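(* Let $p$ be an odd prime. Then the map $v\mapsto\eta\cdot Z(v,q)$ on the Heisenberg algebra $S$ extends by continuity to a natural $\mathbf{Q}_p$-linear map $f\colon S_1\to M_p$. The image of $f$ contains all quasi-modular forms of level one (i.e. $\mathbf{Q}_p[E_2,E_4,E_6]$).
   Context: $S=\mathbf{Q}_p[h_{-1},h_{-2},\ldots]$ is the rank one Heisenberg VOA: for $n<0$, $h_n$ acts on $S$ by multiplication; for $n>0$, $h_n$ acts as $n\,\partial/\partial h_{-n}$; $h_0=0$; it has its usual VOA structure with vacuum $\mathbf{1}=1$, $Y(h_{-1},z)=\sum_nh_nz^{-n-1}$, conformal vector $\omega=\tfrac12h_{-1}^2$, central charge $1$, and $\prod_ih_{-n_i}$ has weight $\sum_in_i$. Write $S^{(n)}$ for the weight $n$ subspace, and $Y(v,z)=\sum_nv(n)z^{-n-1}$. $S_1$ is the completion of $S$ for the norm $|\cdot|_1$ given by the supremum of the $p$-adic absolute values of the coefficients of a polynomial in the monomials in the $h_{-n}$. For $v\in S$ homogeneous of weight $k$ its zero mode is $o(v)=v(k-1)$, extended linearly to $S$; it preserves each $S^{(n)}$. The character of $v$ is $Z(v,q)=q^{-1/24}\sum_{n\ge0}\mathrm{Tr}_{S^{(n)}}(o(v))q^n$. Here $\eta=q^{1/24}\prod_{n\ge1}(1-q^n)$ and $E_2,E_4,E_6$ are the Eisenstein series of level one, all identified with their $q$-expansions. $M_p$ is Serre's ring of $p$-adic modular forms: the completion of $\mathbf{Q}_p[E_4,E_6]$ with respect to the sup-norm on coefficients of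 $q$-expansions, viewed as a ring of $q$-expansions in $\mathbf{Q}_p[[q]]$. For odd $p$, Serre proved $\mathbf{Q}_p[E_2,E_4,E_6]\subseteq M_p$. *)

(* Defs.v *)
From HB Require Import structures.
From mathcomp Require Import all_boot all_order all_algebra.
From mathcomp Require Import finmap generic_quotient ring_quotient.
From mathcomp Require Import boolp classical_sets functions cardinality fsbigop.
From mathcomp Require Import monalg ring lra.

Set Implicit Arguments.
Unset Strict Implicit.
Unset Printing Implicit Defensive.
Import Order.TTheory GRing.Theory Num.Theory.
Local Open Scope quotient_scope.
Local Open Scope classical_set_scope.
Local Open Scope ring_scope.

(* Every norm in play (p-adic absolute values and suprema of them) takes values
   in p^Z U {0}, so [rat] suffices as value type. MathComp's [normedZmodType]
   imposes `|x *+ n| = `|x| *+ n, which excludes ultrametric norms. *)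
HB.mixin Record isUNorm V of GRing.Zmodule V := {
  unorm : V -> rat;
  unorm_eq0 : forall x, (unorm x == 0) = (x == 0);
  unormB : forall x y, unorm (x - y) <= Num.max (unorm x) (unorm y)
}.

#[short(type="uNormZmodType")]
HB.structure Definition UNormZmod := {V of GRing.Zmodule V & isUNorm V}.

HB.mixin Record isUNormMul K of GRing.Field K & UNormZmod K := {
  unormM : forall x y : K, unorm (x * y) = unorm x * unorm y
}.

#[short(type="uNormFieldType")]
HB.structure Definition UNormField :=
  {K of GRing.Field K & UNormZmod K & isUNormMul K}.

HB.mixin Record isUNormScale (K : uNormFieldType) V
    of GRing.Lmodule K V & UNormZmod V := {
  unormZ : forall (a : K) (x : V), unorm (a *: x) = unorm a * unorm x
}.

#[short(type="uNormLmodType")]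
HB.structure Definition UNormLmod (K : uNormFieldType) :=
  {V of GRing.Lmodule K V & UNormZmod V & isUNormScale K V}.

Section UNormTheory.
Variable V : uNormZmodType.
Implicit Types x y : V.

Lemma unorm0 : unorm (0 : V) = 0.
Proof. by apply/eqP; rewrite unorm_eq0. Qed.

Lemma unorm_ge0 x : 0 <= unorm x.
Proof. by have := unormB x x; rewrite subrr unorm0 maxxx. Qed.

Lemma unormN x : unorm (- x) = unorm x.
Proof.
suff h (z : V) : unorm (- z) <= unorm z.
  by apply/eqP; rewrite eq_le h /= -{1}(opprK x) h.
by have := unormB 0 z; rewrite sub0r unorm0 (max_r (unorm_ge0 z)).
Qed.

Lemma unormD x y : unorm (x + y) <= Num.max (unorm x) (unorm y).
Proof. by rewrite -(opprK y) (le_trans (unormB _ _)) // unormN opprK. Qed.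

Lemma unorm_distC x y : unorm (x - y) = unorm (y - x).
Proof. by rewrite -unormN opprB. Qed.

Lemma unormD_lt x y e : unorm x < e -> unorm y < e -> unorm (x + y) < e.
Proof. by move=> hx hy; rewrite (le_lt_trans (unormD _ _)) // gt_max hx. Qed.

Lemma unormB_lt x y e : unorm x < e -> unorm y < e -> unorm (x - y) < e.
Proof. by move=> hx hy; apply: unormD_lt; rewrite ?unormN. Qed.

Lemma unorm_gt0 x : (0 < unorm x) = (x != 0).
Proof. by rewrite lt_neqAle unorm_ge0 andbT eq_sym unorm_eq0. Qed.

Lemma unorm_isosceles x y : unorm (x - y) < unorm x -> unorm y = unorm x.
Proof.
move=> h; apply/eqP; rewrite eq_le; apply/andP; split.
  have := unormB x (x - y); rewrite opprB addrC subrK => /le_trans; apply.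
  by rewrite ge_max lexx ltW.
rewrite leNgt; apply/negP => hy.
by have := unormD_lt h hy; rewrite subrK ltxx.
Qed.

End UNormTheory.

Section Completion.
Variable V : uNormZmodType.

Definition cauchy_seq (u : nat -> V) : Prop :=
  forall e : rat, 0 < e -> exists N, forall m n,
    (N <= m)%N -> (N <= n)%N -> unorm (u m - u n) < e.

Definition null_seq (u : nat -> V) : Prop :=
  forall e : rat, 0 < e -> exists N, forall n, (N <= n)%N -> unorm (u n) < e.

Definition cauchy_pred : {pred nat -> V} := fun u => `[< cauchy_seq u >].

Lemma cauchy_zmod_closed : zmod_closed cauchy_pred.
Proof.
split=> [|u v /asboolP hu /asboolP hv]; apply/asboolP => e e0.
  by exists 0%N => m n _ _; rewrite subrr unorm0.
have [N hN] := hu e e0; have [M hM] := hv e e0.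
exists (maxn N M) => m n; rewrite !geq_max => /andP[a b] /andP[c d].
rewrite (_ : _ - _ = (u m - u n) - (v m - v n)); last first.
  by rewrite /= !opprB addrACA [RHS]addrACA; congr (_ + _); rewrite addrC.
by apply: unormB_lt; [exact: hN | exact: hM].
Qed.

HB.instance Definition _ :=
  GRing.isZmodClosed.Build (nat -> V) cauchy_pred cauchy_zmod_closed.

Record cauchy : Type := Cauchy {
  cauchy_val :> nat -> V;
  cauchy_valP : cauchy_pred cauchy_val }.

HB.instance Definition _ := [isSub for cauchy_val].
HB.instance Definition _ := [Choice of cauchy by <:].
HB.instance Definition _ := [SubChoice_isSubZmodule of cauchy by <:].

Definition null_pred : {pred cauchy} := fun u => `[< null_seq u >].

Lemma null_zmod_closed : zmod_closed null_pred.
Proof.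
split=> [|u v /asboolP hu /asboolP hv]; apply/asboolP => e e0.
  by exists 0%N => n _; rewrite unorm0.
have [N hN] := hu e e0; have [M hM] := hv e e0.
exists (maxn N M) => n; rewrite geq_max => /andP[a b].
by apply: unormB_lt; [exact: hN | exact: hM].
Qed.

HB.instance Definition _ :=
  GRing.isZmodClosed.Build cauchy null_pred null_zmod_closed.

Definition completion : Type := Quotient.quot null_pred.

HB.instance Definition _ := GRing.Zmodule.on completion.

Definition cpi (u : cauchy) : completion := \pi_(Quotient.quot null_pred) u.
Definition crepr (x : completion) : cauchy :=
  repr (x : Quotient.quot null_pred).

Lemma creprK x : cpi (crepr x) = x.
Proof. exact: reprK. Qed.

Lemma cpiB (u v : cauchy) : cpi (u - v) = cpi u - cpi v.
Proof. exact: (raddfB \pi_(Quotient.quot null_pred)). Qed.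

Lemma cpiD (u v : cauchy) : cpi (u + v) = cpi u + cpi v.
Proof. exact: (raddfD \pi_(Quotient.quot null_pred)). Qed.

Lemma cpi_eq0 (u : cauchy) : cpi u = 0 <-> null_seq u.
Proof.
have -> : (cpi u = 0) <-> (u - 0 \in null_pred).
  rewrite Quotient.idealrBE /cpi; split => [->|/eqP ->].
    by rewrite (raddf0 \pi_(Quotient.quot null_pred)).
  by rewrite (raddf0 \pi_(Quotient.quot null_pred)).
by rewrite subr0; split => /asboolP.
Qed.

Lemma cauchyP (u : cauchy) : cauchy_seq u.
Proof. by case: u => u /= /asboolP. Qed.

Definition mk_cauchy (u : nat -> V) (hu : cauchy_seq u) : cauchy :=
  Cauchy (asboolT hu : cauchy_pred u).

Lemma const_cauchy (x : V) : cauchy_seq (fun=> x).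
Proof. by move=> e e0; exists 0%N => m n _ _; rewrite subrr unorm0. Qed.

Definition to_completion (x : V) : completion :=
  cpi (mk_cauchy (const_cauchy x)).

Definition is_norm_lim (u : nat -> V) (r : rat) : Prop :=
  forall e : rat, 0 < e -> exists N, forall n,
    (N <= n)%N -> `|unorm (u n) - r| < e.

Definition completion_norm (x : completion) : rat :=
  xget 0 [set r | is_norm_lim (crepr x) r].

Lemma norm_lim_unique u r s : is_norm_lim u r -> is_norm_lim u s -> r = s.
Proof.
move=> hr hs; apply/eqP; rewrite -subr_eq0 -normr_le0 leNgt; apply/negP => h.
have h2 : 0 < `|r - s| / 2 by rewrite divr_gt0.
have [N hN] := hr _ h2; have [M hM] := hs _ h2.
have a := hN _ (leq_maxl N M); have b := hM _ (leq_maxr N M).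
suff : `|r - s| < `|r - s| by rewrite ltxx.
rewrite [X in _ < X]splitr (le_lt_trans _ (ltrD a b)) //.
rewrite [X in _ <= X + _]distrC (le_trans _ (ler_normD _ _)) //.
by rewrite addrA subrK.
Qed.

(* By the ultrametric inequality, norms along a Cauchy sequence stabilize. *)
Lemma norm_lim_dichotomy (u : cauchy) : null_seq u \/
  exists2 c, 0 < c & exists N, forall n, (N <= n)%N -> unorm (u n) = c.
Proof.
case: (pselect (null_seq u)) => [|/existsNP[e /not_implyP[e0 /forallNP h]]].
  by left.
right; have [N hN] := cauchyP u e0.
have /existsNP[n /not_implyP[nN /negP]] := h N.
rewrite -leNgt => eu; exists (unorm (u n)); first exact: lt_le_trans eu.
by exists N => m mN; apply: unorm_isosceles; apply: lt_le_trans eu; apply: hN.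
Qed.

Lemma null_norm_lim (u : nat -> V) : null_seq u <-> is_norm_lim u 0.
Proof.
by split=> h e e0; have [N hN] := h e e0; exists N => n nN;
  have := hN n nN; rewrite subr0 ger0_norm ?unorm_ge0.
Qed.

Lemma norm_lim_ex (u : cauchy) : exists r, is_norm_lim u r.
Proof.
case: (norm_lim_dichotomy u) => [/null_norm_lim|[c c0 [N hN]]]; first by exists 0.
by exists c => e e0; exists N => n /hN ->; rewrite subrr normr0.
Qed.

Lemma unorm_dist_le (x y : V) : `|unorm x - unorm y| <= unorm (x - y).
Proof.
rewrite ler_norml.
have hx : unorm x <= unorm y + unorm (x - y).
  rewrite -[in X in X <= _](subrK y x) (le_trans (unormD _ _)) //.
  by rewrite ge_max lerDr unorm_ge0 lerDl unorm_ge0.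
have hy : unorm y <= unorm (x - y) + unorm x.
  rewrite -[in X in X <= _](subKr x y) (le_trans (unormB _ _)) //.
  by rewrite ge_max lerDr unorm_ge0 lerDl unorm_ge0.
by apply/andP; split; lra.
Qed.

Lemma completion_normP (u : cauchy) : is_norm_lim u (completion_norm (cpi u)).
Proof.
rewrite /completion_norm; set v := crepr _.
have hv : is_norm_lim v (xget 0 [set r | is_norm_lim v r]).
  by have [r hr] := norm_lim_ex v; apply: (xgetPex 0 (ex_intro _ r hr)).
have huv : null_seq (u - v : cauchy).
  by apply/cpi_eq0; rewrite cpiB /v creprK subrr.
move=> e e0; have e2 : 0 < e / 2 by rewrite divr_gt0.
have [N hN] := hv _ e2; have [M hM] := huv _ e2.
exists (maxn N M) => n; rewrite geq_max => /andP[nN nM].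
rewrite [X in _ < X]splitr (le_lt_trans _ (ltrD (hM _ nM) (hN _ nN))) //.
rewrite (le_trans _ (lerD (unorm_dist_le _ _) (lexx _))) //.
by rewrite (le_trans _ (ler_normD _ _)) // addrA subrK.
Qed.

Lemma completion_norm_eq (u : cauchy) r :
  is_norm_lim u r -> completion_norm (cpi u) = r.
Proof. exact/norm_lim_unique/completion_normP. Qed.

Lemma completion_norm_ge0 x : 0 <= completion_norm x.
Proof.
rewrite -(creprK x); case: (norm_lim_dichotomy (crepr x)).
  by move=> /null_norm_lim /completion_norm_eq ->.
case=> c c0 [N hN]; rewrite (@completion_norm_eq _ c) ?ltW // => e e0.
by exists N => n /hN ->; rewrite subrr normr0.
Qed.

Lemma completion_norm_eq0 x : (completion_norm x == 0) = (x == 0).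
Proof.
rewrite -(creprK x); apply/eqP/eqP => [h|/cpi_eq0/null_norm_lim].
  by apply/cpi_eq0/null_norm_lim; rewrite -h; exact: completion_normP.
exact: completion_norm_eq.
Qed.

Lemma completion_normB x y :
  completion_norm (x - y) <= Num.max (completion_norm x) (completion_norm y).
Proof.
rewrite leNgt; apply/negP; rewrite gt_max => /andP[].
rewrite -(creprK x) -(creprK y) -cpiB; set u := crepr x; set v := crepr y.
set c := completion_norm (cpi (u - v)) => hu hv.
pose d := Num.max (completion_norm (cpi u)) (completion_norm (cpi v)).
have dc : d < c by rewrite gt_max hu.
have e0 : 0 < (c - d) / 2 by rewrite divr_gt0 // subr_gt0.
have [N1 h1] := completion_normP u e0.
have [N2 h2] := completion_normP v e0.
have [N3 h3] := completion_normP (u - v) e0.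
pose n := maxn N1 (maxn N2 N3).
have {h1} := h1 n (leq_maxl _ _).
have {h2} := h2 n (leq_trans (leq_maxl _ _) (leq_maxr _ _)).
have {h3} := h3 n (leq_trans (leq_maxr _ _) (leq_maxr _ _)).
rewrite -/c => /ltr_distlCBl h3 /ltr_distlDr h2 /ltr_distlDr h1.
have := unormB (u n) (v n); rewrite leNgt => /negP; apply.
have du : completion_norm (cpi u) <= d by rewrite le_max lexx.
have dv : completion_norm (cpi v) <= d by rewrite le_max lexx orbT.
have {}h3 : c - (c - d) / 2 < unorm (u n - v n) by exact: h3.
clearbody c d; by rewrite gt_max; apply/andP; split; lra.
Qed.

HB.instance Definition _ :=
  isUNorm.Build completion completion_norm_eq0 completion_normB.

Lemma unorm_to_completion (x : V) : unorm (to_completion x) = unorm x.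
Proof.
apply: completion_norm_eq => e e0; exists 0%N => n _.
by rewrite subrr normr0.
Qed.

Lemma to_completionB x y :
  to_completion (x - y) = to_completion x - to_completion y.
Proof. by rewrite /to_completion -cpiB; congr cpi; exact: val_inj. Qed.

Lemma to_completion_dense (x : completion) (e : rat) : 0 < e ->
  exists v, unorm (x - to_completion v) < e.
Proof.
move=> e0; have e2 : 0 < e / 2 by rewrite divr_gt0.
have [N hN] := cauchyP (crepr x) e2.
exists (crepr x N); rewrite -{1}(creprK x) -cpiB.
have [M hM] := completion_normP
  (crepr x - mk_cauchy (const_cauchy (crepr x N))) e2.
have := hM _ (leq_maxl M N) => /ltr_distlCDr /lt_trans; apply.
by rewrite [X in _ < X]splitr ltrD2r; apply: hN => //; exact: leq_maxr.
Qed.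

End Completion.

Lemma completion_complete (V : uNormZmodType) (x : nat -> completion V) :
  cauchy_seq x -> exists l, null_seq (fun n => x n - l).
Proof.
move=> hx.
have ie n : 0 < n.+1%:R^-1 :> rat by rewrite invr_gt0.
pose u n := projT1 (cid (to_completion_dense (x n) (ie n))).
have hu n : unorm (x n - to_completion (u n)) < n.+1%:R^-1.
  by rewrite /u; case: cid.
have small (e : rat) : 0 < e ->
    exists N, forall n, (N <= n)%N -> n.+1%:R^-1 < e.
  move=> e0; exists (Num.bound e^-1) => n hn.
  rewrite -[e]invrK ltf_pV2 ?posrE ?invr_gt0 //.
  apply: (lt_trans (archi_boundP _)); first by rewrite invr_ge0 ltW.
  by rewrite ltr_nat ltnS.
have cu : cauchy_seq u.
  move=> e e0; have [N hN] := hx e e0; have [M hM] := small e e0.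
  exists (maxn N M) => m n; rewrite !geq_max => /andP[a b] /andP[c d].
  rewrite -unorm_to_completion to_completionB.
  rewrite (_ : _ - _ = (x m - x n) - ((x m - to_completion (u m))
     - (x n - to_completion (u n)))); last first.
    by rewrite [- (_ - (_ - _))]opprB opprB addrA [_ + (x n - _)]addrA subrK
      addrC addrA subrK.
  apply: unormB_lt; first exact: hN.
  by apply: unormB_lt; apply: lt_trans (hu _) (hM _ _).
exists (cpi (mk_cauchy cu)) => e e0.
have e2 : 0 < e / 2 by rewrite divr_gt0.
have [N hN] := cu _ e2; have [M hM] := small e e0.
exists (maxn N M) => n; rewrite geq_max => /andP[a b].
rewrite -(subrK (to_completion (u n)) (x n)) -addrA.
apply: unormD_lt; first exact: lt_trans (hu _) (hM _ _).
rewrite -cpiB.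
have [K hK] := completion_normP
  (mk_cauchy (const_cauchy (u n)) - mk_cauchy cu) e2.
have := hK _ (leq_maxl K N) => /ltr_distlCDr /lt_trans; apply.
by rewrite [X in _ < X]splitr ltrD2r; apply: hN => //; exact: leq_maxr.
Qed.

Section CompletionField.
Variable K : uNormFieldType.
Local Notation C := (cauchy K).

Lemma unorm1 : unorm (1 : K) = 1.
Proof.
have n0 : unorm (1 : K) != 0 by rewrite unorm_eq0 oner_eq0.
by apply: (mulfI n0); rewrite -unormM !mulr1.
Qed.

Lemma unormV (x : K) : unorm x^-1 = (unorm x)^-1.
Proof.
have [->|x0] := eqVneq x 0; first by rewrite invr0 unorm0 invr0.
have n0 : unorm x != 0 by rewrite unorm_eq0.
by apply: (mulfI n0); rewrite -unormM !divff // unorm1.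
Qed.

Lemma cauchy_bounded (u : C) :
  exists2 B, 0 < B & exists N, forall n, (N <= n)%N -> unorm (u n) < B.
Proof.
have [N hN] := cauchyP u (ltr01 : (0 : rat) < 1).
exists (1 + unorm (u N)); first by rewrite ltr_wpDr ?unorm_ge0.
exists N => n nN; rewrite -(subrK (u N) (u n)).
apply: unormD_lt; last by rewrite ltrDr.
by rewrite (lt_le_trans (hN _ _ nN (leqnn N))) // lerDl unorm_ge0.
Qed.

Lemma cauchy_mul_subproof (u v : C) : cauchy_seq (fun n => u n * v n).
Proof.
move=> e e0; have [A A0 [N1 h1]] := cauchy_bounded u.
have [B B0 [N2 h2]] := cauchy_bounded v.
have [N3 h3] := cauchyP u (divr_gt0 e0 B0).
have [N4 h4] := cauchyP v (divr_gt0 e0 A0).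
exists (maxn (maxn N1 N2) (maxn N3 N4)) => m n.
rewrite !geq_max => /andP[/andP[m1 m2] /andP[m3 m4]].
move=> /andP[/andP[n1 n2] /andP[n3 n4]].
rewrite (_ : _ - _ = u m * (v m - v n) + (u m - u n) * v n); last first.
  by rewrite mulrBr mulrBl addrA subrK.
apply: unormD_lt; rewrite unormM.
  rewrite -(divfK (lt0r_neq0 A0) e) mulrC.
  by apply: ltr_pM; rewrite ?unorm_ge0 ?h1 ?h4.
rewrite -(divfK (lt0r_neq0 B0) e).
by apply: ltr_pM; rewrite ?unorm_ge0 ?h2 ?h3.
Qed.

Definition cauchy_mul (u v : C) : C := mk_cauchy (@cauchy_mul_subproof u v).
Definition cauchy_one : C := mk_cauchy (const_cauchy (1 : K)).

Let cmulA : associative cauchy_mul.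
Proof. by move=> u v w; apply/val_inj/funext => n /=; rewrite mulrA. Qed.
Let cmulC : commutative cauchy_mul.
Proof. by move=> u v; apply/val_inj/funext => n /=; rewrite mulrC. Qed.
Let cmul1 : left_id cauchy_one cauchy_mul.
Proof. by move=> u; apply/val_inj/funext => n /=; rewrite mul1r. Qed.
Let cmulD : left_distributive cauchy_mul +%R.
Proof. by move=> u v w; apply/val_inj/funext => n /=; rewrite mulrDl. Qed.
Let cone_neq0 : cauchy_one != 0.
Proof.
apply/eqP => /(congr1 (@cauchy_val K)) /(congr1 (@^~ 0%N)) /= /eqP.
by rewrite oner_eq0.
Qed.

HB.instance Definition _ := GRing.Zmodule_isComNzRing.Build C
  cmulA cmulC cmul1 cmulD cone_neq0.

Let null_proper : 1 \notin @null_pred K /\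
  forall a, {in @null_pred K, forall u, a * u \in @null_pred K}.
Proof.
split=> [|u v /asboolP hv].
  apply/asboolP => /(_ 1 ltr01) [N /(_ N (leqnn N))] /=.
  by rewrite unorm1 ltxx.
apply/asboolP => e e0; have [A A0 [N hN]] := cauchy_bounded u.
have [M hM] := hv _ (divr_gt0 e0 A0); exists (maxn N M) => n.
rewrite geq_max => /andP[n1 n2]; rewrite unormM.
rewrite -(divfK (lt0r_neq0 A0) e) mulrC.
by apply: ltr_pM; rewrite ?unorm_ge0 ?hN ?hM.
Qed.

HB.instance Definition _ := isProperIdeal.Build C (@null_pred K) null_proper.

HB.instance Definition _ := GRing.ComNzRing.copy (completion K)
  (Quotient.quot (@null_pred K)).

Lemma cpiM (u v : C) : cpi (u * v) = cpi u * cpi v.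
Proof. exact: (rmorphM \pi_(Quotient.quot (@null_pred K))). Qed.

Lemma cpi1 : cpi (1 : C) = 1.
Proof. exact: (rmorph1 \pi_(Quotient.quot (@null_pred K))). Qed.

Lemma completion_normM (x y : completion K) :
  unorm (x * y) = unorm x * unorm y.
Proof.
rewrite -(creprK x) -(creprK y) -cpiM; set u := crepr x; set v := crepr y.
have ev (w : C) c : (exists N, forall n, (N <= n)%N -> unorm (w n) = c) ->
    unorm (cpi w) = c.
  case=> N hN; apply: completion_norm_eq => e e0.
  by exists N => n /hN ->; rewrite subrr normr0.
case: (norm_lim_dichotomy u) => [/cpi_eq0 u0|[a a0 [N hN]]].
  by rewrite cpiM u0 mul0r unorm0 mul0r.
case: (norm_lim_dichotomy v) => [/cpi_eq0 v0|[b b0 [M hM]]].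
  by rewrite cpiM v0 mulr0 unorm0 mulr0.
rewrite (ev u a) ?(ev v b); [|by exists M|by exists N].
apply: ev; exists (maxn N M) => n; rewrite geq_max => /andP[n1 n2].
by rewrite unormM hN ?hM.
Qed.

Lemma completion_has_inv (x : completion K) : x != 0 -> exists y, y * x = 1.
Proof.
rewrite -(creprK x) => /eqP x0.
case: (norm_lim_dichotomy (crepr x)) => [/cpi_eq0 //|[c c0 [N hN]]].
set u := crepr x in hN *.
have hv : cauchy_seq (fun n => (u n)^-1).
  move=> e e0; have [M hM] := cauchyP u (mulr_gt0 e0 (mulr_gt0 c0 c0)).
  exists (maxn N M) => m n; rewrite !geq_max => /andP[m1 m2] /andP[n1 n2].
  have um : u m != 0 by rewrite -unorm_gt0 hN.
  have un : u n != 0 by rewrite -unorm_gt0 hN.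
  rewrite (_ : _ - _ = (u n - u m) * (u m * u n)^-1); last first.
    by field; rewrite um un.
  rewrite unormM unormV unormM !hN // ltr_pdivrMr ?mulr_gt0 //.
  exact: hM.
exists (cpi (mk_cauchy hv)); rewrite -cpiM -cpi1; apply/eqP.
rewrite -subr_eq0 -cpiB; apply/eqP/cpi_eq0 => e e0; exists N => n nN /=.
have un : u n != 0 by rewrite -unorm_gt0 hN.
rewrite [X in unorm X](_ : _ = (u n)^-1 * u n - 1) //.
by rewrite mulVf // subrr unorm0.
Qed.

Definition completion_inv (x : completion K) : completion K :=
  xget 0 [set y | x != 0 /\ y * x = 1].

Let cinvP (x : completion K) : x != 0 -> completion_inv x * x = 1.
Proof.
move=> x0; have [y yx] := completion_has_inv x0.
rewrite /completion_inv; case: xgetP => [z _ [] //|/(_ y) []]; by split.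
Qed.

Let cinv0 : completion_inv 0 = 0.
Proof. by rewrite /completion_inv; case: xgetP => // y _ []; rewrite eqxx. Qed.

HB.instance Definition _ :=
  GRing.ComNzRing_isField.Build (completion K) cinvP cinv0.
HB.instance Definition _ := isUNormMul.Build (completion K) completion_normM.

End CompletionField.

Section CompletionLmod.
Variables (K : uNormFieldType) (V : uNormLmodType K).

Lemma cauchy_scale_subproof (a : K) (u : cauchy V) :
  cauchy_seq (fun n => a *: u n).
Proof.
move=> e e0; have [->|a0] := eqVneq a 0.
  by exists 0%N => m n _ _; rewrite !scale0r subrr unorm0.
have na : 0 < unorm a by rewrite unorm_gt0.
have [N hN] := cauchyP u (divr_gt0 e0 na); exists N => m n hm hn.
by rewrite -scalerBr unormZ mulrC -ltr_pdivlMr // hN.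
Qed.

Definition cauchy_scale (a : K) (u : cauchy V) : cauchy V :=
  mk_cauchy (@cauchy_scale_subproof a u).

Definition completion_scale (a : K) (x : completion V) : completion V :=
  cpi (cauchy_scale a (crepr x)).

Lemma completion_scaleE a u : completion_scale a (cpi u) = cpi (cauchy_scale a u).
Proof.
apply/eqP; rewrite -subr_eq0 -cpiB; apply/eqP/cpi_eq0.
have : null_seq (crepr (cpi u) - u).
  by apply/cpi_eq0; rewrite cpiB creprK subrr.
move=> h e e0; have [->|a0] := eqVneq a 0.
  exists 0%N => n _ /=; rewrite [X in unorm X](_ : _ = 0) ?unorm0 //.
  by rewrite -[LHS]/(0 *: _ - 0 *: _) !scale0r subrr.
have na : 0 < unorm a by rewrite unorm_gt0.
have [N hN] := h _ (divr_gt0 e0 na); exists N => n hn.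
rewrite -[X in unorm X]/(a *: crepr (cpi u) n - a *: u n).
by rewrite -scalerBr unormZ mulrC -ltr_pdivlMr // hN.
Qed.

Let scA a b v :
  completion_scale a (completion_scale b v) = completion_scale (a * b) v.
Proof.
rewrite -(creprK v) !completion_scaleE; congr cpi.
by apply/val_inj/funext => n /=; rewrite scalerA.
Qed.
Let sc1 : left_id 1 completion_scale.
Proof.
move=> v; rewrite -(creprK v) !completion_scaleE; congr cpi.
by apply/val_inj/funext => n /=; rewrite scale1r.
Qed.
Let scDr : right_distributive completion_scale +%R.
Proof.
move=> a u v; rewrite -(creprK u) -(creprK v) -cpiD !completion_scaleE -cpiD.
by congr cpi; apply/val_inj/funext => n /=; rewrite scalerDr.
Qed.
Let scDl v : {morph completion_scale^~ v : a b / a + b}.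
Proof.
move=> a b; rewrite -(creprK v) !completion_scaleE -cpiD.
by congr cpi; apply/val_inj/funext => n /=; rewrite scalerDl.
Qed.

HB.instance Definition _ := GRing.Zmodule_isLmodule.Build K (completion V)
  scA sc1 scDr scDl.

Let scN (a : K) (x : completion V) : unorm (a *: x) = unorm a * unorm x.
Proof.
rewrite -(creprK x) [_ *: _]completion_scaleE; set u := crepr x.
have ev (w : cauchy V) c : (exists N, forall n, (N <= n)%N -> unorm (w n) = c)
    -> unorm (cpi w) = c.
  case=> N hN; apply: completion_norm_eq => e e0.
  by exists N => n /hN ->; rewrite subrr normr0.
case: (norm_lim_dichotomy u) => [/cpi_eq0 u0|[b b0 [N hN]]].
  rewrite -completion_scaleE u0 unorm0 mulr0.
  by rewrite -[completion_scale _ _]/(a *: (0 : completion V)) scaler0 unorm0.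
rewrite (ev u b); last by exists N.
by apply: ev; exists N => n nN /=; rewrite unormZ hN.
Qed.

HB.instance Definition _ := isUNormScale.Build K (completion V) scN.

End CompletionLmod.

Definition padic_norm (p : nat) (x : rat) : rat :=
  if x == 0 then 0
  else p%:R ^ ((logn p `|denq x|)%:Z - (logn p `|numq x|)%:Z).

Definition padic_rat (p : nat) (hp : prime p) : Type := rat.

Section PadicRat.
Variables (p : nat) (hp : prime p).

Let p1 : 1 < p%:R :> rat. Proof. by rewrite ltr1n prime_gt1. Qed.
Let p0 : p%:R != 0 :> rat. Proof. by rewrite pnatr_eq0 -lt0n prime_gt0. Qed.

Lemma padic_norm_frac (a b : int) : a != 0 -> b != 0 ->
  padic_norm p (a%:~R / b%:~R) =
    p%:R ^ ((logn p `|b|)%:Z - (logn p `|a|)%:Z).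
Proof.
move=> a0 b0; set x := a%:~R / b%:~R.
have ra : a%:~R != 0 :> rat by rewrite intr_eq0.
have rb : b%:~R != 0 :> rat by rewrite intr_eq0.
have x0 : x != 0 by rewrite mulf_neq0 ?invr_eq0.
rewrite /padic_norm (negPf x0); congr (_ ^ _).
have : (a * denq x = numq x * b)%R.
  apply/eqP; rewrite -(eqr_int rat) !intrM.
  by rewrite numqE mulrAC {2}/x divfK.
move=> /(congr1 (logn p \o absz)) /=; rewrite !abszM.
rewrite !lognM ?absz_gt0 ?denq_neq0 ?numq_eq0 // => h.
apply/eqP; rewrite subr_eq addrAC eq_sym subr_eq -!PoszD; apply/eqP; congr Posz.
by rewrite addnC -h addnC.
Qed.

Let padic_norm_eq0 (x : rat) : (padic_norm p x == 0) = (x == 0).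
Proof.
rewrite /padic_norm; case: ifP => [_|_]; first by rewrite eqxx.
by rewrite expfz_eq0 (negPf p0) andbF.
Qed.

Let padic_normB (x y : rat) :
  padic_norm p (x - y) <= Num.max (padic_norm p x) (padic_norm p y).
Proof.
have ge0 z : 0 <= padic_norm p z.
  by rewrite /padic_norm; case: ifP => // _; rewrite exprz_ge0 // ler0n.
have [->|x0] := eqVneq x 0.
  rewrite sub0r le_max; apply/orP; right.
  by rewrite /padic_norm oppr_eq0 denqN numqN abszN.
have [->|y0] := eqVneq y 0; first by rewrite subr0 le_max lexx.
have [->|xy0] := eqVneq (x - y) 0; first by rewrite {1}/padic_norm eqxx le_max ge0.
have [a [c [e [a0 c0 e0 [xE yE]]]]] : exists a c e : int,
    [/\ a != 0, c != 0, e != 0 & x = a%:~R / e%:~R /\ y = c%:~R / e%:~R].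
  exists (numq x * denq y), (numq y * denq x), (denq x * denq y).
  rewrite !mulf_neq0 ?numq_eq0 ?denq_neq0 //; split=> //.
  have dx : (denq x)%:~R != 0 :> rat by rewrite intr_eq0 denq_neq0.
  have dy : (denq y)%:~R != 0 :> rat by rewrite intr_eq0 denq_neq0.
  by rewrite !intrM !numqE; split; field; rewrite dx dy.
have xyE : x - y = (a - c)%:~R / e%:~R by rewrite xE yE intrB mulrBl.
have ac0 : a - c != 0.
  by apply: contraNneq xy0 => ac; rewrite xyE ac mul0r.
rewrite xyE xE yE !padic_norm_frac // le_max !ler_eXz2l //.
rewrite !lerD2l !lerN2 !lez_nat.
have aa : (0 < `|a|)%N by rewrite absz_gt0.
have cc : (0 < `|c|)%N by rewrite absz_gt0.
have mm : (0 < `|a - c|)%N by rewrite absz_gt0.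
suff : (minn (logn p `|a|) (logn p `|c|) <= logn p `|(a - c)%R|)%N.
  by rewrite geq_min.
set k := minn _ _.
have : ((p ^ k)%:Z %| a - c)%Z.
  apply: rpredB; rewrite dvdzE absz_nat pfactor_dvdn //.
    exact: geq_minl.
  exact: geq_minr.
by rewrite dvdzE absz_nat pfactor_dvdn.
Qed.

HB.instance Definition _ := GRing.Field.copy (padic_rat hp) rat.
HB.instance Definition _ :=
  isUNorm.Build (padic_rat hp) padic_norm_eq0 padic_normB.

Let padic_normM (x y : rat) :
  padic_norm p (x * y) = padic_norm p x * padic_norm p y.
Proof.
have [->|x0] := eqVneq x 0; first by rewrite mul0r /padic_norm eqxx mul0r.
have [->|y0] := eqVneq y 0; first by rewrite mulr0 /padic_norm eqxx mulr0.
have nx : numq x != 0 by rewrite numq_eq0.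
have ny : numq y != 0 by rewrite numq_eq0.
have dx := denq_neq0 x; have dy := denq_neq0 y.
have -> : x * y = (numq x * numq y)%:~R / (denq x * denq y)%:~R.
  by rewrite !intrM invfM mulrACA !divq_num_den.
rewrite padic_norm_frac ?mulf_neq0 // /padic_norm (negPf x0) (negPf y0).
rewrite -expfzDr // !abszM !lognM ?absz_gt0 // !PoszD opprD.
by congr (_ ^ _); rewrite addrACA.
Qed.

HB.instance Definition _ := isUNormMul.Build (padic_rat hp) padic_normM.

End PadicRat.

Definition Qp (p : nat) (hp : prime p) : Type := completion (padic_rat hp).
HB.instance Definition _ p hp := UNormField.on (@Qp p hp).

(* [f : qseries K] is the formal power series \sum_n f n q^n; the product is
   the Cauchy product, not the pointwise one that [nat -> K] carries. *)
Definition qseries (K : Type) : Type := nat -> K.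

Section QSeries.
Variable K : comNzRingType.
Implicit Types f g h : qseries K.

HB.instance Definition _ := GRing.Lmodule.copy (qseries K) (nat -> K^o).

Definition qone : qseries K := fun n => (n == 0%N)%:R.
Definition qmul f g : qseries K := fun n => \sum_(i < n.+1) f i * g (n - i)%N.

Let trunc N f : {poly K} := \poly_(i < N.+1) f i.

Let qmulE N f g n : (n <= N)%N -> qmul f g n = (trunc N f * trunc N g)`_n.
Proof.
move=> nN; rewrite coefM; apply: eq_bigr => i _; rewrite !coef_poly !ltnS.
by rewrite (leq_trans (leq_subr _ _) nN) (leq_trans (leq_ord i) nN).
Qed.

Let qmulC : commutative qmul.
Proof. by move=> f g; apply/funext => n; rewrite !(@qmulE n) // mulrC. Qed.

Let qmulA : associative qmul.
Proof.
have h f g k n : qmul (qmul f g) k n = (trunc n f * trunc n g * trunc n k)`_n.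
  rewrite coefM; apply: eq_bigr => i _.
  by rewrite (@qmulE n) ?leq_ord // coef_poly ltnS leq_subr.
by move=> f g k; apply/funext => n; rewrite qmulC !h mulrC mulrA.
Qed.

Let qmul1 : left_id qone qmul.
Proof.
move=> f; apply/funext => n; rewrite /qmul big_ord_recl /= mul1r subn0.
by rewrite big1 ?addr0 // => i _; rewrite mul0r.
Qed.

Let qmulDl : left_distributive qmul +%R.
Proof.
move=> f g h; apply/funext => n; rewrite -[RHS]/(qmul f h n + qmul g h n).
by rewrite -big_split; apply: eq_bigr => i _; exact: mulrDl.
Qed.

Let qone_neq0 : qone != 0.
Proof.
by apply/eqP => /(congr1 (@^~ 0%N)) /eqP; rewrite /qone /= oner_eq0.
Qed.

HB.instance Definition _ := GRing.Zmodule_isComNzRing.Build (qseries K)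
  qmulA qmulC qmul1 qmulDl qone_neq0.

Let qscaleAl (a : K) f g : a *: (f * g) = (a *: f) * g.
Proof.
apply/funext => n; rewrite -[LHS]/(a * qmul f g n) mulr_sumr.
by apply: eq_bigr => i _; rewrite mulrA.
Qed.

HB.instance Definition _ :=
  GRing.Lmodule_isLalgebra.Build K (qseries K) qscaleAl.

(* [(r, f)] stands for q^r f with r rational. *)
Definition qshift_mul (x y : rat * qseries K) : rat * qseries K :=
  (x.1 + y.1, x.2 * y.2).

(* The coefficient of q^n in \prod_(m >= 1) (1 - q^m) only involves m <= n. *)
Definition euler_product : qseries K :=
  fun n => (\prod_(1 <= m < n.+1) (1 - 'X^m) : {poly K})`_n.

Definition dedekind_eta : rat * qseries K := (24%:R^-1, euler_product).

Definition sigma (k n : nat) : nat := (\sum_(d <- divisors n) d ^ k)%N.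

Definition E2 : qseries K :=
  fun n => if n == 0%N then 1 else - 24%:R * (sigma 1 n)%:R.
Definition E4 : qseries K :=
  fun n => if n == 0%N then 1 else 240%:R * (sigma 3 n)%:R.
Definition E6 : qseries K :=
  fun n => if n == 0%N then 1 else - 504%:R * (sigma 5 n)%:R.

Inductive gen_subalg (G : set (qseries K)) : set (qseries K) :=
| gen_subalg_const a : gen_subalg G a%:A
| gen_subalg_gen g : G g -> gen_subalg G g
| gen_subalg_add f g :
    gen_subalg G f -> gen_subalg G g -> gen_subalg G (f + g)
| gen_subalg_mul f g :
    gen_subalg G f -> gen_subalg G g -> gen_subalg G (f * g).

Definition modular_forms : set (qseries K) := gen_subalg [set E4; E6].
Definition quasi_modular_forms : set (qseries K) :=
  gen_subalg (E2 |` [set E4; E6]).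

End QSeries.

Arguments dedekind_eta K : clear implicits.
Arguments quasi_modular_forms K : clear implicits.
Arguments modular_forms K : clear implicits.

Definition sup_dist_le (K : uNormZmodType) (f g : qseries K) (e : rat) : Prop :=
  forall n, unorm (f n - g n) <= e.

(* The space of bounded q-expansions is complete for the sup-norm, so the
   completion of [modular_forms K], viewed inside K[[q]], is its closure. *)
Definition padic_modular_forms (K : uNormFieldType) : set (qseries K) :=
  [set f | forall e : rat, 0 < e ->
     exists2 g, modular_forms K g & sup_dist_le f g e].

Arguments padic_modular_forms K : clear implicits.

(* The i-th variable is h_{-(i+1)}: the monomial [m : {cmonom nat}] stands for
   the product of the h_{-(i+1)} ^ (m i). *)
Definition heis (K : comNzRingType) : Type := {malg K[{cmonom nat}]}.
HB.instance Definition _ (K : comNzRingType) := GRing.ComAlgebra.on (heis K).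

Section Heisenberg.
Variable K : fieldType.
Local Notation S := (heis K).
Implicit Types (u v : S) (m : {cmonom nat}).

Definition mon m : S := << m >>.

Definition dvar (i : nat) (u : S) : S :=
  \sum_(m <- msupp u) << u@_m *+ m i *g divcm m (ucm i) >>.

(* [Negz i] is -(i+1). *)
Definition hmode (n : int) (u : S) : S :=
  match n with
  | Negz i => mon (ucm i) * u
  | Posz 0 => 0
  | Posz i.+1 => i.+1%:R *: dvar i u
  end.

Definition weight m : nat := (\sum_(i <- finsupp m) m i * i.+1)%N.

(* A field a(z) = \sum_n a(n) z^{-n-1} is given by its modes. *)
Definition vfield : Type := int -> S -> S.

Definition vacuum_field : vfield := fun n u => if n == -1 then u else 0.

Definition binz (x : int) (k : nat) : K :=
  (\prod_(i < k) (x - i%:Z)%:~R) / k`!%:R.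

(* The modes of (1/k!) (d/dz)^k a(z). *)
Definition dfield (k : nat) (a : vfield) : vfield :=
  fun n u => (-1) ^+ k * binz n k *: a (n - k%:Z) u.

(* The modes of the normally ordered product
   :a(z)b(z): = a(z)_- b(z) + b(z) a(z)_+, where a(z)_- gathers the modes a(j)
   with j < 0 and a(z)_+ those with j >= 0. For the fields used here, only
   finitely many terms of these sums are nonzero on a given u. *)
Definition nop (a b : vfield) : vfield := fun n u =>
  \sum_(j \in [set j : int | j < 0]) a j (b (n - j - 1) u)
  + \sum_(j \in [set j : int | 0 <= j]) b (n - j - 1) (a j u).

(* The indices i of the factors h_{-(i+1)} of m, with multiplicities; their
   order is irrelevant, as normally ordered products of derivatives of h(z)
   do not depend on it. *)
Definition factors m : seq nat := flatten [seq nseq (m i) i | i <- finsupp m].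

(* Y(h_{-n_1} ... h_{-n_k}, z) is the normally ordered product of the
   (1/(n_i - 1)!) (d/dz)^(n_i - 1) h(z), with h(z) = Y(h_{-1}, z). *)
Definition Ymon m : vfield :=
  foldr (fun i F => nop (dfield i hmode) F) vacuum_field (factors m).

Definition vertex_op (v : S) : vfield := fun n u =>
  \sum_(m <- msupp v) v@_m *: Ymon m n u.

Definition weight_component (k : nat) (v : S) : S :=
  \sum_(m <- msupp v | weight m == k) v@_m *: mon m.

Definition zero_mode (v u : S) : S :=
  \sum_(k \in [set: nat]) vertex_op (weight_component k v) (k%:Z - 1) u.

(* The trace of f on the weight n subspace, whose basis is the finite set of
   monomials of weight n. *)
Definition weight_trace (n : nat) (f : S -> S) : K :=
  \sum_(m \in [set m | weight m = n]) (f (mon m))@_m.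

(* The central charge is 1, whence the factor q^(-1/24). *)
Definition character (v : S) : rat * qseries K :=
  (- 24%:R^-1, fun n => weight_trace n (zero_mode v)).

End Heisenberg.

Section HeisenbergNorm.
Variable K : uNormFieldType.
Local Notation S := (heis K).

Definition heis_norm (v : S) : rat :=
  \big[Num.max/0]_(m <- msupp v) unorm v@_m.

Let heis_norm_ge (v : S) m : unorm v@_m <= heis_norm v.
Proof.
rewrite /heis_norm; have [mv|/mcoeff_outdom ->] := boolP (m \in msupp v).
  have : m \in (msupp v : seq _) by [].
  elim: (msupp v : seq _) => //= k s IH; rewrite inE big_cons le_max.
  by move=> /orP[/eqP->|/IH->]; rewrite ?lexx ?orbT.
rewrite unorm0; elim/big_rec: _ => // i x _ _.
by rewrite le_max unorm_ge0.
Qed.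

Let heis_norm_le (v : S) c : 0 <= c ->
  (forall m, unorm v@_m <= c) -> heis_norm v <= c.
Proof.
by move=> c0 h; rewrite /heis_norm; elim/big_ind: _ => // x y; rewrite ge_max => ->.
Qed.

Let heis_norm_ge0 (v : S) : 0 <= heis_norm v.
Proof. exact: le_trans (unorm_ge0 _) (heis_norm_ge v (onecm nat)). Qed.

Let heis_norm_eq0 (v : S) : (heis_norm v == 0) = (v == 0).
Proof.
apply/eqP/eqP => [h|->]; last by rewrite /heis_norm msupp0 big_nil.
apply/malgP => m; apply/eqP; rewrite mcoeff0 -unorm_eq0 eq_le unorm_ge0 andbT.
by rewrite -h heis_norm_ge.
Qed.

Let heis_normB (u v : S) : heis_norm (u - v) <= Num.max (heis_norm u) (heis_norm v).
Proof.
apply: heis_norm_le => [|m]; first by rewrite le_max heis_norm_ge0.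
rewrite mcoeffB (le_trans (unormB _ _)) // ge_max !le_max.
by rewrite !heis_norm_ge orbT.
Qed.

HB.instance Definition _ := isUNorm.Build S heis_norm_eq0 heis_normB.

Let heis_normZ (a : K) (v : S) : heis_norm (a *: v) = unorm a * heis_norm v.
Proof.
apply/eqP; rewrite eq_le; apply/andP; split.
  apply: heis_norm_le => [|m]; first by rewrite mulr_ge0 ?unorm_ge0.
  by rewrite mcoeffZ unormM ler_wpM2l ?unorm_ge0 ?heis_norm_ge.
have [->|a0] := eqVneq a 0; first by rewrite unorm0 mul0r.
have na : 0 < unorm a by rewrite unorm_gt0.
rewrite mulrC -ler_pdivlMr //; apply: heis_norm_le => [|m].
  by rewrite divr_ge0 ?unorm_ge0.
by rewrite ler_pdivlMr // mulrC -unormM -mcoeffZ heis_norm_ge.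
Qed.

HB.instance Definition _ := isUNormScale.Build K S heis_normZ.

End HeisenbergNorm.

Definition S1 (p : nat) (hp : prime p) : Type := completion (heis (Qp hp)).
HB.instance Definition _ p hp := UNormLmod.on (@S1 p hp).

(* Continuity for the sup-norm on q-expansions. *)
Definition sup_continuous (V : uNormZmodType) (K : uNormZmodType)
    (f : V -> qseries K) : Prop :=
  forall (x : V) (e : rat), 0 < e -> exists2 d : rat, 0 < d &
    forall y, unorm (y - x) < d -> sup_dist_le (f y) (f x) e.

(* Main.v *)
Require Import Defs.
From HB Require Import structures.
From mathcomp Require Import all_boot all_order all_algebra.
From mathcomp Require Import finmap boolp classical_sets functions cardinality fsbigop.
From mathcomp Require Import monalg ring lra zify cyclic.

(** Let v be a product of variables. Its zero mode is a sum of normally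
    ordered products of Heisenberg modes, with integral coefficients [symbol].
    Moving a mode of index m or -m around a trace weighted by q^L0 multiplies
    the trace by q^m and costs a commutator, which by the Heisenberg relation
    removes one further mode. Solving for the trace gives a factor
    q^m / (1 - q^m). So the trace obeys Wick's rule [trace_series_cons]: the
    first field is contracted with each of the others, and a contraction
    contributes a Lambert series, the [propagator]. The trace of the identity
    is the generating function of partitions, which eta cancels
    ([trace_series_nil]). Hence eta Z(v) is a sum over perfect matchings of
    products of propagators. It has integral coefficients
    ([char_mon_bounded]), so v |-> eta Z(v) is bounded and extends to the
    completion ([cont_ext]).

    A propagator is a linear combination of the series
    sum_n sigma_e(n) q^n with e odd ([propagator_poly]). Hence it suffices to
    show that these are p-adic modular forms. For e >= 3 they are polynomials
    in E4 and E6 ([sigma_series_modular]): counting the positive solutions of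
    a x + b y = n with a weight that is invariant under a rotation of order six
    gives a recursion among them in which e = 1 does not occur. For e = 1,
    Euler's congruence makes the series with the divisors prime to p a limit of
    series with larger e; the divisors divisible by p are then recovered by a
    convergent sum over the substitutions q -> q^(p^i) ([pmf_sigma1]). As p-adic
    modular forms are a closed subalgebra, eta Z(v) is one for every v in the
    completion.

    For the image, the symbols are replaced by the powers of j, whose
    propagators are single Eisenstein series. With the three powers j^0, j^1
    and j^2, the fields paired with their own kind produce every monomial in
    the Eisenstein series of weights 2, 4 and 6, up to monomials with a smaller
    power of the last one ([corr3_lead]). By induction on that power every
    quasi-modular form is eta Z(v) for some polynomial v
    ([quasi_modular_Im]). *)

Set Implicit Arguments.
Unset Strict Implicit.
Unset Printing Implicit Defensive.
Import Order.TTheory GRing.Theory Num.Theory.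
Local Open Scope classical_set_scope.
Local Open Scope ring_scope.

(** * Iterated sums of even powers *)

Section SecondDifference.
Variable K : fieldType.
Hypothesis char0 : forall n, n.+1%:R != 0 :> K.

(** A second antidifference of d^(2k). For k > 0 it is an even polynomial in
    d, unlike the plain sum of powers. *)
Definition power_dsum (k d : nat) : K := \sum_(a < d) (d - a)%:R * a%:R ^+ k.*2.

Lemma power_dsum0 k : power_dsum k 0 = 0.
Proof. by rewrite /power_dsum big_ord0. Qed.

Lemma power_dsum1 k : power_dsum k.+1 1 = 0.
Proof. by rewrite /power_dsum big_ord1 subn0 mul1r doubleS expr0n. Qed.

Lemma power_dsumS k d : power_dsum k d.+1 = power_dsum k d + \sum_(a < d.+1) a%:R ^+ k.*2.
Proof.
rewrite /power_dsum !big_ord_recr /= subSnn mul1r addrA -big_split /=; congr (_ + _).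
apply: eq_bigr => i _; rewrite subSn; last exact: ltnW.
by rewrite -addn1 natrD mulrDl mul1r.
Qed.

Lemma power_dsum_diff2 k d :
  power_dsum k d.+2 - 2 * power_dsum k d.+1 + power_dsum k d = d.+1%:R ^+ k.*2.
Proof. by rewrite !power_dsumS [X in _ + X - _]big_ord_recr /=; ring. Qed.

Lemma diff2_uniq (f g : nat -> K) :
  f 0%N = g 0%N -> f 1%N = g 1%N ->
  (forall d, f d.+2 - 2 * f d.+1 + f d = g d.+2 - 2 * g d.+1 + g d) -> f =1 g.
Proof.
move=> h0 h1 h d; suff: f d = g d /\ f d.+1 = g d.+1 by case.
elim: d => // d [IH1 IH2]; split=> //.
have := h d; rewrite IH1 IH2 => /addIr /addIr //.
Qed.

Lemma sum_parity (V : nmodType) (F : nat -> V) n :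
  \sum_(i < n.*2.+1) F i = \sum_(j < n.+1) F j.*2 + \sum_(j < n) F j.*2.+1.
Proof.
elim: n => [|n IH]; first by rewrite !big_ord1 big_ord0 addr0.
rewrite doubleS big_ord_recr big_ord_recr IH /= [in RHS]big_ord_recr /=.
by rewrite [X in _ = _ + X]big_ord_recr /= -doubleS addrACA -!addrA (addrC (F _.*2)).
Qed.

Lemma exprDB_even (x y : K) n :
  (x + y) ^+ n.*2 + (x - y) ^+ n.*2 =
  \sum_(j < n.+1) 2 * 'C(n.*2, j.*2)%:R * (x ^+ (n.*2 - j.*2) * y ^+ j.*2).
Proof.
rewrite exprDn exprBn -big_split /=.
rewrite (@sum_parity _ (fun i : nat => x ^+ (n.*2 - i) * y ^+ i *+ 'C(n.*2, i) +
  (-1) ^+ i * x ^+ (n.*2 - i) * y ^+ i *+ 'C(n.*2, i))) /=.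
rewrite [X in _ + X]big1 ?addr0 => [|j _].
  apply: eq_bigr => j _; rewrite -signr_odd odd_double expr0 mul1r.
  by rewrite -mulr2n -[RHS]mulrA !mulr_natl.
by rewrite -signr_odd /= odd_double expr1 mulN1r mulNr mulNrn subrr.
Qed.

Lemma exprDB_odd (x y : K) n :
  (x + y) ^+ n.*2 - (x - y) ^+ n.*2 =
  \sum_(j < n) 2 * 'C(n.*2, j.*2.+1)%:R * (x ^+ (n.*2 - j.*2.+1) * y ^+ j.*2.+1).
Proof.
rewrite exprDn exprBn -sumrB /=.
rewrite (@sum_parity _ (fun i : nat => x ^+ (n.*2 - i) * y ^+ i *+ 'C(n.*2, i) -
  (-1) ^+ i * x ^+ (n.*2 - i) * y ^+ i *+ 'C(n.*2, i))) /=.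
rewrite [X in X + _]big1 ?add0r => [|j _].
  apply: eq_bigr => j _; rewrite -signr_odd /= odd_double expr1 mulN1r mulNr mulNrn.
  by rewrite opprK -mulr2n -[RHS]mulrA !mulr_natl.
by rewrite -signr_odd odd_double expr0 mul1r subrr.
Qed.

(** Both sides agree at 0 and 1, and the binomial expansion of (x + 1)^(2k+2)
    + (x - 1)^(2k+2) shows that their second differences agree. The term d^2
    stands for the summand of index 0, because [power_dsum 0 d] is d (d + 1) /
    2, which is not even. *)
Lemma expr_even_dsum k d :
  d%:R ^+ k.*2.+2 =
  d%:R ^+ 2 + \sum_(j < k) 2 * 'C(k.*2.+2, j.+1.*2)%:R * power_dsum j.+1 d :> K.
Proof.
move: d; apply: diff2_uniq => [||d].
- by rewrite !expr0n /= add0r big1 // => j _; rewrite power_dsum0 mulr0.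
- by rewrite !expr1n big1 ?addr0 // => j _; rewrite power_dsum1 mulr0.
have e : d.+2%:R = d.+1%:R + 1 :> K by rewrite -addn1 natrD.
have e' : d%:R = d.+1%:R - 1 :> K by rewrite -addn1 natrD addrK.
have -> (A B C : K) : A - 2 * B + C = (A + C) - 2 * B by ring.
rewrite e e' -doubleS exprDB_even big_ord_recl double0 bin0 subn0 !mulr1.
rewrite [X in _ = X](_ : _ =
  2 + \sum_(j < k) 2 * 'C(k.+1.*2, j.+1.*2)%:R * d.+1%:R ^+ j.+1.*2); last first.
  under [in RHS]eq_bigr do rewrite -power_dsum_diff2.
  under [in RHS]eq_bigr do rewrite mulrDr mulrBr.
  rewrite big_split sumrB /=.
  have -> : \sum_(i < k) 2 * 'C(k.+1.*2, i.+1.*2)%:R * (2 * power_dsum i.+1 d.+1) =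
     2 * \sum_(i < k) 2 * 'C(k.+1.*2, i.+1.*2)%:R * power_dsum i.+1 d.+1 :> K.
    by rewrite mulr_sumr; apply: eq_bigr => j _; rewrite mulrCA.
  ring.
rewrite addrAC subrr add0r big_ord_recr /= subnn binn expr1n mulr1 mulr1 mulr1 addrC.
congr (_ + _); rewrite (reindex_inj rev_ord_inj) /=; apply: eq_bigr => j _.
rewrite expr1n mulr1 /bump /= add1n.
have jk := ltn_ord j.
have -> : (k - j.+1).+1 = (k.+1 - j.+1)%N by lia.
rewrite doubleB bin_sub; last by rewrite leq_double; lia.
by congr (_ * _ ^+ _); rewrite -!muln2; lia.
Qed.

Lemma natr_neq0 n : (0 < n)%N -> n%:R != 0 :> K.
Proof. by case: n. Qed.

(** [expr_even_dsum] expresses [power_dsum k] by d^(2k+2), d^2 and the sums of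
    smaller index, so evenness follows by induction. The leading coefficient
    is recorded because [sigma_series_modular] divides by an expression in
    it. *)
Lemma power_dsum_even_poly k : (0 < k)%N -> exists c : nat -> K, forall d,
  power_dsum k d = \sum_(j < k) c j * d%:R ^+ j.+1.*2
             + (k.*2.+2 * k.*2.+1)%:R^-1 * d%:R ^+ k.+1.*2.
Proof.
elim/ltn_ind: k => -[//|k] IH _.
pose c := fun i => if pselect (0 < i < k.+1)%N is left h
  then projT1 (cid (IH i (proj2 (andP h)) (proj1 (andP h)))) else fun=> 0.
have hc i d : (i < k)%N -> power_dsum i.+1 d = \sum_(j < i.+1) c i.+1 j * d%:R ^+ j.+1.*2
             + (i.+1.*2.+2 * i.+1.*2.+1)%:R^-1 * d%:R ^+ i.+2.*2.
  move=> ik; rewrite /c; case: pselect => [h|[]]; last by rewrite /= ltnS.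
  by case: cid.
pose a := (k.+1.*2.+2 * k.+1.*2.+1)%:R : K.
have a0 : a != 0 by apply: natr_neq0.
have bE : (2 * 'C(k.+1.*2.+2, k.+1.*2))%:R = a.
  rewrite -bin_sub; last by lia.
  have -> : (k.+1.*2.+2 - k.+1.*2 = 2)%N by lia.
  by rewrite mulnC (bin_ffact _ 2) ffactnS ffactn1.
have h d := expr_even_dsum k.+1 d.
(* The coefficients of the sum of index i + 1, leading one included, padded
    with zeros. *)
pose c' i (j : nat) := if (j < i.+1)%N then c i.+1 j else
   if j == i.+1 then (i.+1.*2.+2 * i.+1.*2.+1)%:R^-1 else 0.
have hc' i d : (i < k)%N -> power_dsum i.+1 d = \sum_(j < k.+1) c' i j * d%:R ^+ j.+1.*2.
  move=> ik; rewrite hc // -(big_mkord predT (fun j => c' i j * d%:R ^+ j.+1.*2)).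
  rewrite (@big_cat_nat _ _ _ i.+2) //= ?ltnS // [X in _ = _ + X]big_nat_cond.
  rewrite [X in _ = _ + X]big1 ?addr0 => [|j]; last first.
    rewrite andbT => /andP[ij _]; rewrite /c' ltnNge (ltnW ij) /=.
    by rewrite eqn_leq leqNgt ij /= mul0r.
  rewrite [RHS]big_mkord [RHS]big_ord_recr /= /c' ltnn eqxx; congr (_ + _).
  by apply: eq_bigr => j _; rewrite ltn_ord.
exists (fun j => a^-1 * ((- (j == 0%N)%:R) -
   \sum_(i < k) 2 * 'C(k.+1.*2.+2, i.+1.*2)%:R * c' i j)) => d.
have := h d; rewrite big_ord_recr /= -natrM bE => hd.
apply: (mulfI a0); rewrite mulrDr mulrA mulfV // mul1r hd.
rewrite [X in _ = X + _]mulr_sumr.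
rewrite [X in _ = X + _](eq_bigr (fun j : 'I_k.+1 =>
   - ((j : nat) == 0%N)%:R * d%:R ^+ j.+1.*2 - (\sum_(i < k)
   2 * 'C(k.+1.*2.+2, i.+1.*2)%:R * c' i j) * d%:R ^+ j.+1.*2)) => [|j _]; last first.
  by rewrite -[a^-1 * _ * _]mulrA mulVKf // mulrBl.
rewrite sumrB big_ord_recl /= mulN1r [X in - _ + X]big1 ?addr0 => [|j _]; last first.
  by rewrite /= oppr0 mul0r.
rewrite (eq_bigr (fun i : 'I_k => \sum_(j < k.+1)
   2 * 'C(k.+1.*2.+2, i.+1.*2)%:R * (c' i j * d%:R ^+ j.+1.*2))) => [|i _]; last first.
  by rewrite hc' // mulr_sumr.
rewrite exchange_big /=.
rewrite [X in _ = _ - X + _](eq_bigr (fun j : 'I_k.+1 => \sum_(i < k)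
   2 * 'C(k.+1.*2.+2, i.+1.*2)%:R * (c' i j * d%:R ^+ j.+1.*2))) => [|j _]; last first.
  by rewrite mulr_suml; apply: eq_bigr => i _; rewrite !mulrA.
ring.
Qed.

End SecondDifference.

(** * A form invariant under a rotation of order six *)

Section Hexform.
Variable K : fieldType.
Hypothesis char0 : forall n, n.+1%:R != 0 :> K.

(** Up to sign, the rotation (a, b) -> (a + b, - a) permutes (a, b), (a + b,
    a) and (b, a + b) cyclically. This is twice the orbit sum of a^2 b^(2k)
    minus the orbit sum of b^(2k+2). For k > 0 the combination vanishes on (0,
    b), and in its part odd in b the monomials a b^(2k+1) and a^(2k+1) b have
    opposite coefficients. *)
Definition hexform (k : nat) (a b : K) : K :=
  2 * (a ^+ 2 * b ^+ k.*2 + (a + b) ^+ 2 * a ^+ k.*2 + b ^+ 2 * (a + b) ^+ k.*2)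
  - (a ^+ k.+1.*2 + b ^+ k.+1.*2 + (a + b) ^+ k.+1.*2).

Lemma exprN_even (x : K) k : (- x) ^+ k.*2 = x ^+ k.*2.
Proof. by rewrite exprNn -signr_odd odd_double mul1r. Qed.

(** The rotation takes (a - b, b) to (a, b - a). *)
Lemma hexform_rot k a b : hexform k (a - b) b = hexform k a (b - a).
Proof.
rewrite /hexform subrK [a + (b - a)]addrC subrK.
rewrite -(opprB a b) !exprN_even.
have -> : (- (a - b)) ^+ 2 = (a - b) ^+ 2 by rewrite sqrrN.
ring.
Qed.

(** The rotation takes (a, - b) to (b - a, a), up to sign. *)
Lemma hexform_opp k a b : hexform k (b - a) a = hexform k a (- b).
Proof.
rewrite /hexform subrK -(opprB a b) !exprN_even.
have -> : (- (a - b)) ^+ 2 = (a - b) ^+ 2 by rewrite sqrrN.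
have -> : (- b) ^+ 2 = b ^+ 2 by rewrite sqrrN.
ring.
Qed.

Lemma hexform0 k a : hexform k.+1 0 a = 0.
Proof.
rewrite /hexform add0r !doubleS !expr0n /= !mul0r mulr0 !add0r -exprD.
by rewrite add2n; ring.
Qed.

Lemma sum_sqr d : \sum_(a < d) a%:R ^+ 2 = (d%:R - 1) * d%:R * (2 * d%:R - 1) / 6 :> K.
Proof.
have h6 : 6 != 0 :> K by exact: char0.
elim: d => [|d IH]; first by rewrite big_ord0 mulr0 !mul0r.
by rewrite big_ord_recr /= IH -natr1; field.
Qed.

(** Exchanging a and d - a in two of the terms turns the summand into 4 d (d -
    a) a^(2k+2) + 2 a^2 d^(2k+2) - d^(2k+4). *)
Lemma sum_hexform k d : \sum_(1 <= a < d) hexform k.+1 a%:R (d - a)%:R =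
  4 * d%:R * power_dsum K k.+1 d + (d%:R ^+ k.*2.+3 - d%:R ^+ k.*2.+1.+4) / 3.
Proof.
have h6 : 6 != 0 :> K by exact: char0.
case: d => [|d]; first by rewrite big_geq // !expr0n !mulr0 mul0r add0r subrr mul0r.
pose E (x : K) := x ^+ k.+1.*2; pose F (x : K) := x ^+ k.+2.*2.
have refl (f : nat -> K) : \sum_(1 <= a < d.+1) f (d.+1 - a)%N = \sum_(1 <= a < d.+1) f a.
  by rewrite [RHS]big_nat_rev /=; apply: eq_big_nat => a /andP[a1 ad]; congr f; lia.
set D : K := d.+1%:R.
have s1 : \sum_(1 <= a < d.+1) hexform k.+1 a%:R (d.+1 - a)%:R =
  \sum_(1 <= a < d.+1) (2 * ((d.+1 - a)%:R ^+ 2 * E a%:R)) +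
  \sum_(1 <= a < d.+1) (2 * (a%:R ^+ 2 * E D)) +
  \sum_(1 <= a < d.+1) (2 * D ^+ 2 * E a%:R - 2 * F a%:R - F D).
  rewrite -[X in X + _ + _]refl -[X in _ + X + _]refl.
  have -> : \sum_(1 <= a < d.+1) (2 * D ^+ 2 * E a%:R - 2 * F a%:R - F D) =
    \sum_(1 <= a < d.+1) (2 * D ^+ 2 * E a%:R - F a%:R - F D)
    - \sum_(1 <= a < d.+1) F (d.+1 - a)%:R.
    rewrite (refl (fun a => F a%:R)) -sumrB; apply: eq_bigr => a _; ring.
  rewrite -sumrB -!big_split /=; apply: eq_big_nat => a /andP[a1 ad].
  rewrite subKn; last exact: ltnW.
  rewrite /hexform -natrD subnKC; last exact: ltnW.
  rewrite -/D -/(E _) -/(E _) -/(E _) -/(F _) -/(F _) -/(F _); ring.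
have sq : \sum_(1 <= a < d.+1) a%:R ^+ 2 = (D - 1) * D * (2 * D - 1) / 6.
  rewrite -sum_sqr -(big_mkord predT (fun a => a%:R ^+ 2 : K)) /=.
  by rewrite [RHS]big_nat_recl // expr0n add0r big_add1.
have hs : power_dsum K k.+1 d.+1 = \sum_(1 <= a < d.+1) (D - a%:R) * E a%:R.
  rewrite /power_dsum -(big_mkord predT (fun a => (d.+1 - a)%:R * E a%:R)) /=.
  rewrite big_nat_recl // /E doubleS expr0n mulr0 add0r big_add1 /=.
  by apply: eq_big_nat => a /andP[a1 ad]; rewrite natrB // ltnW.
rewrite s1 -!big_split /=.
rewrite (eq_big_nat _ _ (F2 := fun a : nat =>
   4 * D * ((D - a%:R) * E a%:R) + (2 * E D * a%:R ^+ 2 - F D))); last first.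
  move=> a /andP[a1 ad]; rewrite natrB; last exact: ltnW.
  have -> : F a%:R = a%:R ^+ 2 * E a%:R by rewrite /F /E doubleS -exprD.
  rewrite -/D; ring.
rewrite big_split /= -mulr_sumr -hs; congr (_ + _).
rewrite sumrB -mulr_sumr sq sumr_const_nat subSS subn0.
have -> : F D *+ d = F D * (D - 1) by rewrite /D -mulr_natr -natr1 addrK.
by rewrite /F /E !doubleS !exprS; field; rewrite h6 (char0 2).
Qed.

End Hexform.

(** * Positive solutions of ax + by = n *)

Definition pos_pairs n := [seq (a, b) | a <- iota 1 n, b <- iota 1 n].
Definition bilin_sols n := [seq t <- [seq (s, t) | s <- pos_pairs n, t <- pos_pairs n] |
  t.1.1 * t.2.1 + t.1.2 * t.2.2 == n]%N.

Lemma mem_pos_pairs n a b :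
  ((a, b) \in pos_pairs n) = [&& 0 < a, a <= n, 0 < b & b <= n]%N.
Proof.
apply/allpairsP/idP => [[[a' b'] /= [ha hb [-> ->]]]|/and4P[h1 h2 h3 h4]].
  by move: ha hb; rewrite !mem_iota !add1n !ltnS => /andP[-> ->] /andP[-> ->].
by exists (a, b); rewrite /= !mem_iota !add1n !ltnS h1 h2 h3 h4.
Qed.

Lemma uniq_pos_pairs n : uniq (pos_pairs n).
Proof. by apply: allpairs_uniq; rewrite ?iota_uniq // => -[? ?] [? ?] _ _ /= [-> ->]. Qed.

Lemma uniq_bilin_sols n : uniq (bilin_sols n).
Proof.
apply: filter_uniq; apply: allpairs_uniq; rewrite ?uniq_pos_pairs //.
by move=> [? ?] [? ?] _ _ /= [-> ->].
Qed.

Lemma mem_bilin_sols n a b x y : (((a, b), (x, y)) \in bilin_sols n) =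
  [&& 0 < a, 0 < b, 0 < x, 0 < y & a * x + b * y == n]%N.
Proof.
rewrite mem_filter /= andbC.
apply/andP/and5P => [[/allpairsP[[[a' b'] [x' y']] /= [h1 h2 [-> -> -> ->]]] e]|].
  move: h1 h2; rewrite !mem_pos_pairs => /and4P[-> _ -> _] /and4P[-> _ -> _].
  by rewrite e.
move=> [a0 b0 x0 y0 /eqP e]; split; last exact/eqP.
apply/allpairsP; exists ((a, b), (x, y)); rewrite !mem_pos_pairs a0 b0 x0 y0 /=.
by split=> //; apply/andP; split; rewrite -e; nia.
Qed.

Lemma mem_filter_bilin_sols n (P : pred _) a b x y :
  (((a, b), (x, y)) \in [seq t <- bilin_sols n | P t]) =
  P ((a, b), (x, y)) && [&& 0 < a, 0 < b, 0 < x, 0 < y & a * x + b * y == n]%N.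
Proof. by rewrite mem_filter mem_bilin_sols. Qed.

Lemma big_seq_bij (V : nmodType) (T U : eqType) (s : seq T) (t : seq U)
  (f : T -> U) (g : U -> T) (F : U -> V) : uniq s -> uniq t ->
  (forall x, x \in s -> f x \in t /\ g (f x) = x) ->
  (forall y, y \in t -> g y \in s /\ f (g y) = y) ->
  \sum_(x <- s) F (f x) = \sum_(y <- t) F y.
Proof.
move=> us ut hs ht; rewrite -(big_map f predT F); apply: perm_big.
apply: uniq_perm => //.
  by rewrite map_inj_in_uniq // => x y /hs[_ {2}<-] /hs[_ {2}<-] ->.
move=> y; apply/mapP/idP => [[x /hs[h _] ->] //|/ht[h e]].
by exists (g y).
Qed.

Definition swap_sol (t : (nat * nat) * (nat * nat)) :=
  ((t.1.2, t.1.1), (t.2.2, t.2.1)).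

Lemma bilin_sols_swap (V : nmodType) (F : nat -> nat -> V)
    (P : nat -> nat -> nat -> nat -> bool) n :
  \sum_(t <- bilin_sols n | P t.1.1 t.1.2 t.2.1 t.2.2) F t.1.1 t.1.2 =
  \sum_(t <- bilin_sols n | P t.1.2 t.1.1 t.2.2 t.2.1) F t.1.2 t.1.1.
Proof.
rewrite -big_filter -[RHS]big_filter; apply: esym.
apply: (big_seq_bij (f := swap_sol) (g := swap_sol)
  (fun t => F t.1.1 t.1.2)); rewrite ?(filter_uniq _ (uniq_bilin_sols _)) //.
  move=> [[a b] [x y]]; rewrite /swap_sol /= !mem_filter_bilin_sols /= addnC.
  by move=> /andP[-> /and5P[-> -> -> -> ->]].
move=> [[a b] [x y]]; rewrite /swap_sol /= !mem_filter_bilin_sols /= addnC.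
by move=> /andP[-> /and5P[-> -> -> -> ->]].
Qed.

(** The shear (a, b, x, y) -> (a + b, b, x, y - x) preserves a x + b y. *)
Lemma bilin_sols_shear (V : nmodType) (F G : nat -> nat -> V) n :
  (forall a b, (0 < a)%N -> (0 < b)%N -> G (a + b)%N b = F a b) ->
  \sum_(t <- bilin_sols n | (t.2.1 < t.2.2)%N) F t.1.1 t.1.2 =
  \sum_(t <- bilin_sols n | (t.1.2 < t.1.1)%N) G t.1.1 t.1.2.
Proof.
move=> FG; rewrite -big_filter -[RHS]big_filter.
rewrite (eq_big_seq (fun t => G (t.1.1 + t.1.2)%N t.1.2)); last first.
  move=> [[a b] [x y]]; rewrite mem_filter_bilin_sols => /andP[_ /and5P[a0 b0 _ _ _]].
  by rewrite /= FG.
apply: (big_seq_bij (f := fun t => ((t.1.1 + t.1.2, t.1.2), (t.2.1, t.2.2 - t.2.1))%N)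
  (g := fun t => ((t.1.1 - t.1.2, t.1.2), (t.2.1, t.2.2 + t.2.1))%N)
  (fun t => G t.1.1 t.1.2)).
- exact/filter_uniq/uniq_bilin_sols.
- exact/filter_uniq/uniq_bilin_sols.
- move=> [[a b] [x y]]; rewrite !mem_filter_bilin_sols /=.
  move=> /andP[xy /and5P[a0 b0 x0 y0 /eqP e]]; split.
    rewrite -e; apply/andP; split; first by lia.
    by apply/and5P; split; lia.
  by rewrite addnK subnK // ltnW.
- move=> [[a b] [x y]]; rewrite !mem_filter_bilin_sols /=.
  move=> /andP[xy /and5P[a0 b0 x0 y0 /eqP e]]; split.
    rewrite -e; apply/andP; split; first by lia.
    by apply/and5P; split; lia.
  by rewrite addnK subnK // ltnW.
Qed.

(** For x = y the equation reads (a + b) x = n. *)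
Lemma bilin_sols_diag (V : nmodType) (F : nat -> nat -> V) n :
  \sum_(t <- bilin_sols n | t.2.1 == t.2.2) F t.1.1 t.1.2 =
  \sum_(d <- divisors n) \sum_(1 <= a < d) F a (d - a)%N.
Proof.
case: n => [|n].
  have -> : bilin_sols 0 = [::] by [].
  by rewrite /divisors /= big_nil big_seq1 big_geq.
rewrite -big_filter -(big_allpairs_dep (h := fun d a : nat => (d, a))
  (F := fun p => F p.2 (p.1 - p.2)%N)).
apply: esym.
apply: (big_seq_bij
  (f := fun p => ((p.2, p.1 - p.2), (n.+1 %/ p.1, n.+1 %/ p.1))%N)
  (g := fun t => (t.1.1 + t.1.2, t.1.1)%N) (fun t => F t.1.1 t.1.2)).
- apply: allpairs_uniq_dep => [|d _|]; first exact: divisors_uniq.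
    exact: iota_uniq.
  by move=> [d a] [d' a'] _ _ /= [-> ->].
- exact/filter_uniq/uniq_bilin_sols.
- move=> [d a] /allpairsPdep[d' [a' [hd ha [-> ->]]]]; rewrite /=.
  move: hd ha; rewrite -dvdn_divisors // mem_index_iota => hd /andP[a1 ad].
  rewrite mem_filter_bilin_sols /= eqxx -mulnDl subnKC; last exact: ltnW.
  rewrite mulnC divnK // eqxx a1 subn_gt0 ad divn_gt0 ?(ltn_trans _ ad) //.
  by rewrite dvdn_leq.
- move=> [[a b] [x y]]; rewrite mem_filter_bilin_sols /=.
  move=> /andP[/eqP <- /and5P[a0 b0 x0 _]]; rewrite -mulnDl => /eqP e.
  split; last by rewrite addKn -e mulKn ?addn_gt0 ?a0.
  apply/allpairsPdep; exists (a + b)%N, a; rewrite -dvdn_divisors // mem_index_iota.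
  by rewrite -e dvdn_mulr // a0 -addn1 leq_add2l.
Qed.

(** Shears map the solutions with x < y onto those with b < a, and the
    solutions with y < x onto those with a < b. This leaves the solutions with
    x = y on one side, and those with a = b, where G vanishes, on the
    other. *)
Lemma bilin_sols_transform (V : zmodType) (F G : nat -> nat -> V) n :
  (forall a b, (0 < a)%N -> (0 < b)%N -> G (a + b)%N b = F a b) ->
  (forall a b, (0 < a)%N -> (0 < b)%N -> G a (a + b)%N = F a b) ->
  (forall a, G a a = 0) ->
  \sum_(t <- bilin_sols n) F t.1.1 t.1.2 =
  \sum_(t <- bilin_sols n) G t.1.1 t.1.2 +
  \sum_(d <- divisors n) \sum_(1 <= a < d) F a (d - a)%N.
Proof.
move=> h1 h2 h0.
(* Both sums are cut into three according to the order of two of the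
    unknowns. *)
have tri (H : nat -> nat -> V) (f g : (nat * nat) * (nat * nat) -> nat) :
  \sum_(t <- bilin_sols n) H t.1.1 t.1.2 =
  \sum_(t <- bilin_sols n | (f t < g t)%N) H t.1.1 t.1.2 +
  \sum_(t <- bilin_sols n | (g t < f t)%N) H t.1.1 t.1.2 +
  \sum_(t <- bilin_sols n | f t == g t) H t.1.1 t.1.2.
  rewrite (bigID (fun t => (f t < g t)%N)) /= -addrA; congr (_ + _).
  rewrite (bigID (fun t => (g t < f t)%N)) /=; congr (_ + _); apply: eq_bigl => t.
    by case: ltngtP.
  by case: ltngtP.
rewrite (tri F (fun t => t.2.1) (fun t => t.2.2)) bilin_sols_diag; congr (_ + _).
rewrite (tri G (fun t => t.1.2) (fun t => t.1.1)).
rewrite [X in _ = _ + X]big1 ?addr0 => [|t /eqP ->]; last exact: h0.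
rewrite (bilin_sols_shear _ h1); congr (_ + _).
rewrite (bilin_sols_swap F (fun _ _ x y => (y < x)%N)).
rewrite (bilin_sols_swap G (fun a b _ _ => (a < b)%N)).
apply: (@bilin_sols_shear _ (fun a b => F b a) (fun a b => G b a)) => a b a0 b0.
by rewrite addnC h2.
Qed.

(** * Lambert series *)

Section Divisor.
Variable K : fieldType.

(** The Lambert series sum_d F(d) q^d / (1 - q^d). The constant term is set
    apart because the list [divisors 0] is not empty. *)
Definition lambert (F : nat -> K) : qseries K :=
  fun n => if n == 0%N then 0 else \sum_(d <- divisors n) F d.

(** For odd e, the Eisenstein series of weight e + 1 without its constant
    term, scaled to start with q. *)
Definition sigma_series (e : nat) : qseries K := lambert (fun d => d%:R ^+ e).

Lemma qaddE (f g : qseries K) n : (f + g) n = f n + g n. Proof. by []. Qed.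
Lemma qoppE (f : qseries K) n : (- f) n = - f n. Proof. by []. Qed.
Lemma qscaleE a (f : qseries K) n : (a *: f) n = a * f n. Proof. by []. Qed.
Lemma qoneE n : (1 : qseries K) n = (n == 0%N)%:R. Proof. by []. Qed.
Lemma qmulE (f g : qseries K) n : (f * g) n = \sum_(i < n.+1) f i * g (n - i)%N.
Proof. by []. Qed.

Lemma qsumE (I : Type) (r : seq I) (P : pred I) (f : I -> qseries K) n :
  (\sum_(i <- r | P i) f i) n = \sum_(i <- r | P i) f i n.
Proof. by elim/big_rec2: _ => [|i x y _ <-]. Qed.

Lemma lambertD F G : lambert (fun d => F d + G d) = lambert F + lambert G.
Proof.
apply/funext => n; rewrite qaddE /lambert; case: eqP => _; first by rewrite addr0.
by rewrite big_split.
Qed.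

Lemma lambertZ a F : lambert (fun d => a * F d) = a *: lambert F.
Proof.
apply/funext => n; rewrite qscaleE /lambert; case: eqP => _; first by rewrite mulr0.
by rewrite mulr_sumr.
Qed.

Lemma lambert_sum (I : Type) (r : seq I) (F : I -> nat -> K) :
  lambert (fun d => \sum_(i <- r) F i d) = \sum_(i <- r) lambert (F i).
Proof.
apply/funext => n; rewrite qsumE /lambert; case: eqP => _.
  by rewrite big1_eq.
by rewrite exchange_big.
Qed.

Lemma eq_lambert F G : (forall d, (0 < d)%N -> F d = G d) ->
  lambert F = lambert G.
Proof.
move=> FG; apply/funext => -[//|n]; rewrite /lambert /=.
by apply: eq_big_seq => d; rewrite -dvdn_divisors // => /dvdn_gt0 h; apply/FG/h.
Qed.

Lemma lambert_box F n i : (i <= n)%N -> lambert F i =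
  \sum_(p <- pos_pairs n | (p.1 * p.2 == i)%N) F p.1.
Proof.
rewrite /lambert; case: i => [_|i ile] /=.
  rewrite big1_seq // => -[a x]; rewrite mem_pos_pairs /= muln_eq0.
  by case: a x => [|a] [|x] /=; rewrite ?andbF.
rewrite -[RHS]big_filter.
apply: (@big_seq_bij K nat (nat * nat)%type _ _ (fun d => (d, (i.+1 %/ d)%N))
  (fun p => p.1) (fun p => F p.1)).
- exact: divisors_uniq.
- exact/filter_uniq/uniq_pos_pairs.
- move=> d; rewrite -dvdn_divisors // => hd; have d0 := dvdn_gt0 (ltn0Sn i) hd.
  split=> //; rewrite mem_filter mem_pos_pairs /= mulnC divnK // eqxx d0.
  rewrite (leq_trans (dvdn_leq _ hd)) // divn_gt0 // dvdn_leq //=.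
  exact: leq_trans (leq_div _ _) _.
- move=> [a x]; rewrite mem_filter mem_pos_pairs /= => /andP[/eqP e /and4P[a0 _ _ _]].
  by rewrite -dvdn_divisors // -e mulKn // dvdn_mulr.
Qed.

Lemma big_bilin_sols (V : nmodType) (F : nat -> nat -> V) n :
  \sum_(t <- bilin_sols n) F t.1.1 t.1.2 = \sum_(p <- pos_pairs n) \sum_(q <- pos_pairs n)
     (if (p.1 * p.2 + q.1 * q.2 == n)%N then F p.1 q.1 else 0).
Proof.
rewrite /bilin_sols big_filter big_mkcond big_allpairs_dep big_allpairs_dep /=.
rewrite big_allpairs_dep /=; apply: eq_bigr => a _.
under eq_bigr do rewrite big_allpairs_dep.
rewrite exchange_big /=; apply: eq_bigr => x _.
by rewrite big_allpairs_dep /=.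
Qed.

(** In a solution of a x + b y = n, the divisors a and b belong to the two
    summands of n. *)
Lemma lambertM F G n :
  (lambert F * lambert G) n = \sum_(t <- bilin_sols n) F t.1.1 * G t.1.2.
Proof.
rewrite qmulE (big_bilin_sols (fun a b => F a * G b)).
rewrite (eq_bigr (fun i : 'I_n.+1 => \sum_(p <- pos_pairs n) \sum_(q <- pos_pairs n)
  (if (i == p.1 * p.2 :> nat)%N then
     if (n - i == q.1 * q.2)%N then F p.1 * G q.1 else 0 else 0))); last first.
  move=> i _; rewrite !(@lambert_box _ n) ?leq_subr ?leq_ord //.
  rewrite big_mkcond mulr_suml; apply: eq_bigr => p _.
  rewrite eq_sym; case: eqP => _; last by rewrite mul0r big1_eq.
  rewrite mulr_sumr big_mkcond; apply: eq_bigr => q _.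
  by rewrite eq_sym; case: eqP.
rewrite exchange_big /=; apply: eq_bigr => p _; rewrite exchange_big /=.
apply: eq_bigr => q _; rewrite -big_mkcond /=.
have [pn|pn] := leqP (p.1 * p.2) n.
  rewrite (big_pred1 (Ordinal (pn : (p.1 * p.2 < n.+1)%N))) => [|i]; last first.
    by apply/eqP/eqP => [h|->//]; exact: val_inj.
  by rewrite /= -(eqn_add2l (p.1 * p.2)) subnKC // eq_sym.
rewrite big_pred0 => [|i]; last first.
  by apply/eqP => ei; have := ltn_ord i; rewrite ei ltnS leqNgt pn.
by case: eqP => // e; move: pn; rewrite -e ltnNge leq_addr.
Qed.

End Divisor.

(** * Modularity of the divisor series of weight at least four *)

Section Subalg.
Variable K : comNzRingType.
Variable G : set (qseries K).

Lemma gen_subalg1 : gen_subalg G 1.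
Proof. by rewrite -(scale1r 1); exact: gen_subalg_const. Qed.

Lemma gen_subalg0 : gen_subalg G 0.
Proof. by rewrite -(scale0r 1); exact: gen_subalg_const. Qed.

Lemma gen_subalg_scale a f : gen_subalg G f -> gen_subalg G (a *: f).
Proof.
by move=> hf; rewrite -[f]mul1r scalerAl; apply: gen_subalg_mul => //; exact: gen_subalg_const.
Qed.

Lemma gen_subalg_opp f : gen_subalg G f -> gen_subalg G (- f).
Proof. by rewrite -scaleN1r; exact: gen_subalg_scale. Qed.

Lemma gen_subalg_sub f g : gen_subalg G f -> gen_subalg G g -> gen_subalg G (f - g).
Proof. by move=> hf hg; apply: gen_subalg_add => //; exact: gen_subalg_opp. Qed.

Lemma gen_subalg_sum (I : eqType) (r : seq I) (f : I -> qseries K) :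
  (forall i, i \in r -> gen_subalg G (f i)) -> gen_subalg G (\sum_(i <- r) f i).
Proof.
move=> h; rewrite big_seq; elim/big_ind: _ => //; first exact: gen_subalg0.
exact: gen_subalg_add.
Qed.
End Subalg.

Section Modular.
Variable K : fieldType.
Hypothesis char0 : forall n, n.+1%:R != 0 :> K.
Local Notation sigma_series := (@sigma_series K).

(** Passing to the part odd in b leaves only monomials with both exponents
    odd, which count products of two Eisenstein series of even weight. *)
Lemma hexform_odd k (a b : K) : hexform k a b - hexform k a (- b) =
  8 * (a ^+ k.*2.+1 * b)
  + \sum_(j < k) 4 * 'C(k.*2, j.*2.+1)%:R * (a ^+ (k.*2 - j.*2.+1) * b ^+ j.*2.+3)
  - \sum_(j < k.+1) 2 * 'C(k.+1.*2, j.*2.+1)%:R * (a ^+ (k.+1.*2 - j.*2.+1) * b ^+ j.*2.+1).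
Proof.
rewrite -exprDB_odd.
have -> : \sum_(j < k) 4 * 'C(k.*2, j.*2.+1)%:R * (a ^+ (k.*2 - j.*2.+1) * b ^+ j.*2.+3)
  = 2 * b ^+ 2 * ((a + b) ^+ k.*2 - (a - b) ^+ k.*2).
  rewrite exprDB_odd mulr_sumr; apply: eq_bigr => j _.
  rewrite -[b ^+ j.*2.+3]/(b ^+ (2 + j.*2.+1)) exprD.
  move: (a ^+ _) (b ^+ j.*2.+1) ('C(_, _)%:R) => x y z; ring.
rewrite /hexform !exprN_even (exprS a k.*2) sqrrN.
move: (a ^+ k.*2) (b ^+ k.*2) ((a + b) ^+ k.*2) ((a - b) ^+ k.*2) => x y z t.
move: (a ^+ k.+1.*2) (b ^+ k.+1.*2) ((a + b) ^+ k.+1.*2) ((a - b) ^+ k.+1.*2) => x' y' z' t'.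
ring.
Qed.

(** The sum of [hexform] over the positive pairs with sum d, as evaluated by
    [sum_hexform]. *)
Definition divisor_poly k (d : nat) : K :=
  4 * d%:R * power_dsum K k d + (d%:R ^+ k.*2.+1 - d%:R ^+ k.*2.+3) / 3.

(** This is [bilin_sols_transform] for the weight [hexform k.+1]. Exchanging a
    and b turns its transform hexform (a - b) b into hexform a (- b), so the
    difference of the two sides involves only [hexform_odd]. *)
Lemma sigma_identity k :
  8 *: (sigma_series k.+1.*2.+1 * sigma_series 1)
  + \sum_(j < k.+1) (4 * 'C(k.+1.*2, j.*2.+1)%:R) *:
      (sigma_series (k.+1.*2 - j.*2.+1) * sigma_series j.*2.+3)
  - \sum_(j < k.+2) (2 * 'C(k.+2.*2, j.*2.+1)%:R) *:
      (sigma_series (k.+2.*2 - j.*2.+1) * sigma_series j.*2.+1)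
  = lambert (divisor_poly k.+1).
Proof.
apply/funext => n; rewrite !qaddE qoppE !qsumE.
have sE u v : (sigma_series u * sigma_series v) n =
    \sum_(t <- bilin_sols n) t.1.1%:R ^+ u * t.1.2%:R ^+ v.
  exact: lambertM.
rewrite qscaleE sE.
under [X in _ + X - _]eq_bigr do rewrite qscaleE sE mulr_sumr.
under [X in _ - X]eq_bigr do rewrite qscaleE sE mulr_sumr.
rewrite exchange_big [X in _ - X]exchange_big mulr_sumr /= -big_split -sumrB /=.
rewrite (eq_bigr (fun t => hexform k.+1 t.1.1%:R t.1.2%:R -
    hexform k.+1 t.1.1%:R (- t.1.2%:R))); last first.
  by move=> t _; rewrite hexform_odd expr1.
rewrite sumrB.
case: n {sE} => [|n].
  by rewrite /bilin_sols /= !big_nil subr0.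
rewrite (@bilin_sols_transform _ (fun a b => hexform k.+1 a%:R b%:R)
  (fun a b => hexform k.+1 (a%:R - b%:R) b%:R)) => [|a b _ _|a b _ _|a].
- rewrite [X in X + _ - _](_ : _ =
      \sum_(t <- bilin_sols n.+1) hexform k.+1 t.1.1%:R (- t.1.2%:R)); last first.
    rewrite (bilin_sols_swap (fun a b => hexform k.+1 (a%:R - b%:R) b%:R) (fun _ _ _ _ => true)).
    by apply: eq_bigr => t _; rewrite hexform_opp.
  rewrite addrAC subrr add0r /lambert /=; apply: eq_bigr => d _.
  exact: sum_hexform.
- by rewrite natrD addrK.
- by rewrite hexform_rot natrD addrAC subrr add0r.
- by rewrite subrr hexform0.
Qed.

Lemma sigma_series_E4 : sigma_series 3 = 240%:R^-1 *: (E4 K - 1).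
Proof.
apply/funext => n; rewrite qscaleE qaddE qoppE qoneE /E4 /sigma_series /lambert.
case: eqP => _; first by rewrite subrr mulr0.
rewrite subr0 mulKf; last exact: (char0 239).
by rewrite /sigma natr_sum; apply: eq_bigr => d _; rewrite natrX.
Qed.

Lemma sigma_series_E6 : sigma_series 5 = (- 504%:R^-1) *: (E6 K - 1).
Proof.
apply/funext => n; rewrite qscaleE qaddE qoppE qoneE /E6 /sigma_series /lambert.
case: eqP => _; first by rewrite subrr mulr0.
rewrite subr0 mulNr mulrN mulNr opprK mulKf; last exact: (char0 503).
by rewrite /sigma natr_sum; apply: eq_bigr => d _; rewrite natrX.
Qed.

Lemma sigma_series_E2 : sigma_series 1 = (- 24%:R^-1) *: (E2 K - 1).
Proof.
apply/funext => n; rewrite qscaleE qaddE qoppE qoneE /E2 /sigma_series /lambert.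
case: eqP => _; first by rewrite subrr mulr0.
rewrite subr0 mulNr mulrN mulNr opprK mulKf; last exact: (char0 23).
by rewrite /sigma natr_sum; apply: eq_bigr => d _; rewrite natrX.
Qed.

(** The exponents of d in [divisor_poly] are odd and at least 3, because
    [power_dsum] is even and vanishes at 0; so the series of weight two does
    not occur. The last coefficient vanishes only for k = 1. *)
Lemma divisor_poly_sigma k : (0 < k)%N -> exists c : nat -> K,
  lambert (divisor_poly k) = \sum_(j < k) c j *: sigma_series j.*2.+3 +
    (4 / (k.*2.+2 * k.*2.+1)%:R - 3%:R^-1) *: sigma_series k.*2.+3.
Proof.
move=> k0; have [c hc] := power_dsum_even_poly char0 k0.
exists (fun j => 4 * c j + if j == k.-1 then 3%:R^-1 else 0).
rewrite -lambertZ.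
under eq_bigr do rewrite -lambertZ.
rewrite -lambert_sum -lambertD; congr lambert; apply/funext => d.
rewrite /divisor_poly hc.
under [in RHS]eq_bigr do rewrite mulrDl.
rewrite big_split /=.
case: k k0 {hc} => // k _; rewrite [X in _ = _ + X + _]big_ord_recr /= eqxx.
rewrite [X in _ = _ + (X + _) + _]big1 ?add0r; last first.
  by move=> j _; rewrite ltn_eqF ?mul0r.
have -> : \sum_(j < k.+1) 4 * c j * d%:R ^+ j.*2.+3 =
  4 * d%:R * (\sum_(j < k.+1) c j * d%:R ^+ j.+1.*2).
  rewrite mulr_sumr; apply: eq_bigr => j _; rewrite doubleS exprS.
  by move: (d%:R : K) (d%:R ^+ _) (c j) => x y z; ring.
move: (\sum_(j < k.+1) _) => S.
have -> : d%:R ^+ k.+1.*2.+3 = d%:R * d%:R ^+ k.+2.*2 :> K by rewrite -exprS.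
rewrite -[k.+1.*2.+1]/(k.*2.+3).
move: (d%:R : K) (d%:R ^+ k.+2.*2) (d%:R ^+ k.*2.+3) (_%:R^-1) => z x y t.
by ring.
Qed.

(** The four terms of [sigma_identity] that contain the series of weight two
    cancel. What remains expresses the series of index 2k + 3, for k >= 2, by
    products and combinations of those of odd index between 3 and 2k + 1. The
    induction starts with E4 and E6. *)
Theorem sigma_series_modular k : modular_forms K (sigma_series k.*2.+3).
Proof.
have m3 : modular_forms K (sigma_series 3).
  rewrite sigma_series_E4; apply/gen_subalg_scale/gen_subalg_sub; last exact: gen_subalg1.
  by apply: gen_subalg_gen; left.
have m5 : modular_forms K (sigma_series 5).
  rewrite sigma_series_E6; apply/gen_subalg_scale/gen_subalg_sub; last exact: gen_subalg1.
  by apply: gen_subalg_gen; right.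
elim/ltn_ind: k => -[//|[//|k]] IH.
have m2 j : (j < k.+2)%N -> modular_forms K (sigma_series j.*2.+3) by exact: IH.
have := sigma_identity k.+1; have [c ->] := @divisor_poly_sigma k.+2 isT.
set a : K := 4 / _ - _ => e.
have a0 : a != 0.
  pose q := (k.+2.*2.+2 * k.+2.*2.+1)%N.
  have q0 : q%:R != 0 :> K by exact: char0.
  (* The coefficient a vanishes exactly when q = 12, but q is at least 30. *)
  have : (q - 12)%:R != 0 :> K by apply: natr_neq0; rewrite // /q subn_gt0; nia.
  apply: contraNneq => a0; rewrite natrB; last by rewrite /q; nia.
  have : a * (3 * q%:R) = 12 - q%:R.
    rewrite /a -/q; move: (q%:R : K) q0 => Q Q0.
    by field; rewrite Q0 (char0 2).
  by rewrite a0 mul0r => /eqP; rewrite eq_sym subr_eq0 => /eqP ->; rewrite subrr.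
have -> : sigma_series k.+2.*2.+3 = a^-1 *: (8 *: (sigma_series k.+2.*2.+1 * sigma_series 1) +
    \sum_(j < k.+2) (4 * 'C(k.+2.*2, j.*2.+1)%:R) *:
        (sigma_series (k.+2.*2 - j.*2.+1) * sigma_series j.*2.+3) -
    \sum_(j < k.+3) (2 * 'C(k.+3.*2, j.*2.+1)%:R) *:
        (sigma_series (k.+3.*2 - j.*2.+1) * sigma_series j.*2.+1)
    - \sum_(j < k.+2) c j *: sigma_series j.*2.+3).
  by rewrite e addrAC subrr add0r scalerA mulVf // scale1r.
apply: gen_subalg_scale; apply: gen_subalg_sub; last first.
  by apply: gen_subalg_sum => j _; apply/gen_subalg_scale/m2.
rewrite [\sum_(j < k.+2) _]big_ord_recr [\sum_(j < k.+3) _]big_ord_recr /=.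
rewrite [\sum_(j < k.+2) _]big_ord_recl /=.
(* S1 and S2 are the sums without the extreme indices, which carry
    [sigma_series 1]. *)
set S1 := \sum_(j < k.+1) _; set S2 := \sum_(j < k.+1) _.
have -> : (k.+2.*2 - k.+1.*2.+1 = 1)%N by lia.
have -> : (k.+3.*2 - k.+2.*2.+1 = 1)%N by lia.
have -> : 'C(k.+2.*2, k.+1.*2.+1) = k.+2.*2.
  by rewrite -bin_sub; [rewrite (_ : _ - _ = 1)%N ?bin1|]; lia.
have -> : 'C(k.+3.*2, k.+2.*2.+1) = k.+3.*2.
  by rewrite -bin_sub; [rewrite (_ : _ - _ = 1)%N ?bin1|]; lia.
rewrite bin1 subn1 /= -[k.+1.*2.+3]/(k.+2.*2.+1) -[(double k).+2.+2.+1]/(k.+2.*2.+1).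
rewrite (mulrC (sigma_series 1)); set X := sigma_series _ * sigma_series 1.
have -> : 8 *: X + (S1 + (4 * k.+2.*2%:R) *: X) -
   ((2 * k.+3.*2%:R) *: X + S2 + (2 * k.+3.*2%:R) *: X) = S1 - S2.
  have -> : k.+3.*2%:R = k.+2.*2%:R + 2 :> K by rewrite -natrD addn2.
  have lin (u v : K) : 8 *: X + (S1 + (4 * u) *: X) - (v *: X + S2 + v *: X) =
     (8 + 4 * u - v - v) *: X + (S1 - S2).
    rewrite !scalerBl (scalerDl _ 8).
    by move: (8 *: X) ((4 * u) *: X) (v *: X) => x y z; ring.
  by rewrite lin [X in X *: _](_ : _ = 0) ?scale0r ?add0r //; ring.
apply: gen_subalg_sub.
  apply: gen_subalg_sum => j _; apply: gen_subalg_scale; apply: gen_subalg_mul.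
    have jk := ltn_ord j.
    rewrite (_ : k.+2.*2 - j.*2.+1 = (k - j).*2.+3)%N; last by lia.
    by apply: m2; lia.
  by apply: m2; have := ltn_ord j; lia.
apply: gen_subalg_sum => j _; apply: gen_subalg_scale; apply: gen_subalg_mul.
  have jk := ltn_ord j; rewrite /bump /= add1n.
  rewrite (_ : k.+3.*2 - j.+1.*2.+1 = (k - j).*2.+3)%N; last by lia.
  by apply: m2; lia.
by rewrite /bump /= add1n; apply: m2; have := ltn_ord j; lia.
Qed.
End Modular.

(** * The closed subalgebra of p-adic modular forms *)

Section Ultrametric.
Variable K : uNormFieldType.
Implicit Types f g : qseries K.

Lemma unorm_sum (V : uNormZmodType) (I : eqType) (r : seq I) (F : I -> V) c : 0 <= c ->
  (forall i, i \in r -> unorm (F i) <= c) -> unorm (\sum_(i <- r) F i) <= c.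
Proof.
move=> c0 h; rewrite big_seq; elim/big_ind: _ => //; first by rewrite unorm0.
by move=> x y hx hy; rewrite (le_trans (unormD _ _)) // ge_max hx.
Qed.

Lemma unorm_nat_le1 n : unorm (n%:R : K) <= 1.
Proof.
elim: n => [|n IH]; first by rewrite unorm0.
by rewrite -natr1 (le_trans (unormD _ _)) // ge_max IH unorm1 /=.
Qed.

Lemma unorm_int_le1 (z : int) : unorm (z%:~R : K) <= 1.
Proof.
case: z => n; first by rewrite -pmulrn unorm_nat_le1.
by rewrite NegzE mulrNz unormN -pmulrn unorm_nat_le1.
Qed.

Lemma unormX (x : K) n : unorm (x ^+ n) = unorm x ^+ n.
Proof. by elim: n => [|n IH]; rewrite ?expr0 ?unorm1 // !exprS unormM IH. Qed.

Definition qbounded (f : qseries K) (B : rat) := forall n, unorm (f n) <= B.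

Lemma qbounded_mul f g A B : qbounded f A -> qbounded g B -> qbounded (f * g) (A * B).
Proof.
move=> hf hg n; rewrite qmulE -big_enum; apply: unorm_sum => [|i _].
  by apply: mulr_ge0;
    [exact: le_trans (unorm_ge0 _) (hf 0%N)|exact: le_trans (unorm_ge0 _) (hg 0%N)].
by rewrite unormM ler_pM ?unorm_ge0.
Qed.

Lemma qboundedD f g B : qbounded f B -> qbounded g B -> qbounded (f + g) B.
Proof. by move=> hf hg n; rewrite (le_trans (unormD _ _)) // ge_max hf hg. Qed.

Lemma sup_dist_leE f g e : sup_dist_le f g e <-> qbounded (f - g) e.
Proof. by []. Qed.

Lemma lambert_bound (F : nat -> K) B : 0 <= B -> (forall d, unorm (F d) <= B) ->
  qbounded (lambert F) B.
Proof.
move=> B0 h [|n]; rewrite /lambert /=; first by rewrite unorm0.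
exact: unorm_sum.
Qed.

(** What [pmf_mul] needs in order to estimate products. *)
Lemma modular_forms_bounded f : modular_forms K f -> exists B, qbounded f B.
Proof.
elim=> [a|g|{}f g _ [A hA] _ [B hB]|{}f g _ [A hA] _ [B hB]].
- exists (unorm a) => n; rewrite qscaleE qoneE unormM.
  by case: eqP => _; rewrite ?unorm0 ?mulr0 ?unorm_ge0 // unorm1 mulr1.
- move=> hg; exists 1 => n.
  case: hg => ->; rewrite /E4 /E6; case: eqP => _; rewrite ?unorm1 //.
    by rewrite unormM mulr_ile1 ?unorm_ge0 ?unorm_nat_le1.
  by rewrite unormM unormN mulr_ile1 ?unorm_ge0 ?unorm_nat_le1.
- exists (Num.max A B); apply: qboundedD => n.
    by rewrite (le_trans (hA n)) // le_max lexx.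
  by rewrite (le_trans (hB n)) // le_max lexx orbT.
- by exists (A * B); exact: qbounded_mul.
Qed.

Local Notation pmf := (padic_modular_forms K).

Lemma pmf_modular f : modular_forms K f -> pmf f.
Proof. by move=> h e e0; exists f => // n; rewrite subrr unorm0 ltW. Qed.

Lemma pmf_closed f :
  (forall e : rat, 0 < e -> exists2 g, pmf g & sup_dist_le f g e) -> pmf f.
Proof.
move=> h e e0; have [g hg fg] := h e e0; have [m hm gm] := hg e e0.
exists m => // n; rewrite -(subrK (g n) (f n)) -addrA.
by rewrite (le_trans (unormD _ _)) // ge_max fg gm.
Qed.

Lemma pmf_add f g : pmf f -> pmf g -> pmf (f + g).
Proof.
move=> hf hg e e0; have [f' hf' ff'] := hf e e0; have [g' hg' gg'] := hg e e0.
exists (f' + g'); first exact: gen_subalg_add.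
apply/sup_dist_leE; rewrite opprD addrACA.
by apply: qboundedD.
Qed.

Lemma pmf_bounded f : pmf f -> exists B, qbounded f B.
Proof.
move=> hf; have [g /modular_forms_bounded[B hB] fg] := hf 1 ltr01.
exists (Num.max 1 B); rewrite -(subrK g f).
apply: qboundedD => n; first by rewrite (le_trans (fg n)) // le_max lexx.
by rewrite (le_trans (hB n)) // le_max lexx orbT.
Qed.

(** The approximation of g is chosen first, because the precision needed for f
    depends on its norm. *)
Lemma pmf_mul f g : pmf f -> pmf g -> pmf (f * g).
Proof.
move=> hf hg e e0; have [A hA] := pmf_bounded hf.
have A0 : 0 <= A by exact: le_trans (unorm_ge0 _) (hA 0%N).
have A1 : 0 < A + 1 by rewrite ltr_wpDl.
have [g' mg' gg'] := hg (e / (A + 1)) (divr_gt0 e0 A1).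
have [B hB] := modular_forms_bounded mg'.
have B0 : 0 <= B by exact: le_trans (unorm_ge0 _) (hB 0%N).
have B1 : 0 < B + 1 by rewrite ltr_wpDl.
have [f' mf' ff'] := hf (e / (B + 1)) (divr_gt0 e0 B1).
exists (f' * g'); first exact: gen_subalg_mul.
apply/sup_dist_leE.
have -> : f * g - f' * g' = f * (g - g') + (f - f') * g' by ring.
apply: qboundedD => n.
  apply: (le_trans (qbounded_mul hA gg' n)).
  by rewrite mulrCA ger_pMr // ler_pdivrMr // mul1r lerDl.
apply: (le_trans (qbounded_mul ff' hB n)).
by rewrite -mulrA ger_pMr // mulrC ler_pdivrMr // mul1r lerDl.
Qed.

Lemma pmf_scale a f : pmf f -> pmf (a *: f).
Proof.
move=> hf; rewrite -[f]mul1r scalerAl; apply: pmf_mul => //.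
by apply/pmf_modular/gen_subalg_const.
Qed.

Lemma pmf_opp f : pmf f -> pmf (- f).
Proof. by rewrite -scaleN1r; exact: pmf_scale. Qed.

Lemma pmf_sub f g : pmf f -> pmf g -> pmf (f - g).
Proof. by move=> hf hg; apply: pmf_add => //; exact: pmf_opp. Qed.

Lemma pmf1 : pmf 1.
Proof. exact/pmf_modular/gen_subalg1. Qed.

Lemma pmf0 : pmf 0.
Proof. exact/pmf_modular/gen_subalg0. Qed.

Lemma pmf_sum (I : eqType) (r : seq I) (f : I -> qseries K) :
  (forall i, i \in r -> pmf (f i)) -> pmf (\sum_(i <- r) f i).
Proof.
move=> h; rewrite big_seq; elim/big_ind: _ => //; first exact: pmf0.
exact: pmf_add.
Qed.

End Ultrametric.

(** * The divisor series of weight two *)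

Section Serre.
Variables (K : uNormFieldType) (p : nat).
Hypothesis hp : prime p.
Hypothesis char0 : forall n, n.+1%:R != 0 :> K.
Hypothesis normp : unorm (p%:R : K) = p%:R^-1.
Local Notation pmf := (padic_modular_forms K).
Local Notation sigma_series := (@sigma_series K).

Lemma unorm_pX k : unorm ((p ^ k)%:R : K) = p%:R^-1 ^+ k.
Proof. by rewrite natrX unormX normp. Qed.

Lemma pV_small (e : rat) : 0 < e -> exists N, forall k, (N <= k)%N -> p%:R^-1 ^+ k <= e.
Proof.
move=> e0; exists (Num.bound e^-1) => k hk.
rewrite exprVn -[e]invrK lef_pV2 ?posrE ?invr_gt0 ?exprn_gt0 ?ltr0n ?prime_gt0 //.
rewrite -natrX; apply: ltW; apply: (lt_trans (archi_boundP _)).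
  by rewrite invr_ge0 ltW.
by rewrite ltr_nat (leq_ltn_trans hk) // ltn_expl // prime_gt1.
Qed.

Lemma pV_ge0 k : 0 <= p%:R^-1 ^+ k :> rat.
Proof. by rewrite exprn_ge0 // invr_ge0 ler0n. Qed.

Lemma unorm_dvd k m : (p ^ k %| m)%N -> unorm (m%:R : K) <= p%:R^-1 ^+ k.
Proof.
move=> /dvdnP[q ->]; rewrite natrM unormM unorm_pX.
by rewrite ler_piMl ?pV_ge0 // unorm_nat_le1.
Qed.

Lemma unorm_eqmod k m n : m = n %[mod p ^ k] ->
  unorm (m%:R - n%:R : K) <= p%:R^-1 ^+ k.
Proof.
(* Symmetry allows the truncated subtraction m - n. *)
wlog le_nm : m n / (n <= m)%N => [hw|] h.
  have [|/ltnW] := leqP n m => nm; first exact: hw.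
  by rewrite unorm_distC; apply: hw.
rewrite -natrB // unorm_dvd // -eqn_mod_dvd //; exact/eqP.
Qed.

(** The substitution q -> q^(p^i). *)
Definition qdilate i (f : qseries K) : qseries K :=
  fun n => if (p ^ i %| n)%N then f (n %/ p ^ i)%N else 0.

(** The divisor series without its Euler factor at p. *)
Definition sigma_depleted e : qseries K := lambert (fun d => if (p %| d)%N then 0 else d%:R ^+ e).

Lemma qdilateD i f g : qdilate i (f + g) = qdilate i f + qdilate i g.
Proof. by apply/funext => n; rewrite qaddE /qdilate; case: ifP; rewrite ?addr0. Qed.

Lemma qdilateB i f g : qdilate i (f - g) = qdilate i f - qdilate i g.
Proof. by apply/funext => n; rewrite qaddE qoppE /qdilate; case: ifP; rewrite ?subr0. Qed.

Lemma qdilateZ i a f : qdilate i (a *: f) = a *: qdilate i f.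
Proof. by apply/funext => n; rewrite qscaleE /qdilate; case: ifP; rewrite ?mulr0. Qed.

Lemma qdilate0 f : qdilate 0 f = f.
Proof. by apply/funext => n; rewrite /qdilate dvd1n divn1. Qed.

Lemma qdilateS i f : qdilate i (qdilate 1 f) = qdilate i.+1 f.
Proof.
have p0 := prime_gt0 hp; have pi0 : (0 < p ^ i)%N by rewrite expn_gt0 p0.
apply/funext => n; rewrite /qdilate expn1.
case: ifP => [/dvdnP[m ->]|hn].
  by rewrite mulnK // expnS dvdn_pmul2r // divnMr.
by case: ifP => // h; move: hn; rewrite (dvdn_trans _ h) // expnS dvdn_mull.
Qed.

Lemma qdilate_bound i f B : qbounded f B -> qbounded (qdilate i f) B.
Proof.
move=> h n; rewrite /qdilate; case: ifP => _ //.
by rewrite unorm0 (le_trans (unorm_ge0 _) (h 0%N)).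
Qed.

(** The divisors of n divisible by p are the multiples by p of the divisors of
    n / p. *)
Lemma sigma_split e : sigma_series e = sigma_depleted e + (p ^ e)%:R *: qdilate 1 (sigma_series e).
Proof.
have p0 := prime_gt0 hp.
apply/funext => n; rewrite qaddE qscaleE /qdilate expn1 /sigma_depleted /sigma_series /lambert.
case: n => [|n] /=; first by rewrite dvdn0 div0n mulr0 addr0.
rewrite (bigID (fun d => (p %| d)%N)) /= addrC; congr (_ + _).
  by rewrite big_mkcond /=; apply: eq_bigr => d _; case: (p %| d)%N.
case: ifP => pn; last first.
  rewrite mulr0 -big_filter big1_seq // => d; rewrite mem_filter -dvdn_divisors //.
  by move=> /andP[_ /andP[pd /(dvdn_trans pd)]]; rewrite pn.
have q0 : (0 < n.+1 %/ p)%N by rewrite divn_gt0 // dvdn_leq.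
rewrite -big_filter (negPf (lt0n_neq0 q0)) mulr_sumr; apply: esym.
rewrite (eq_bigr (fun d => (p * d)%:R ^+ e)) => [|d _]; last by rewrite natrX natrM exprMn.
apply: (@big_seq_bij K nat nat _ _ (fun d => p * d)%N (fun d => d %/ p)%N (fun d => d%:R ^+ e)).
- exact: divisors_uniq.
- exact/filter_uniq/divisors_uniq.
- move=> d; rewrite mem_filter -!dvdn_divisors // => hd.
  by rewrite dvdn_mulr // mulKn // -(divnK pn) mulnC dvdn_pmul2r.
- move=> d; rewrite mem_filter -!dvdn_divisors // => /andP[pd dn].
  by split; [rewrite -(dvdn_pmul2r p0) !divnK | rewrite mulnC divnK].
Qed.

(** Let e' be the larger exponent. If p does not divide d, then d^e' = d^e
    modulo p^(N+1) by Euler's theorem; if p divides d, then p^e' and hence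
    p^(N+1) divides d^e'. The factor 2 preserves the parity of the
    exponent. *)
Lemma sigma_depleted_lim e N :
  qbounded (sigma_series (e + 2 * totient (p ^ N.+1)) - sigma_depleted e) (p%:R^-1 ^+ N.+1).
Proof.
set e' := (e + _)%N.
have p0 := prime_gt0 hp.
rewrite -scaleN1r -lambertZ -lambertD; apply: lambert_bound; first exact: pV_ge0.
move=> d; case: ifP => [pd|pd].
  rewrite mulr0 addr0 -natrX unorm_dvd //.
  apply: dvdn_trans (dvdn_exp2r e' pd); apply: dvdn_exp2l.
  rewrite /e' totient_pfactor //= (leq_trans _ (leq_addl _ _)) //.
  have : (N < p ^ N)%N by rewrite ltn_expl // prime_gt1.
  have := prime_gt1 hp; nia.
rewrite mulN1r -!natrX; apply: unorm_eqmod.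
have cop : coprime (d ^ 2) (p ^ N.+1).
  by rewrite coprimeXr // coprimeXl // coprime_sym prime_coprime // pd.
by rewrite /e' expnD expnM -modnMmr (Euler_exp_totient cop) modnMmr muln1.
Qed.

(** By [sigma_split], the substitution q -> q^p maps a divisor series to the
    difference of the series and its depleted part, divided by a power of p.
    The depleted part is a limit of divisor series, so induction on i applies
    to both. *)
Lemma pmf_qdilate_sigma i k : pmf (qdilate i (sigma_series k.*2.+3)).
Proof.
elim: i k => [|i IH] k; first by rewrite qdilate0; apply/pmf_modular/sigma_series_modular.
have h : pmf (qdilate i (sigma_depleted k.*2.+3)).
  apply: pmf_closed => e e0; have [N hN] := pV_small e0.
  exists (qdilate i (sigma_series (k + totient (p ^ N.+1)).*2.+3)); first exact: IH.
  apply/sup_dist_leE; rewrite -qdilateB; apply: qdilate_bound => n.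
  rewrite qaddE qoppE unorm_distC.
  rewrite (le_trans _ (hN _ (leqnSn N))) //.
  have -> : ((k + totient (p ^ N.+1)).*2.+3 = k.*2.+3 + 2 * totient (p ^ N.+1))%N by lia.
  exact: sigma_depleted_lim.
have e0 : (p ^ k.*2.+3)%:R != 0 :> K by apply: natr_neq0 => //; rewrite expn_gt0 prime_gt0.
have -> : qdilate i.+1 (sigma_series k.*2.+3) =
    (p ^ k.*2.+3)%:R^-1 *: (qdilate i (sigma_series k.*2.+3) - qdilate i (sigma_depleted k.*2.+3)).
  rewrite -qdilateB [X in qdilate i (X - _)]sigma_split addrAC subrr add0r qdilateZ qdilateS.
  by rewrite scalerA mulVf // scale1r.
by apply/pmf_scale/pmf_sub.
Qed.

Lemma pmf_qdilate_depleted1 i : pmf (qdilate i (sigma_depleted 1)).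
Proof.
apply: pmf_closed => e e0; have [N hN] := pV_small e0.
pose t := totient (p ^ N.+1).
have t0 : (0 < t)%N by rewrite totient_gt0 expn_gt0 prime_gt0.
exists (qdilate i (sigma_series t.-1.*2.+3)); first exact: pmf_qdilate_sigma.
apply/sup_dist_leE; rewrite -qdilateB; apply: qdilate_bound => n.
rewrite qaddE qoppE unorm_distC (le_trans _ (hN _ (leqnSn N))) //.
have -> : (t.-1.*2.+3 = 1 + 2 * totient (p ^ N.+1))%N by rewrite -/t; lia.
exact: sigma_depleted_lim.
Qed.

(** Iterating [sigma_split] gives a sum of depleted series in q^(p^i) with
    coefficients p^i, which converges in the sup-norm. *)
Theorem pmf_sigma1 : pmf (sigma_series 1).
Proof.
have h N : sigma_series 1 =
    \sum_(i < N) (p ^ i)%:R *: qdilate i (sigma_depleted 1) +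
    (p ^ N)%:R *: qdilate N (sigma_series 1).
  elim: N => [|N IH]; first by rewrite big_ord0 add0r qdilate0 scale1r.
  rewrite big_ord_recr /= -addrA {1}IH; congr (_ + _).
  rewrite {1}sigma_split qdilateD qdilateZ qdilateS scalerDr scalerA -natrM.
  by rewrite expn1 -expnSr.
apply: pmf_closed => e e0; have [N hN] := pV_small e0.
exists (\sum_(i < N) (p ^ i)%:R *: qdilate i (sigma_depleted 1)).
  rewrite -big_enum; apply: pmf_sum => i _; apply: pmf_scale; exact: pmf_qdilate_depleted1.
apply/sup_dist_leE => n; rewrite {1}(h N) addrAC subrr add0r qscaleE unormM unorm_pX.
rewrite (le_trans _ (hN N (leqnn N))) // ler_piMr ?pV_ge0 //.
apply: qdilate_bound; apply: lambert_bound => // d.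
by rewrite -natrX unorm_nat_le1.
Qed.

Theorem pmf_sigma_odd k : pmf (sigma_series k.*2.+1).
Proof.
by case: k => [|k]; [exact: pmf_sigma1|apply/pmf_modular/sigma_series_modular].
Qed.

End Serre.

(** * Heisenberg modes on monomials *)

Section Weight.
Implicit Types m : {cmonom nat}.

Lemma weightEw m (d : {fset nat}) : (finsupp m `<=` d)%fset ->
  weight m = (\sum_(i <- d) m i * i.+1)%N.
Proof.
move=> h; rewrite /weight (big_fset_incl _ h) //= => i _ hi.
by rewrite -cmE_eq0 in hi; rewrite (eqP hi).
Qed.

Lemma weightM m1 m2 : weight (mulcm m1 m2) = (weight m1 + weight m2)%N.
Proof.
pose d := (finsupp m1 `|` finsupp m2)%fset.
rewrite (@weightEw _ d) ?(@weightEw m1 d) ?(@weightEw m2 d).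
- by rewrite -big_split /=; apply: eq_bigr => i _; rewrite mulcmE mulnDl.
- exact: fsubsetUr.
- exact: fsubsetUl.
- by rewrite (mdomD m1 m2).
Qed.

Lemma weightU i : weight (ucm i) = i.+1.
Proof. by rewrite /weight mdomU big_seq_fset1 ucmE eqxx mul1n. Qed.

Lemma weight1 : weight (onecm nat) = 0%N.
Proof. by rewrite /weight mdom1 big_seq_fset0. Qed.

Lemma leq_weight m i : (m i * i.+1 <= weight m)%N.
Proof.
have [h|h] := boolP (i \in finsupp m); last first.
  by rewrite -cmE_eq0 in h; rewrite (eqP h).
rewrite /weight (big_rem i) //=; exact: leq_addr.
Qed.

Lemma divcmK m i : (0 < m i)%N -> mulcm (divcm m (ucm i)) (ucm i) = m.
Proof.
move=> mi; apply/eqP/cmP => j; rewrite mulcmE divcmE ucmE.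
by case: eqP => [<-|_]; rewrite ?subn0 ?addn0 // subnK.
Qed.

Lemma mulcmK m i : divcm (mulcm m (ucm i)) (ucm i) = m.
Proof. by apply/eqP/cmP => j; rewrite divcmE mulcmE addnK. Qed.

Lemma mulcmU m i : mulcm m (ucm i) i = (m i).+1.
Proof. by rewrite mulcmE ucmE eqxx addn1. Qed.

End Weight.

Section Modes.
Variable K : fieldType.
Local Notation S := (heis K).
Implicit Types (u v : S) (m : {cmonom nat}).

Lemma heisD u v m : (u + v)@_m = u@_m + v@_m.
Proof. exact: mcoeffD. Qed.

Lemma heisB u v m : (u - v)@_m = u@_m - v@_m.
Proof. exact: mcoeffB. Qed.

Lemma heisZ a u m : (a *: u)@_m = a * u@_m.
Proof. exact: mcoeffZ. Qed.

Lemma heis0 m : (0 : S)@_m = 0.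
Proof. exact: mcoeff0. Qed.

Lemma heis_sum (I : Type) (r : seq I) (P : pred I) (F : I -> S) m :
  (\sum_(i <- r | P i) F i)@_m = \sum_(i <- r | P i) (F i)@_m.
Proof. by elim/big_rec2: _ => [|i x y _ <-]; rewrite ?heis0 ?heisD. Qed.

Lemma heisP u v : (forall m, u@_m = v@_m) -> u = v.
Proof. by move=> h; apply/malgP. Qed.

Lemma mcoeff_mulU i u m : (mon K (ucm i) * u)@_m =
  if (0 < m i)%N then u@_(divcm m (ucm i)) else 0.
Proof.
rewrite mcoeffMl /mon msuppU1 big_seq_fset1 mcoeffUU.
under eq_bigr do rewrite mul1r.
have h m' : (mulcm (ucm i) m' == m) = ((0 < m i)%N && (m' == divcm m (ucm i))).
  apply/eqP/andP => [<-|[mi /eqP ->]].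
    by rewrite mulcmC mulcmU mulcmK.
  by rewrite mulcmC divcmK.
under eq_bigr do rewrite h.
case: ifP => mi /=; last by rewrite big1.
have [hm|hm] := boolP (divcm m (ucm i) \in msupp u); last first.
  rewrite (mcoeff_outdom hm) big1_seq // => m' /= hm'.
  by case: eqP => // e; move: hm' hm; rewrite e => ->.
rewrite (big_rem _ hm) /= eqxx big1_seq ?addr0 // => m' /=.
by rewrite mem_rem_uniq ?fset_uniq // inE => /andP[/negPf ->].
Qed.

Lemma mcoeff_dvar i u m : (dvar i u)@_m = (m i).+1%:R * u@_(mulcm m (ucm i)).
Proof.
rewrite mulr_natl.
rewrite /dvar raddf_sum /=.
have h m' : << u@_m' *+ m' i *g divcm m' (ucm i) >>@_m =
   if m' == mulcm m (ucm i) then u@_m' *+ (m i).+1 else 0.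
  rewrite mcoeffU; case: eqP => [e|ne]; case: eqP => [e'|ne'] //=.
  - by rewrite e' mulcmU.
  - have [mi|] := ltnP 0 (m' i); last by rewrite leqn0 => /eqP ->; rewrite mulr0n.
    by case: ne'; rewrite -e divcmK.
  - by case: ne; rewrite e' mulcmK.
under eq_bigr do rewrite h.
have [hm|hm] := boolP (mulcm m (ucm i) \in msupp u); last first.
  rewrite (mcoeff_outdom hm) mul0rn big1_seq // => m' /= hm'.
  by case: eqP => // e; move: hm' hm; rewrite e => ->.
rewrite (big_rem _ hm) /= eqxx big1_seq ?addr0 // => m' /=.
by rewrite mem_rem_uniq ?fset_uniq // inE => /andP[/negPf ->].
Qed.

(** The coefficients of [hmode n u]. Traces only see coefficients, so below a
    family h of operators with these coefficients stands for the modes. *)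
Definition mode_coef (n : int) (u : S) m : K :=
  match n with
  | Negz i => if (0 < m i)%N then u@_(divcm m (ucm i)) else 0
  | Posz 0 => 0
  | Posz i.+1 => i.+1%:R * ((m i).+1%:R * u@_(mulcm m (ucm i)))
  end.

Lemma hmodeE n u m : (hmode n u)@_m = mode_coef n u m.
Proof.
case: n => [[|i]|i] /=; first exact: heis0.
- by rewrite (heisZ i.+1%:R (dvar i u)) mcoeff_dvar.
- exact: mcoeff_mulU.
Qed.

End Modes.

Section AbstractModes.
Variable K : fieldType.
Local Notation S := (heis K).
Variable h : int -> S -> S.
Hypothesis hE : forall n u m, (h n u)@_m = mode_coef n u m.
Implicit Types (u v : S) (m : {cmonom nat}).

Lemma modeP n a u v : h n (a *: u + v) = a *: h n u + h n v.
Proof.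
apply: heisP => m; rewrite heisD heisZ !hE; case: n => [[|i]|i] /=.
- by rewrite mulr0 addr0.
- by rewrite heisD heisZ !mulrDr; congr (_ + _); ring.
- by case: ifP => _; rewrite ?mulr0 ?addr0 // heisD heisZ.
Qed.

(** All cases are immediate except the creation and the annihilation of one
    and the same variable of exponent e, where the commutator is the factor (e
    + 1) - e. *)
Lemma mode_comm n l u : h n (h l u) - h l (h n u) =
  if n + l == 0 then n%:~R *: u else 0.
Proof.
have ifE (b : bool) x m : (if b then x *: u else 0)@_m = if b then x * u@_m else 0.
  by case: b; rewrite ?heisZ ?heis0.
have eqcm m i j : i <> j ->
    mulcm (divcm m (ucm j)) (ucm i) = divcm (mulcm m (ucm i)) (ucm j).
  move=> ij; apply/eqP/cmP => k; rewrite mulcmE !divcmE mulcmE !ucmE.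
  case: (j =P k) => [<-|_]; last by rewrite !subn0.
  by case: (i =P j) => // _; rewrite !addn0.
have cross i j m : (h i.+1 (h (Negz j) u))@_m - (h (Negz j) (h i.+1 u))@_m =
   if i == j then i.+1%:R * u@_m else 0.
  rewrite !hE /= !hE /= mulcmE ucmE.
  have [->|ij] := eqVneq i j.
    rewrite addn1 /= mulcmK; case: ltnP => [mj|].
      rewrite divcmK // divcmE ucmE eqxx subn1 prednK // -(@natr1 _ (m j)); ring.
    by rewrite leqn0 => /eqP ->; rewrite subr0 mul1r.
  rewrite addn0; case: ifP => _; last by rewrite !mulr0 subrr.
  rewrite divcmE ucmE eq_sym (negPf ij) subn0 eqcm ?subrr //; exact/eqP.
apply: heisP => m; rewrite heisB ifE.
case: n l => [[|i]|i] [[|j]|j].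
- by rewrite subrr /= mul0r ?if_same.
- by rewrite !hE /= !hE /= !mulr0 subrr.
- by rewrite !hE /= !hE /= if_same subrr.
- by rewrite !hE /= !hE /= !mulr0 subrr.
- rewrite !hE /= !hE /= -!mulcmA (mulcmC (ucm i)) !mulcmE !ucmE (eq_sym j).
  case: (i =P j) => [->|_]; first by rewrite subrr.
  rewrite !addn0; ring.
- by rewrite cross NegzE subr_eq0 eqz_nat eqSS.
- by rewrite !hE /= !hE /= if_same subrr.
- rewrite -opprB cross NegzE addrC subr_eq0 eqz_nat eqSS.
  by case: eqP => [->|_]; rewrite ?oppr0 // mulrNz mulNr.
- rewrite !hE /= !hE /= !divcmE !ucmE.
  have dd : divcm (divcm m (ucm j)) (ucm i) = divcm (divcm m (ucm i)) (ucm j).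
    by apply/eqP/cmP => k; rewrite !divcmE subnAC.
  rewrite dd; have [->|ij] := eqVneq i j; first by rewrite subrr.
  rewrite !subn0.
  by case: (0 < m i)%N; case: (0 < m j)%N; rewrite ?subrr.
Qed.

End AbstractModes.

(** * Normally ordered products of Heisenberg modes *)

Fixpoint removals (T : Type) (s : seq T) : seq (T * seq T) :=
  if s is x :: s' then (x, s') :: [seq (y.1, x :: y.2) | y <- removals s'] else [::].

Section NormalProduct.
Variables (K : fieldType) (V : lmodType K) (h : int -> V -> V).
Hypothesis hP : forall n a u v, h n (a *: u + v) = a *: h n u + h n v.
Hypothesis h_comm : forall n l u, h n (h l u) - h l (h n u) =
  if n + l == 0 then n%:~R *: u else 0.

Lemma modes0 n : h n 0 = 0.
Proof.
by have := hP n (-1) 0 0; rewrite scaler0 addr0 scaleN1r addNr.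
Qed.

Lemma modesD n u v : h n (u + v) = h n u + h n v.
Proof. by rewrite -[u]scale1r hP !scale1r. Qed.

Lemma modesZ n a u : h n (a *: u) = a *: h n u.
Proof. by rewrite -[a *: u]addr0 hP modes0 addr0. Qed.

Lemma modesB n u v : h n (u - v) = h n u - h n v.
Proof. by rewrite addrC -scaleN1r hP scaleN1r addrC. Qed.

Lemma modes_sum (I : Type) (r : seq I) (F : I -> V) n :
  h n (\sum_(i <- r) F i) = \sum_(i <- r) h n (F i).
Proof. by elim/big_rec2: _ => [|i x y _ <-]; rewrite ?modes0 ?modesD. Qed.

(** The part lowering the weight by d of the normally ordered product of the
    fields sum_j f(j) h_j z^(-j) with f in s, restricted to the modes with
    index at most M in absolute value. The cutoff makes every sum finite, so
    the identities below hold on all of V. *)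
Fixpoint norder (M : nat) (s : seq (int -> K)) (d : int) (u : V) : V :=
  if s is f :: s' then
    \sum_(i < M) (f (Negz i) *: h (Negz i) (norder M s' (d + i.+1%:Z) u)
                + f i.+1%:Z *: norder M s' (d - i.+1%:Z) (h i.+1%:Z u))
  else if d == 0 then u else 0.

Lemma norderP M s d a u v : norder M s d (a *: u + v) = a *: norder M s d u + norder M s d v.
Proof.
elim: s d u v => [|f s IH] d u v /=; first by case: eqP; rewrite ?scaler0 ?addr0.
rewrite scaler_sumr -big_split; apply: eq_bigr => i _ /=.
rewrite IH !hP IH !scalerDr !scalerA ![a * _]mulrC -!addrA; congr (_ + _).
by rewrite addrCA.
Qed.

Lemma norder0 M s d : norder M s d 0 = 0.
Proof.
by have := norderP M s d (-1) 0 0; rewrite scaler0 addr0 scaleN1r addNr.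
Qed.

Lemma norderZ M s d a u : norder M s d (a *: u) = a *: norder M s d u.
Proof. by rewrite -[a *: u]addr0 norderP norder0 addr0. Qed.

Lemma norderB M s d u v : norder M s d (u - v) = norder M s d u - norder M s d v.
Proof. by rewrite addrC -scaleN1r norderP scaleN1r addrC. Qed.

(** The commutator of h_n with a field is a scalar multiple of the identity;
    so commuting h_n through the product deletes one factor at a time and does
    not disturb the normal order. *)
Lemma norder_commutator M s d n u : (`|n| <= M)%N ->
  h n (norder M s d u) - norder M s d (h n u) =
  \sum_(x <- removals s) (n%:~R * x.1 (- n)) *: norder M x.2 (d + n) u.
Proof.
move=> nM; elim: s d u => [|f s IH] d u /=.
  by rewrite big_nil; case: eqP; rewrite ?modes0 subrr.
rewrite modes_sum -sumrB big_cons big_map /=.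
under [X in _ = _ + X]eq_bigr do rewrite scaler_sumr.
rewrite [X in _ = _ + X]exchange_big /=.
have step (i : 'I_M) :
  h n (f (Negz i) *: h (Negz i) (norder M s (d + i.+1%:Z) u) +
         f i.+1%:Z *: norder M s (d - i.+1%:Z) (h i.+1%:Z u)) -
    (f (Negz i) *: h (Negz i) (norder M s (d + i.+1%:Z) (h n u)) +
     f i.+1%:Z *: norder M s (d - i.+1%:Z) (h i.+1%:Z (h n u))) =
  ((if n == i.+1%:Z then (n%:~R * f (- n)) *: norder M s (d + n) u else 0) +
   (if n == Negz i then (n%:~R * f (- n)) *: norder M s (d + n) u else 0)) +
  \sum_(x <- removals s) (n%:~R * x.1 (- n)) *:
     (f (Negz i) *: h (Negz i) (norder M x.2 (d + n + i.+1%:Z) u) +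
      f i.+1%:Z *: norder M x.2 (d + n - i.+1%:Z) (h i.+1%:Z u)).
  rewrite hP modesZ opprD addrACA -!scalerBr.
  set w1 := norder M s (d + i.+1%:Z).
  have -> : h n (h (Negz i) (w1 u)) - h (Negz i) (w1 (h n u)) =
     (if n == i.+1%:Z then n%:~R *: w1 u else 0) +
     h (Negz i) (h n (w1 u) - w1 (h n u)).
    rewrite modesB addrA -[X in _ = X + _ - _](_ :
      h n (h (Negz i) (w1 u)) - h (Negz i) (h n (w1 u)) = _).
      by rewrite subrK.
    by rewrite h_comm NegzE subr_eq0.
  set w2 := norder M s (d - i.+1%:Z).
  have -> : h n (w2 (h i.+1%:Z u)) - w2 (h i.+1%:Z (h n u)) =
     (if n == Negz i then n%:~R *: w2 u else 0) +
     (h n (w2 (h i.+1%:Z u)) - w2 (h n (h i.+1%:Z u))).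
    have -> : (if n == Negz i then n%:~R *: w2 u else 0) =
       w2 (h n (h i.+1%:Z u) - h i.+1%:Z (h n u)).
      by rewrite h_comm NegzE -addr_eq0 /w2; case: eqP => _; rewrite ?norder0 ?norderZ.
    by rewrite /w2 norderB [RHS]addrC addrA subrK.
  rewrite /w1 /w2 !IH modes_sum !scalerDr addrACA; congr (_ + _).
    congr (_ + _); case: eqP => [->|_]; rewrite ?scaler0 // scalerA mulrC.
      by rewrite NegzE.
    by rewrite NegzE opprK.
  rewrite !scaler_sumr -big_split; apply: eq_bigr => x _ /=.
  rewrite modesZ scalerDr !scalerA ![_ * f _]mulrC.
  by rewrite (addrAC d _ n) (addrAC d _ n).
rewrite (eq_bigr _ (fun i _ => step i)) big_split; congr (_ + _) => /=.
case: n nM {step IH} => [[_|n nM]|n nM].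
- rewrite mul0r scale0r big1 // => i _; by rewrite addr0.
- rewrite (bigD1 (Ordinal nM)) //= eqxx addr0 big1 ?addr0 // => i /eqP ni.
  rewrite eqz_nat eqSS addr0; case: eqP => // e; case: ni; exact: val_inj.
- rewrite (bigD1 (Ordinal nM)) //= eqxx add0r big1 ?addr0 // => i /eqP ni.
  rewrite add0r; case: eqP => // -[e]; case: ni; exact: val_inj.
Qed.

Lemma norder_commute_annih M s i u : (i < M)%N ->
  h i.+1%:Z (norder M s (- i.+1%:Z) u) = norder M s (- i.+1%:Z) (h i.+1%:Z u) +
  \sum_(x <- removals s) (i.+1%:R * x.1 (- i.+1%:Z)) *: norder M x.2 0 u.
Proof.
move=> iM; have := @norder_commutator M s (- i.+1%:Z) i.+1%:Z u iM.
move/(canRL (subrK _)) => ->; rewrite addrC; congr (_ + _).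
by apply: eq_bigr => x _; rewrite addNr.
Qed.

Lemma norder_commute_create M s i u : (i < M)%N ->
  norder M s i.+1%:Z (h (Negz i) u) = h (Negz i) (norder M s i.+1%:Z u) +
  \sum_(x <- removals s) (i.+1%:R * x.1 i.+1%:Z) *: norder M x.2 0 u.
Proof.
move=> iM; have := @norder_commutator M s i.+1%:Z (Negz i) u iM.
move/(canRL (subrK _)) => ->; rewrite addrAC -big_split big1 ?add0r // => x _ /=.
by rewrite NegzE opprK subrr -scalerDl mulrNz mulNr addNr scale0r.
Qed.

Lemma eq_norder_cons M f s t d u :
  (forall d u, norder M s d u = norder M t d u) -> norder M (f :: s) d u = norder M (f :: t) d u.
Proof. by move=> st /=; apply: eq_bigr => i _; rewrite !st. Qed.

(** Annihilation modes commute with each other, and so do creation modes; all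
    creation modes stand on the left. *)
Lemma norder_swap M f g s d u : norder M [:: f, g & s] d u = norder M [:: g, f & s] d u.
Proof.
have cr (i j : nat) v : h (Negz i) (h (Negz j) v) = h (Negz j) (h (Negz i) v).
  by apply/eqP; rewrite -subr_eq0 h_comm; case: eqP.
have an (i j : nat) v : h i.+1%:Z (h j.+1%:Z v) = h j.+1%:Z (h i.+1%:Z v).
  by apply/eqP; rewrite -subr_eq0 h_comm; case: eqP.
pose X f g (i k : nat) := f (Negz i) *: (g (Negz k) *: h (Negz i) (h (Negz k)
   (norder M s (d + i.+1%:Z + k.+1%:Z) u))).
pose Y f g (i k : nat) := f (Negz i) *: (g k.+1%:Z *: h (Negz i)
   (norder M s (d + i.+1%:Z - k.+1%:Z) (h k.+1%:Z u))).
pose Z f g (i k : nat) := f i.+1%:Z *: (g k.+1%:Z *: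
   (norder M s (d - i.+1%:Z - k.+1%:Z) (h k.+1%:Z (h i.+1%:Z u)))).
have E f' g' : norder M [:: f', g' & s] d u =
   \sum_(i < M) \sum_(k < M) (X f' g' i k + Y f' g' i k + (Y g' f' k i + Z f' g' i k)).
  apply: eq_bigr => i _; rewrite modes_sum !scaler_sumr -big_split; apply: eq_bigr => k _ /=.
  rewrite modesD !modesZ !scalerDr; congr (_ + _); congr (_ + _).
  rewrite /Y !scalerA mulrC; congr (_ *: h _ (norder _ _ _ _)).
  by rewrite addrAC.
rewrite !E exchange_big; apply: eq_bigr => i _; apply: eq_bigr => k _ /=.
have -> : X f g k i = X g f i k.
  rewrite /X !scalerA mulrC cr; congr (_ *: h _ (h _ (norder _ _ _ _))).
  by rewrite addrAC.
have -> : Z f g k i = Z g f i k.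
  by rewrite /Z !scalerA mulrC an; congr (_ *: (norder _ _ _ _)); rewrite addrAC.
by rewrite -!addrA; congr (_ + _); rewrite addrCA.
Qed.

Lemma norder_front M f a b d u : norder M (a ++ f :: b) d u = norder M (f :: a ++ b) d u.
Proof.
elim: a d u => [//|g a IH] d u; rewrite cat_cons.
by rewrite (eq_norder_cons _ _ _ IH) norder_swap.
Qed.

End NormalProduct.

(** * Weights and traces *)

(** In a monomial of weight N only the first N variables occur, with exponents
    at most N. *)
Lemma finite_weight N : finite_set [set m : {cmonom nat} | weight m = N].
Proof.
pose D := [fset i in iota 0 N]%fset.
pose g (f : {ffun 'I_N -> 'I_N.+1}) : {cmonom nat} :=
  [cmonom (if insub i is Some j then val (f j) else 0%N) | i in D]%M.
apply: (@sub_finite_set _ _ (range g)); last exact/finite_image/finite_finset.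
move=> m /= wm; exists [ffun i : 'I_N => inord (m i)] => //.
apply/eqP/cmP => i; rewrite /g cmE fsfunE.
have lw := leq_weight m i; rewrite wm in lw.
case: ifP; rewrite !inE mem_iota /= add0n.
  move=> iN; rewrite insubT /= ffunE inordK // ltnS.
  by apply: leq_trans lw; rewrite leq_pmulr.
move/negbT; rewrite -leqNgt => Ni; case: (m i) lw => [//|k].
by rewrite mulSn => h; exfalso; lia.
Qed.

Definition weight_mons N : seq {cmonom nat} := fset_set [set m : {cmonom nat} | weight m = N].

Lemma mem_weight_mons N m : (m \in weight_mons N) = (weight m == N).
Proof.
rewrite /weight_mons in_fset_set; last exact: finite_weight.
by apply/idP/eqP => [|h]; rewrite inE.
Qed.

Lemma uniq_weight_mons N : uniq (weight_mons N). Proof. exact: fset_uniq. Qed.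

Section Trace.
Variable K : fieldType.
Local Notation S := (heis K).
Implicit Types (u v : S) (m : {cmonom nat}).

Lemma weight_traceE N (f : S -> S) : weight_trace N f = \sum_(m <- weight_mons N) (f (mon K m))@_m.
Proof.
rewrite /weight_trace (fsbigE (weight_mons N)) ?uniq_weight_mons //=.
- rewrite big_seq_cond [RHS]big_seq; apply: eq_bigl => m.
  have [mW|//] := boolP (m \in weight_mons N); apply/mem_set.
  by move: mW; rewrite mem_weight_mons => /eqP.
- by move=> m /=; rewrite mem_weight_mons => /eqP.
- by move=> m <-; rewrite mem_weight_mons eqxx.
Qed.

Variable h : int -> S -> S.
Hypothesis hE : forall n u m, (h n u)@_m = mode_coef n u m.

(** The weight w is an integer, so that the degree of a mode can always be
    subtracted from it; negative weights force u = 0. *)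
Definition homog (w : int) u := forall m, u@_m != 0 -> (weight m)%:Z = w.

Lemma homog0 w : homog w 0.
Proof. by move=> m; rewrite heis0 eqxx. Qed.

Lemma homogD w u v : homog w u -> homog w v -> homog w (u + v).
Proof.
move=> hu hv m; rewrite heisD; have [u0|u0 _] := eqVneq (u@_m) 0; last exact: hu.
by rewrite u0 add0r => /hv.
Qed.

Lemma homogZ w a u : homog w u -> homog w (a *: u).
Proof. by move=> hu m; rewrite heisZ mulf_eq0 negb_or => /andP[_ /hu]. Qed.

Lemma homog_sum w (I : Type) (r : seq I) (F : I -> S) :
  (forall i, homog w (F i)) -> homog w (\sum_(i <- r) F i).
Proof. by move=> hF; elim/big_ind: _ => //; [exact: homog0|exact: homogD]. Qed.

Lemma homog_lt0 w u : homog w u -> w < 0 -> u = 0.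
Proof.
move=> hu w0; apply: heisP => m; rewrite heis0; apply/eqP/negPn/negP => /hu e.
by move: w0; rewrite -e.
Qed.

Lemma homog_mon m : homog (weight m)%:Z (mon K m).
Proof. by move=> m'; rewrite /mon mcoeffU1; have [->|] := eqVneq m m'; rewrite ?eqxx. Qed.

Lemma homog_mode n w u : homog w u -> homog (w - n) (h n u).
Proof.
move=> hu m; rewrite hE; case: n => [[|i]|i] /=; first by rewrite eqxx.
  rewrite !mulf_eq0 !negb_or => /andP[_ /andP[_ /hu <-]].
  by rewrite weightM weightU PoszD addrK.
case: ifP => [mi|]; last by rewrite eqxx.
by move=> /hu <-; rewrite -{1}(divcmK mi) weightM weightU NegzE opprK PoszD.
Qed.

Local Notation norder := (norder h).
Let hP := modeP hE.
Let hcomm := mode_comm hE.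

Lemma homog_norder M s d w u : homog w u -> homog (w - d) (norder M s d u).
Proof.
elim: s d w u => [|f s IH] d w u hu /=.
  by case: eqP => [->|_]; [rewrite subr0|exact: homog0].
rewrite -big_enum; apply: homog_sum => i; apply: homogD; apply: homogZ.
  have := @homog_mode (Negz i) _ _ (IH (d + i.+1%:Z) _ _ hu).
  by rewrite (_ : w - _ - _ = w - d) // NegzE; ring.
have := IH (d - i.+1%:Z) _ _ (@homog_mode i.+1%:Z _ _ hu).
by rewrite (_ : w - _ - _ = w - d) //; ring.
Qed.

(** A mode of index beyond M either annihilates u or is a creation mode
    applied to a vector of negative weight. *)
Lemma norder_stable M M' s d w u : homog w u -> w <= M%:Z -> w - d <= M%:Z -> (M <= M')%N ->
  norder M' s d u = norder M s d u.
Proof.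
move=> hu0 wM0 wdM0 /subnKC; move: (M' - M)%N => k <-.
elim: s d w u hu0 wM0 wdM0 => [|f s IH] d w u hu wM wdM //=.
rewrite big_split_ord /= [X in _ + X]big1 ?addr0 => [|i _]; last first.
  have -> : h (Posz (M + i).+1) u = 0.
    by apply: (homog_lt0 (@homog_mode (Posz (M + i).+1) _ _ hu)); lia.
  rewrite (norder0 hP) scaler0 addr0.
  have -> : norder (M + k) s (d + (M + i).+1%:Z) u = 0.
    by apply: (homog_lt0 (@homog_norder (M + k)%N s (d + (M + i).+1%:Z) _ _ hu)); lia.
  by rewrite (modes0 hP) scaler0.
apply: eq_bigr => i _.
rewrite (IH (d + i.+1%:Z) _ _ hu wM); last by lia.
rewrite (IH (d - i.+1%:Z) _ _ (@homog_mode i.+1%:Z _ _ hu)) //; lia.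
Qed.

(** Cyclicity of the trace between two weight spaces. Multiplication by the
    variable identifies the monomials of weight N - (i + 1) with the monomials
    of weight N that it divides, and the others do not contribute. *)
Lemma trace_create N i (X : S -> S) :
  weight_trace N (fun u => h (Negz i) (X u)) =
  if (i < N)%N then weight_trace (N - i.+1) (fun u => X (h (Negz i) u)) else 0.
Proof.
rewrite !weight_traceE.
have hm m : h (Negz i) (mon K m) = mon K (mulcm m (ucm i)).
  apply: heisP => m'; rewrite hE /= /mon !mcoeffU1.
  case: ltnP => [mi|].
    have -> // : (m == divcm m' (ucm i)) = (mulcm m (ucm i) == m').
    by apply/eqP/eqP => [->|<-]; rewrite ?divcmK // mulcmK.
  rewrite leqn0 => m'0; case: eqP => // e; move: m'0; by rewrite -e mulcmU.
under eq_bigr do rewrite hE /=.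
rewrite -big_mkcond -big_filter /=.
case: ltnP => [iN|Ni]; last first.
  rewrite big1_seq // => m /=; rewrite mem_filter mem_weight_mons => /andP[mi /eqP wm].
  have := leq_weight m i; rewrite wm => lw; exfalso.
  move: lw; case: (m i) mi => // k _; rewrite mulSn; lia.
under [RHS]eq_bigr do rewrite hm.
apply: esym.
rewrite (eq_bigr (fun m => (X (mon K (mulcm m (ucm i))))@_(divcm (mulcm m (ucm i)) (ucm i)))).
  apply: (@big_seq_bij K {cmonom nat} {cmonom nat} _ _
    (fun m => mulcm m (ucm i)) (fun m => divcm m (ucm i))
    (fun m => (X (mon K m))@_(divcm m (ucm i)))).
  - exact: uniq_weight_mons.
  - exact/filter_uniq/uniq_weight_mons.
  - move=> m; rewrite mem_weight_mons mem_filter mem_weight_mons mulcmU weightM weightU => /eqP ->.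
    by rewrite subnK // eqxx mulcmK.
  - move=> m; rewrite mem_filter !mem_weight_mons => /andP[mi /eqP wm].
    rewrite divcmK //; split=> //.
    by rewrite -wm -{2}(divcmK mi) weightM weightU addnK.
by move=> m _; rewrite mulcmK.
Qed.

(** As for [trace_create]; the exponents produced by the derivative are the
    same on both sides. *)
Lemma trace_annih N i (X : S -> S) : (forall a u, X (a *: u) = a *: X u) ->
  weight_trace N (fun u => X (h i.+1%:Z u)) =
  if (i < N)%N then weight_trace (N - i.+1) (fun u => h i.+1%:Z (X u)) else 0.
Proof.
move=> XZ; rewrite !weight_traceE.
have hm m : h i.+1%:Z (mon K m) =
    if (0 < m i)%N then (i.+1%:R * (m i)%:R) *: mon K (divcm m (ucm i)) else 0 *: 0.
  apply: heisP => m'; rewrite hE /= /mon !mcoeffU1.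
  case: ltnP => [mi|m0].
    rewrite heisZ mcoeffU1 mulrA; case: eqP => [e|ne].
      by rewrite e mulcmU mulcmK eqxx.
    case: eqP => [e|]; last by rewrite !mulr0.
    by case: ne; rewrite -e divcmK.
  rewrite scale0r heis0; case: eqP => [e|]; last by rewrite !mulr0.
  by move: m0; rewrite e mulcmU.
under eq_bigr do rewrite hm.
rewrite (eq_bigr (fun m => if (0 < m i)%N then
   i.+1%:R * (m i)%:R * (X (mon K (divcm m (ucm i))))@_m else 0)); last first.
  by move=> m _; case: ifP; rewrite XZ heisZ ?mul0r.
rewrite -big_mkcond -big_filter /=.
case: ltnP => [iN|Ni]; last first.
  rewrite big1_seq // => m /=; rewrite mem_filter mem_weight_mons => /andP[mi /eqP wm].
  have := leq_weight m i; rewrite wm => lw; exfalso.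
  move: lw; case: (m i) mi => // k _; rewrite mulSn; lia.
apply: esym.
rewrite (eq_bigr (fun m => i.+1%:R * (mulcm m (ucm i) i)%:R *
   (X (mon K (divcm (mulcm m (ucm i)) (ucm i))))@_(mulcm m (ucm i)))).
  apply: (@big_seq_bij K {cmonom nat} {cmonom nat} _ _
    (fun m => mulcm m (ucm i)) (fun m => divcm m (ucm i))
    (fun m => i.+1%:R * (m i)%:R * (X (mon K (divcm m (ucm i))))@_m)).
  - exact: uniq_weight_mons.
  - exact/filter_uniq/uniq_weight_mons.
  - move=> m; rewrite mem_weight_mons mem_filter mem_weight_mons mulcmU weightM weightU => /eqP ->.
    by rewrite subnK // eqxx mulcmK.
  - move=> m; rewrite mem_filter !mem_weight_mons => /andP[mi /eqP wm].
    rewrite divcmK //; split=> //.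
    by rewrite -wm -{2}(divcmK mi) weightM weightU addnK.
by move=> m _; rewrite mulcmK mulcmU hE /= mulrA.
Qed.

End Trace.

(** * Wick's rule for traces *)

Section Shift.
Variable K : fieldType.
Implicit Types f g a b : qseries K.

Lemma qscaleAr x f g : x *: (f * g) = f * (x *: g).
Proof. by rewrite mulrC scalerAl mulrC. Qed.

Definition qpow (l : nat) : qseries K := fun n => (n == l)%:R.

Lemma qpowM l f n : (qpow l * f) n = if (l <= n)%N then f (n - l)%N else 0.
Proof.
rewrite qmulE; case: leqP => ln.
  rewrite (bigD1 (Ordinal (ln : (l < n.+1)%N))) //= /qpow eqxx mul1r big1 ?addr0 // => i ne.
  rewrite (_ : (i == l :> nat) = false) ?mul0r //.
  by apply: contraNF ne => /eqP e; apply/eqP/val_inj.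
rewrite big1 // => i _; rewrite /qpow (_ : (i == l :> nat) = false) ?mul0r //.
by rewrite ltn_eqF // (leq_ltn_trans _ ln) // -ltnS.
Qed.

(** Comparing coefficients, each one equals the coefficient l places
    before. *)
Lemma qpow_fix0 l f : (0 < l)%N -> f = qpow l * f -> f = 0.
Proof.
move=> l0 e; apply/funext; elim/ltn_ind => n IH; rewrite e qpowM.
by case: leqP => // ln; rewrite IH //; lia.
Qed.

(** The geometric series q^l / (1 - q^l), written as a Lambert series. *)
Definition geom (l : nat) : qseries K := lambert (fun d => (d == l)%:R).

Lemma geomE l n : (0 < l)%N -> geom l n = ((0 < n) && (l %| n))%N%:R.
Proof.
move=> l0; rewrite /geom /lambert; case: n => [//|n] /=.
have [h|h] := boolP (l %| n.+1)%N.
  rewrite (big_rem l) -?dvdn_divisors //= eqxx big1_seq ?addr0 // => d /=.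
  by rewrite mem_rem_uniq ?divisors_uniq // inE => /andP[/negPf ->].
rewrite big1_seq // => d /=; rewrite -dvdn_divisors // => hd.
by case: eqP => // e; move: hd; rewrite e (negPf h).
Qed.

Lemma geom_rec l : (0 < l)%N -> geom l = qpow l * (1 + geom l).
Proof.
move=> l0; apply/funext => n; rewrite qpowM; case: leqP => ln.
  rewrite qaddE qoneE !geomE // subn_eq0 subn_gt0.
  have -> : (l %| n - l)%N = (l %| n)%N by rewrite dvdn_subl.
  rewrite (leq_trans l0 ln) /=; case: (ltngtP l n) ln => // [ln|<-] _.
    by rewrite add0r.
  by rewrite dvdnn addr0.
rewrite geomE //; case: n ln => [//|n] ln /=.
by rewrite gtnNdvd.
Qed.

(** The hypothesis says that a = q^l (a + b). *)
Lemma geom_solve l a b : (0 < l)%N ->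
  (forall n, a n = if (l <= n)%N then a (n - l)%N + b (n - l)%N else 0) -> a = geom l * b.
Proof.
move=> l0 h; apply/eqP; rewrite -subr_eq0; apply/eqP/(qpow_fix0 l0).
have ea : a = qpow l * (a + b) by apply/funext => n; rewrite qpowM h.
rewrite {1}ea {1}(geom_rec l0); ring.
Qed.

End Shift.

Section TraceRecursion.
Variable K : fieldType.
Local Notation S := (heis K).
Variable h : int -> S -> S.
Hypothesis hE : forall n u m, (h n u)@_m = mode_coef n u m.
Local Notation norder := (norder h).
Let hP := modeP hE.
Let hcomm := mode_comm hE.

Lemma trace_eq N (f g : S -> S) : (forall u, f u = g u) -> weight_trace N f = weight_trace N g.
Proof. by move=> fg; congr weight_trace; apply/funext. Qed.

Lemma traceD N (f g : S -> S) :
  weight_trace N (fun u => f u + g u) = weight_trace N f + weight_trace N g.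
Proof. by rewrite !weight_traceE -big_split; apply: eq_bigr => m _; rewrite heisD. Qed.

Lemma traceZ N a (f : S -> S) : weight_trace N (fun u => a *: f u) = a * weight_trace N f.
Proof. by rewrite !weight_traceE mulr_sumr; apply: eq_bigr => m _; rewrite heisZ. Qed.

Lemma trace_sum N (I : Type) (r : seq I) (F : I -> S -> S) :
  weight_trace N (fun u => \sum_(i <- r) F i u) = \sum_(i <- r) weight_trace N (F i).
Proof.
rewrite weight_traceE; under eq_bigr do rewrite heis_sum.
by rewrite exchange_big; apply: eq_bigr => i _; rewrite weight_traceE.
Qed.

Definition cutoff_trace M s : qseries K := fun N => weight_trace N (norder M s 0).
(** In weight N the cutoff N is enough, by [norder_stable]. *)
Definition trace_series s : qseries K := fun N => weight_trace N (norder N s 0).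

Lemma cutoff_traceE M s N : (N <= M)%N -> cutoff_trace M s N = trace_series s N.
Proof.
move=> NM; rewrite /cutoff_trace /trace_series !weight_traceE; apply: eq_big_seq => m.
rewrite mem_weight_mons => /eqP wm.
by rewrite (norder_stable hE s (@homog_mon K m) _ _ NM) ?wm ?subr0.
Qed.

(** The contraction of a creation and an annihilation mode of index d, in both
    orders; the factor d is the scalar in the Heisenberg relation. *)
Definition propagator_coef (f g : int -> K) (d : nat) : K :=
  d%:R * (f (- d%:Z) * g d%:Z + f d%:Z * g (- d%:Z)).

Definition propagator (f g : int -> K) : qseries K := lambert (propagator_coef f g).

(** Cyclicity of the trace moves the creation mode to the right of the product
    and multiplies by q^(i+1); moving it back to the left adds the commutator.
    [geom_solve] solves the resulting equation. *)
Lemma trace_create_norder M s i : (i < M)%N ->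
  (fun N => weight_trace N (fun u => h (Negz i) (norder M s i.+1%:Z u))) =
  geom K i.+1 * \sum_(x <- removals s) (i.+1%:R * x.1 i.+1%:Z) *: cutoff_trace M x.2.
Proof.
move=> iM; apply: geom_solve => // N; rewrite (trace_create hE); case: ltnP => // _.
rewrite qsumE; under [in RHS]eq_bigr do rewrite qscaleE -traceZ.
rewrite -trace_sum -traceD; apply: trace_eq => u.
exact: (norder_commute_create hP hcomm).
Qed.

Lemma trace_annih_norder M s i : (i < M)%N ->
  (fun N => weight_trace N (fun u => norder M s (- i.+1%:Z) (h i.+1%:Z u))) =
  geom K i.+1 * \sum_(x <- removals s) (i.+1%:R * x.1 (- i.+1%:Z)) *: cutoff_trace M x.2.
Proof.
move=> iM; apply: geom_solve => // N; rewrite (trace_annih hE); last first.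
  by move=> a u; rewrite (norderZ hP).
case: ltnP => // _; rewrite qsumE.
under [in RHS]eq_bigr do rewrite qscaleE -traceZ.
rewrite -trace_sum -traceD; apply: trace_eq => u.
exact: (norder_commute_annih hP hcomm).
Qed.

Lemma cutoff_trace_cons M f s : cutoff_trace M (f :: s) =
  \sum_(x <- removals s)
    (\sum_(i < M) propagator_coef f x.1 i.+1 *: geom K i.+1) * cutoff_trace M x.2.
Proof.
rewrite [LHS](_ : _ = \sum_(i < M) (f (Negz i) *:
   ((fun N => weight_trace N (fun u => h (Negz i) (norder M s i.+1%:Z u))) : qseries K)
   + f i.+1%:Z *:
   ((fun N => weight_trace N (fun u => norder M s (- i.+1%:Z) (h i.+1%:Z u))) : qseries K))); last first.
  apply/funext => N; rewrite qsumE /cutoff_trace /=.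
  rewrite trace_sum; apply: eq_bigr => i _.
  rewrite add0r sub0r qaddE !qscaleE traceD; congr (_ + _); exact: traceZ.
rewrite (eq_bigr (fun i : 'I_M => \sum_(x <- removals s)
    (propagator_coef f x.1 i.+1 *: geom K i.+1) * cutoff_trace M x.2)) => [|i _]; last first.
  rewrite (trace_create_norder _ (ltn_ord i)) (trace_annih_norder _ (ltn_ord i)).
  rewrite !mulr_sumr !scaler_sumr -big_split; apply: eq_bigr => x _ /=.
  rewrite -!qscaleAr !scalerA -scalerDl -scalerAl; congr (_ *: _).
  by rewrite /propagator_coef NegzE; ring.
by rewrite exchange_big; apply: eq_bigr => x _; rewrite mulr_suml.
Qed.

Lemma cutoff_propagator M f g n : (n <= M)%N ->
  (\sum_(i < M) propagator_coef f g i.+1 *: geom K i.+1) n = propagator f g n.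
Proof.
move=> nM; rewrite qsumE /propagator /lambert; case: n nM => [|n] nM /=.
  by rewrite big1 // => i _; rewrite qscaleE geomE // mulr0.
under eq_bigr do rewrite qscaleE geomE //=.
rewrite -(big_mkord predT (fun i => propagator_coef f g i.+1 * (i.+1 %| n.+1)%:R)) /=.
rewrite -(big_add1 _ _ 0 M.+1 predT (fun i => propagator_coef f g i * (i %| n.+1)%:R)).
rewrite (bigID (fun i => i %| n.+1)%N) /= [X in _ + X]big1 ?addr0; last first.
  by move=> i /negPf ->; rewrite mulr0.
rewrite -big_filter (perm_big (divisors n.+1)) /=.
  by apply: eq_big_seq => d; rewrite -dvdn_divisors // => ->; rewrite mulr1.
apply: uniq_perm; rewrite ?divisors_uniq ?filter_uniq ?iota_uniq // => d.
rewrite mem_filter mem_index_iota -dvdn_divisors // ltnS.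
case hd: (d %| n.+1)%N => //=; rewrite (dvdn_gt0 _ hd) //=.
exact: leq_trans (dvdn_leq _ hd) nM.
Qed.

(** Wick's rule. Each mode of the first field is removed by
    [trace_create_norder] or [trace_annih_norder], and the commutator deletes
    one of the other fields. *)
Theorem trace_series_cons f s : trace_series (f :: s) =
  \sum_(x <- removals s) propagator f x.1 * trace_series x.2.
Proof.
apply/funext => N; rewrite -(@cutoff_traceE N) // cutoff_trace_cons !qsumE.
apply: eq_bigr => x _; rewrite !qmulE; apply: eq_bigr => i _.
by rewrite (cutoff_propagator _ _ (leq_ord i)) cutoff_traceE ?leq_subr.
Qed.

Lemma trace_series_front f a b : trace_series (a ++ f :: b) = trace_series (f :: a ++ b).
Proof.
apply/funext => N; rewrite /trace_series; apply: trace_eq => u.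
exact: (norder_front hP hcomm).
Qed.

End TraceRecursion.

(** * Partitions and the Euler product *)

Section Euler.
Variable K : fieldType.
Implicit Types m : {cmonom nat}.

Definition vars_lt (k : nat) m := all (fun i => i < k)%N (finsupp m : seq nat).

Lemma vars_ltP k m : reflect (forall i, (k <= i)%N -> m i = 0%N) (vars_lt k m).
Proof.
apply: (iffP allP) => [h i ki|h i im].
  apply/eqP; rewrite cmE_eq0; apply/negP => /h; by rewrite ltnNge ki.
rewrite ltnNge; apply/negP => /h /eqP; rewrite cmE_eq0 => /negP; exact.
Qed.

(** The generating function of partitions with parts at most k. *)
Definition npart (k : nat) : qseries K := fun n => \sum_(m <- weight_mons n | vars_lt k m) 1.

Lemma npart0 : npart 0 = 1.
Proof.
apply/funext => n; rewrite qoneE /npart.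
have h m : vars_lt 0 m -> m = onecm nat.
  by move=> /vars_ltP h; apply/eqP/cmP => i; rewrite h // onecmE.
case: eqP => [->|/eqP n0].
  rewrite -big_filter (perm_big [:: onecm nat]) ?big_seq1 //.
  apply: uniq_perm => //; first exact/filter_uniq/uniq_weight_mons.
  move=> m; rewrite mem_filter mem_weight_mons inE; apply/andP/eqP => [[/h]|->] //.
  by rewrite weight1; split=> //; apply/vars_ltP => i _; rewrite onecmE.
rewrite big_seq_cond big1 // => m /andP[+ /h e]; rewrite mem_weight_mons e weight1 eq_sym.
by rewrite (negPf n0).
Qed.

(** A monomial either omits the variable of index k or is a multiple of it. *)
Lemma npart_rec k : npart k.+1 = npart k + qpow K k.+1 * npart k.+1.
Proof.
apply/funext => n; rewrite qaddE qpowM /npart (bigID (fun m => m k == 0%N)) /=.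
congr (_ + _).
  apply: eq_bigl => m; apply/andP/vars_ltP => [[/vars_ltP h /eqP mk] i|h].
    by rewrite leq_eqVlt => /orP[/eqP <- //|]; exact: h.
  split; last by rewrite h.
  by apply/vars_ltP => i ki; rewrite h // ltnW.
rewrite -big_filter; case: (leqP k.+1 n) => kn; last first.
  rewrite big1_seq // => m /=; rewrite mem_filter mem_weight_mons.
  move=> /andP[/andP[_ mk] /eqP wm]; have := leq_weight m k.
  by move: mk; rewrite wm; case: (m k) => // j _; rewrite mulSn; lia.
rewrite -[RHS]big_filter; apply: esym.
apply: (@big_seq_bij K {cmonom nat} {cmonom nat} _ _ (fun m => mulcm m (ucm k))
  (fun m => divcm m (ucm k)) (fun _ => 1)).
- exact/filter_uniq/uniq_weight_mons.
- exact/filter_uniq/uniq_weight_mons.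
- move=> m; rewrite !mem_filter !mem_weight_mons => /andP[/vars_ltP h /eqP wm]; rewrite mulcmK.
  rewrite weightM weightU wm subnK // eqxx mulcmU /=; split=> //; rewrite !andbT.
  apply/vars_ltP => i ki; rewrite mulcmE h // ucmE.
  by rewrite (_ : (k == i) = false) //; apply/eqP => e; move: ki; rewrite e ltnn.
- move=> m; rewrite !mem_filter !mem_weight_mons => /andP[/andP[/vars_ltP h mk] /eqP wm].
  rewrite -lt0n in mk; rewrite divcmK //; split=> //.
  apply/andP; split; first by apply/vars_ltP => i ki; rewrite divcmE h.
  by rewrite -wm -{2}(divcmK mk) weightM weightU addnK.
Qed.

Definition eulerp (k : nat) : qseries K :=
  fun n => (\prod_(1 <= m < k.+1) (1 - 'X^m) : {poly K})`_n.

Lemma eulerp0 : eulerp 0 = 1.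
Proof. by apply/funext => n; rewrite /eulerp big_geq // coef1 qoneE. Qed.

Lemma eulerpS k : eulerp k.+1 = eulerp k * (1 - qpow K k.+1).
Proof.
apply/funext => n; rewrite /eulerp big_nat_recr //= coefM qmulE.
apply: eq_bigr => i _; congr (_ * _).
by rewrite coefB coef1 coefXn qaddE qoppE qoneE.
Qed.

Lemma eulerp_npart k : eulerp k * npart k = 1.
Proof.
elim: k => [|k IH]; first by rewrite eulerp0 npart0 mulr1.
rewrite eulerpS -[RHS]IH -mulrA; congr (_ * _).
by rewrite mulrBl mul1r {1}npart_rec addrK.
Qed.

Lemma eulerp_stable k n : (n <= k)%N -> eulerp k n = euler_product K n.
Proof.
move=> nk; have -> : euler_product K n = eulerp n n by [].
move: nk => /subnKC <-; elim: (k - n)%N => [|j IH]; first by rewrite addn0.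
rewrite addnS eulerpS mulrBr mulr1 qaddE qoppE mulrC qpowM.
by rewrite ltnNge leq_addr /= subr0.
Qed.

Variable h : int -> heis K -> heis K.

Lemma trace_series_nil : euler_product K * trace_series h [::] = 1.
Proof.
apply/funext => n; rewrite -(eulerp_npart n) !qmulE; apply: eq_bigr => i _.
rewrite eulerp_stable ?leq_ord //; congr (_ * _).
rewrite /trace_series weight_traceE /npart [RHS]big_mkcond; apply: eq_big_seq => m.
rewrite mem_weight_mons => /eqP wm /=; rewrite /mon mcoeffU1 eqxx ifT //.
apply/vars_ltP => j nj; have := leq_weight m j; rewrite wm.
have := leq_subr i n; case: (m j) => // l; rewrite mulSn; lia.
Qed.

End Euler.

(** * Fields as normally ordered products *)

Section NormalOrder.
Variable K : fieldType.
Local Notation S := (heis K).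
Variable h : int -> S -> S.
Hypothesis hE : forall n u m, (h n u)@_m = mode_coef n u m.
Local Notation norder := (norder h).
Let hP := modeP hE.

(** The coefficients of the field (1/i!) (d/dz)^i h(z), which is the sum of
    [symbol i j] h_j z^(-j-i-1) over all j. *)
Definition symbol (i : nat) (j : int) : K := (-1) ^+ i * binz K (j + i%:Z) i.

(** This is why normal ordering by the index of a derived field agrees with
    normal ordering by the index of the Heisenberg mode. *)
Lemma binz_small (i : nat) (x : nat) : (x < i)%N -> binz K x%:Z i = 0.
Proof.
by move=> xi; rewrite /binz (bigD1 (Ordinal xi)) //= subrr !mul0r.
Qed.

Definition shift (s : seq nat) : nat := \sum_(i <- s) i.+1.

(** The definition of [Ymon] for an arbitrary list of factors, so that
    induction on the list is possible. *)
Definition nfield (s : seq nat) : vfield K :=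
  foldr (fun i F => nop (dfield i h) F) (@vacuum_field K) s.

Lemma dfieldE i n u : dfield i h n u = symbol i (n - i%:Z) *: h (n - i%:Z) u.
Proof. by rewrite /dfield /symbol subrK. Qed.

Lemma mode_index0 u : h 0 u = 0.
Proof. by apply: heisP => m; rewrite hE heis0. Qed.

(** The product [nop] separates the modes of the field by the sign of the
    index j, and [norder] by the sign of j - i. The two separations differ in
    the modes with 0 <= j < i, which vanish by [binz_small], and in h_0 = 0.
    The mode number exceeds the degree d by [shift s - 1] because the field of
    index i has weight i + 1. *)
Lemma nfield_norder s M d w u : homog w u -> w <= M%:Z -> w - d <= M%:Z ->
  nfield s (d + (shift s)%:Z - 1) u = norder M (map symbol s) d u.
Proof.
elim: s M d w u => [|i s IH] M d w u hu wM wdM.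
  rewrite /= /vacuum_field /shift big_nil addr0 -subr_eq0 opprK subrK.
  by [].
set n := _ - 1.
(* The field vanishes at 0; the induction hypothesis applies with a cutoff
    large enough for the degree. *)
have IH0 n' : nfield s n' 0 = 0.
  have hz : homog 0 (0 : S) by exact: homog0.
  have -> : n' = (n' + 1 - (shift s)%:Z) + (shift s)%:Z - 1 by ring.
  by rewrite (IH (absz (n' + 1 - (shift s)%:Z)%R) _ 0) ?(norder0 hP) //; lia.
have nE : n = d + i.+1%:Z + (shift s)%:Z - 1.
  by rewrite /n /shift big_cons PoszD addrA.
have cre (k : nat) : dfield i h (i%:Z - k.+1%:Z) (nfield s (n - (i%:Z - k.+1%:Z) - 1) u)
   = symbol i (Negz k) *: h (Negz k) (norder (M + k)%N (map symbol s) (d + k.+1%:Z) u).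
  rewrite dfieldE (_ : _ - _ - i%:Z = Negz k); last by rewrite NegzE; ring.
  rewrite (_ : n - _ - 1 = d + k.+1%:Z + (shift s)%:Z - 1); last first.
    by rewrite nE; lia.
  by rewrite (IH (M + k)%N _ w) //; lia.
have ann (k : nat) : (k < M)%N ->
  nfield s (n - (i%:Z + k.+1%:Z) - 1) (dfield i h (i%:Z + k.+1%:Z) u)
   = symbol i k.+1%:Z *: norder M (map symbol s) (d - k.+1%:Z) (h k.+1%:Z u).
  move=> kM; rewrite dfieldE (_ : i%:Z + _ - i%:Z = k.+1%:Z); last by ring.
  rewrite (_ : n - _ - 1 = d - k.+1%:Z + (shift s)%:Z - 1); last first.
    by rewrite nE; lia.
  rewrite (IH M _ (w - k.+1%:Z)); try lia; first exact: (norderZ hP).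
  by apply: homogZ; exact: (@homog_mode _ _ hE k.+1%:Z).
rewrite /nfield /= -/(nfield s) /nop.
(* The indices of the modes within the cutoff: creation modes in r1,
    annihilation modes in r2. *)
pose r1 := [seq i%:Z - k.+1%:Z | k <- iota i (M - i)].
pose r2 := [seq i%:Z + k.+1%:Z | k <- iota 0 M].
rewrite (fsbigE r1) /=; first last.
- move=> j j0 jr; have [k kE] : exists k : nat, j = i%:Z - k.+1%:Z.
    by exists (absz (i%:Z - j - 1)%R); lia.
  rewrite kE cre.
  have kM : (M <= k)%N.
    rewrite leqNgt; apply/negP => kM; move/negP: jr; apply; apply/mapP; exists k => //.
    by rewrite mem_iota; lia.
  have -> : norder (M + k) (map symbol s) (d + k.+1%:Z) u = 0.
    by apply: (homog_lt0 (@homog_norder _ _ hE (M + k)%N (map symbol s) (d + k.+1%:Z) _ _ hu)); lia.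
  by rewrite (modes0 hP) scaler0.
- by move=> j /= /mapP[k]; rewrite mem_iota => hk ->; lia.
- by rewrite map_inj_uniq ?iota_uniq // => k l; lia.
rewrite (fsbigE r2) /=; first last.
- move=> j j0 jr; have [ji|ij] := ltP j i%:Z.
    rewrite /dfield; case: j j0 jr ji => // j _ _ ji.
    by rewrite binz_small // mulr0 scale0r IH0.
  case: (eqVneq j i%:Z) => [->|ne].
    by rewrite dfieldE subrr mode_index0 scaler0 IH0.
  have [k kE] : exists k : nat, j = i%:Z + k.+1%:Z.
    by exists (absz (j - i%:Z - 1)%R); lia.
  rewrite dfieldE kE (_ : i%:Z + _ - i%:Z = k.+1%:Z); last by ring.
  have kM : (M <= k)%N.
    rewrite leqNgt; apply/negP => kM; move/negP: jr; apply; apply/mapP; exists k => //.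
    by rewrite mem_iota; lia.
  have -> : h k.+1%:Z u = 0.
    by apply: (homog_lt0 (@homog_mode _ _ hE k.+1%:Z _ _ hu)); lia.
  by rewrite scaler0 IH0.
- by move=> j /= /mapP[k]; rewrite mem_iota => hk ->; lia.
- by rewrite map_inj_uniq ?iota_uniq // => k l; lia.
rewrite big_split /=; congr (_ + _).
  rewrite big_seq_cond (eq_bigl (fun j => j \in r1)) => [|j]; last first.
    apply: andb_idr => /mapP[k]; rewrite mem_iota => hk ->; apply/mem_set => /=; lia.
  rewrite -big_seq big_map.
  rewrite -(big_mkord predT (fun k => symbol i (Negz k) *: h (Negz k)
    (norder M (map symbol s) (d + k.+1%:Z) u))).
  have [Mi|iM] := leqP M i.
    rewrite (_ : M - i = 0)%N ?big_nil; last by apply/eqP; rewrite subn_eq0.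
    rewrite big_nat_cond big1 // => k /andP[/andP[_ kM] _].
    rewrite /symbol (_ : Negz k + i%:Z = (i - k.+1)%N%:Z); last by lia.
    by rewrite binz_small ?mulr0 ?scale0r //; lia.
  rewrite [RHS](@big_cat_nat _ _ _ i) //=; last exact: ltnW.
  rewrite [X in _ = X + _]big_nat_cond [X in _ = X + _]big1 ?add0r; last first.
    move=> k /andP[/andP[_ kM] _].
    rewrite /symbol (_ : Negz k + i%:Z = (i - k.+1)%N%:Z); last by lia.
    by rewrite binz_small ?mulr0 ?scale0r //; lia.
  apply: eq_big_nat => k /andP[ik kM]; rewrite cre.
  by rewrite (norder_stable hE _ hu wM _ (leq_addr k M)) //; lia.
rewrite big_seq_cond (eq_bigl (fun j => j \in r2)) => [|j]; last first.
  apply: andb_idr => /mapP[k]; rewrite mem_iota => hk ->; apply/mem_set => /=; lia.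
rewrite -big_seq big_map.
rewrite -(big_mkord predT (fun k => symbol i k.+1%:Z *:
    norder M (map symbol s) (d - k.+1%:Z) (h k.+1%:Z u))).
rewrite /index_iota subn0; apply: eq_big_seq => k; rewrite mem_iota => /andP[_ kM].
by rewrite ann.
Qed.

End NormalOrder.

(** * Zero modes and characters *)

Section ZeroMode.
Variable K : fieldType.
Local Notation S := (heis K).
Implicit Types (u v : S) (m : {cmonom nat}).

Lemma shift_factors m : shift (factors m) = weight m.
Proof.
rewrite /shift /factors /weight big_flatten big_map; apply: eq_bigr => i _.
by rewrite big_nseq iter_addn_0 mulnC.
Qed.

Lemma Ymon_norder m m' : Ymon m ((weight m)%:Z - 1) (mon K m') =
  norder (@hmode K) (weight m') (map (symbol K) (factors m)) 0 (mon K m').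
Proof.
have := nfield_norder (@hmodeE K) (factors m) (@homog_mon K m') (lexx _).
move=> /(_ 0); rewrite subr0 add0r shift_factors; apply; exact: lexx.
Qed.

Lemma big_msupp (V : lmodType K) v (d : {fset {cmonom nat}}) (F : {cmonom nat} -> V) :
  (msupp v `<=` d)%fset ->
  \sum_(m <- msupp v) v@_m *: F m = \sum_(m <- d) v@_m *: F m.
Proof.
by move=> h; rewrite (big_fset_incl _ h) //= => m _ /mcoeff_outdom ->; rewrite scale0r.
Qed.

Lemma mcoeff_component k v m :
  (weight_component k v)@_m = if weight m == k then v@_m else 0.
Proof.
rewrite /weight_component heis_sum.
have h m' : (v@_m' *: mon K m')@_m = if m' == m then v@_m else 0.
  by rewrite heisZ /mon mcoeffU1; case: eqP => [->|]; rewrite ?mulr1 ?mulr0.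
under eq_bigr do rewrite h.
rewrite big_mkcond /=.
rewrite (eq_bigr (fun i => if i == m then (if weight m == k then v@_m else 0) else 0)); last first.
  by move=> i _; have [->//|_] := eqVneq i m; rewrite if_same.
have [mv|mv] := boolP (m \in msupp v); last first.
  rewrite (mcoeff_outdom mv) if_same big1_seq // => i /= iv.
  by case: eqP => // e; move: mv; rewrite -e iv.
rewrite (big_rem _ mv) /= eqxx big1_seq ?addr0 // => i /=.
by rewrite mem_rem_uniq ?fset_uniq // inE => /andP[/negPf ->].
Qed.

Lemma vertex_op_component k v n u : vertex_op (weight_component k v) n u =
  \sum_(m <- msupp v) (if weight m == k then v@_m *: Ymon m n u else 0).
Proof.
rewrite /vertex_op (@big_msupp _ _ (msupp v)); last first.
  apply/fsubsetP => m; rewrite -!mcoeff_neq0 mcoeff_component.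
  by case: ifP => //; rewrite eqxx.
by apply: eq_bigr => m _; rewrite mcoeff_component; case: ifP; rewrite ?scale0r.
Qed.

(** The component of weight k contributes exactly the monomials of weight k,
    in the mode k - 1. *)
Lemma zero_modeE v u : zero_mode v u =
  \sum_(m <- msupp v) v@_m *: Ymon m ((weight m)%:Z - 1) u.
Proof.
rewrite /zero_mode.
pose r := undup (map weight (msupp v)).
rewrite (fsbigE r) ?undup_uniq //=; last first.
  move=> k _ kr; rewrite vertex_op_component big1_seq // => m /= mv.
  case: eqP => // wm; move: kr; rewrite mem_undup -wm map_f //.
rewrite (eq_bigl xpredT) => [|k]; last exact/mem_set.
under eq_bigr do rewrite vertex_op_component.
rewrite exchange_big /=; apply: eq_big_seq => m mv.
have mr : weight m \in r by rewrite mem_undup map_f.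
rewrite (big_rem _ mr) /= eqxx big1_seq ?addr0 // => k /=.
rewrite mem_rem_uniq ?undup_uniq // inE => /andP[/negPf kw _].
by rewrite eq_sym kw.
Qed.

Definition char_mon m : qseries K :=
  euler_product K * trace_series (@hmode K) (map (symbol K) (factors m)).

Definition eta_char v : qseries K := \sum_(m <- msupp v) v@_m *: char_mon m.

Lemma eta_charE v : qshift_mul (dedekind_eta K) (character v) = (0, eta_char v).
Proof.
rewrite /qshift_mul /= subrr; congr (_, _).
rewrite /eta_char; under eq_bigr do rewrite /char_mon qscaleAr.
rewrite -mulr_sumr; congr (_ * _); apply/funext => n.
rewrite qsumE weight_traceE.
under eq_bigr do rewrite zero_modeE heis_sum.
rewrite exchange_big /=; apply: eq_bigr => m _.
rewrite qscaleE /trace_series weight_traceE mulr_sumr; apply: eq_big_seq => m'.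
by rewrite mem_weight_mons => /eqP wm; rewrite heisZ Ymon_norder wm.
Qed.

Lemma eta_charP a u v : eta_char (a *: u + v) = a *: eta_char u + eta_char v.
Proof.
pose d := (msupp (a *: u + v) `|` (msupp u `|` msupp v))%fset.
rewrite /eta_char !(@big_msupp _ _ d).
- rewrite scaler_sumr -big_split; apply: eq_bigr => m _ /=.
  by rewrite heisD heisZ scalerDl scalerA.
- by rewrite /d fsetUA fsubsetUr.
- by rewrite /d fsetUC -fsetUA fsubsetUl.
- exact: fsubsetUl.
Qed.

Lemma eta_char_mon m : eta_char (mon K m) = char_mon m.
Proof. by rewrite /eta_char /mon msuppU1 big_seq_fset1 mcoeffUU scale1r. Qed.

End ZeroMode.

(** * Normalized correlators *)

Lemma removals_map (T U : Type) (g : T -> U) (s : seq T) :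
  removals (map g s) = [seq (g x.1, map g x.2) | x <- removals s].
Proof.
elim: s => //= x s ->; congr (_ :: _).
by rewrite -!map_comp.
Qed.

Lemma size_removals (T : eqType) (s : seq T) x : x \in removals s -> (size x.2).+1 = size s.
Proof.
elim: s x => //= y s IH x; rewrite inE => /orP[/eqP -> //|/mapP[z zs ->]] /=.
by rewrite (IH z).
Qed.

Section Correlators.
Variable K : fieldType.
Hypothesis char0 : forall n, n.+1%:R != 0 :> K.
Local Notation h := (@hmode K).
Let hE := @hmodeE K.

(** The trace normalized by the trace of the identity. By [corr_cons] it is
    the sum over all perfect matchings of the products of the propagators. *)
Definition corr (s : seq (int -> K)) : qseries K := euler_product K * trace_series h s.

Lemma corr_nil : corr [::] = 1. Proof. exact: trace_series_nil. Qed.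

Lemma corr_cons f s : corr (f :: s) = \sum_(x <- removals s) propagator f x.1 * corr x.2.
Proof.
rewrite /corr (trace_series_cons hE) mulr_sumr; apply: eq_bigr => x _.
by rewrite mulrCA.
Qed.

(** Normally ordered products are symmetric in their factors. *)
Lemma corr_front f a b : corr (a ++ f :: b) = corr (f :: a ++ b).
Proof. by rewrite /corr (trace_series_front hE). Qed.

Lemma corr_perm (T : eqType) (g : T -> int -> K) (s t : seq T) a :
  perm_eq s t -> corr (a ++ map g s) = corr (a ++ map g t).
Proof.
elim: s t a => [|x s IH] t a pst.
  by move: pst; rewrite perm_sym => /perm_nilP ->.
have xt : x \in t by rewrite -(perm_mem pst) mem_head.
have [t1 [t2 et]] : exists t1 t2, t = t1 ++ x :: t2.
  by case/splitPr: xt => t1 t2; exists t1, t2.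
move: pst; rewrite et -[x :: t2]cat1s perm_sym perm_catCA /= perm_cons => pst.
rewrite /= -(cat1s (g x)) catA (IH (t1 ++ t2)) 1?perm_sym // -catA cat1s !map_cat /=.
by rewrite corr_front [in RHS]catA corr_front -catA.
Qed.

Lemma char_monE m : char_mon K m = corr (map (symbol K) (factors m)).
Proof. by []. Qed.

Lemma binz_int (x : int) k : exists z : int, binz K x k = z%:~R.
Proof.
have fk : (k`!)%:R != 0 :> K by apply: natr_neq0 => //; exact: fact_gt0.
have key (z : int) : \prod_(i < k) (x - i%:Z) = z * (k`!)%:Z -> exists z : int, binz K x k = z%:~R.
  move=> e; exists z; rewrite /binz.
  have -> : \prod_(i < k) (x - i%:Z)%:~R = (\prod_(i < k) (x - i%:Z))%:~R :> K.
    by rewrite rmorph_prod.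
  by rewrite e intrM mulfK.
case: x key => n key.
- apply: (key 'C(n, k)%:Z); rewrite -PoszM bin_ffact.
  elim: k {fk key} => [|k IH]; first by rewrite big_ord0 ffactn0.
  rewrite big_ord_recr /= IH ffactnSr PoszM.
  have [kn|nk] := leqP k n; first by rewrite -subzn.
  by rewrite ffact_small // !mul0r.
- apply: (key ((-1) ^+ k * 'C(n + k, k)%:Z)); rewrite -mulrA -PoszM bin_ffact.
  elim: k {fk key} => [|k IH]; first by rewrite big_ord0 ffactn0.
  rewrite big_ord_recr /= IH addnS ffactSS PoszM exprS NegzE.
  by rewrite (_ : _ - k%:Z = - (n + k).+1%:Z); [ring|lia].
Qed.

Lemma symbol_int i j : exists z : int, symbol K i j = z%:~R.
Proof.
rewrite /symbol; have [z ->] := binz_int (j + i%:Z) i.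
by exists ((-1) ^+ i * z); rewrite intrM rmorphXn /= intrN.
Qed.

Definition symbol_poly (i : nat) : {poly K} :=
  ((-1) ^+ i / i`!%:R) *: \prod_(k < i) ('X + (i%:Z - k%:Z)%:~R%:P).

Lemma symbol_polyE i j : symbol K i j = (symbol_poly i).[j%:~R].
Proof.
rewrite /symbol /binz /symbol_poly hornerZ horner_prod mulrA mulrAC; congr (_ * _).
apply: eq_bigr => k _; rewrite hornerD hornerX hornerC -intrD; congr (_%:~R).
by rewrite addrA.
Qed.

(** Contracting in both orders adds the polynomial P(-d) Q(d) and its
    reflection, which doubles the even powers of d and cancels the odd ones.
    The factor d then makes all exponents odd. *)
Lemma propagator_poly (P Q : {poly K}) :
  propagator (fun j => P.[j%:~R]) (fun j => Q.[j%:~R]) =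
  \sum_(e < size ((P \Po (- 'X)) * Q))
    (if odd e then 0 else 2 * ((P \Po (- 'X)) * Q)`_e) *: sigma_series K e.+1.
Proof.
set R := _ * Q.
under eq_bigr do rewrite -lambertZ.
rewrite -lambert_sum; apply: eq_lambert => d _.
have RE x : R.[x] = P.[- x] * Q.[x].
  by rewrite hornerM horner_comp hornerN hornerX.
rewrite /propagator_coef -[X in _ * (_ + X)](mulrC) !rmorphN /=.
have -> : P.[- d%:~R] * Q.[d%:~R] + Q.[- d%:~R] * P.[d%:~R] = R.[d%:~R] + R.[- d%:~R].
  by rewrite !RE opprK [Q.[_] * _]mulrC.
rewrite !horner_coef -big_split mulr_sumr; apply: eq_bigr => e _ /=.
rewrite -pmulrn exprNn -signr_odd exprS.
by case: odd; rewrite ?expr1 ?expr0; ring.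
Qed.

End Correlators.

Section CorrelatorsPadic.
Variables (K : uNormFieldType) (p : nat).
Hypothesis hp : prime p.
Hypothesis char0 : forall n, n.+1%:R != 0 :> K.
Hypothesis normp : unorm (p%:R : K) = p%:R^-1.
Local Notation pmf := (padic_modular_forms K).

(** By Wick's rule a correlator is built from propagators by sums and
    products. *)
Lemma corr_ind (P : qseries K -> Prop) :
  P 0 -> P 1 -> (forall f g, P f -> P g -> P (f + g)) ->
  (forall f g, P f -> P g -> P (f * g)) ->
  (forall i j, P (propagator (symbol K i) (symbol K j))) ->
  forall s, P (corr (map (symbol K) s)).
Proof.
move=> P0 P1 PD PM PG s; have [n] := ubnP (size s); elim: n s => // n IH [|i s] /=.
  by rewrite corr_nil.
rewrite ltnS => sn; rewrite corr_cons removals_map big_map big_seq.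
elim/big_ind: _ => [//|f g|x xs /=]; first exact: PD.
apply: PM; first exact: PG.
by apply: IH; rewrite -(size_removals xs) in sn; exact: ltnW.
Qed.

(** The symbols are integers, hence so are the coefficients of all
    propagators. *)
Lemma char_mon_bounded m : qbounded (char_mon K m) 1.
Proof.
rewrite char_monE; apply: (@corr_ind (fun f => qbounded f 1)) => [|n|f g hf hg|f g hf hg|i j].
- by move=> n; rewrite unorm0.
- by rewrite qoneE unorm_nat_le1.
- exact: qboundedD.
- by rewrite -[1]mulr1; exact: qbounded_mul.
- apply: lambert_bound => // d; rewrite /propagator_coef unormM.
  have le1 k l : unorm (symbol K k l) <= 1.
    by have [z ->] := symbol_int char0 k l; exact: unorm_int_le1.
  rewrite mulr_ile1 ?unorm_ge0 ?unorm_nat_le1 // (le_trans (unormD _ _)) //.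
  rewrite ge_max (unormM (symbol K i (- d%:Z))) (unormM (symbol K i d%:Z)).
  by rewrite !mulr_ile1 ?unorm_ge0 ?le1.
Qed.

Lemma char_mon_pmf m : pmf (char_mon K m).
Proof.
rewrite char_monE; apply: (@corr_ind pmf) => [||f g|f g|i j].
- exact: pmf0.
- exact: pmf1.
- exact: pmf_add.
- exact: pmf_mul.
- have -> : symbol K i = (fun l => (symbol_poly K i).[l%:~R]).
    by apply/funext => l; exact: symbol_polyE.
  have -> : symbol K j = (fun l => (symbol_poly K j).[l%:~R]).
    by apply/funext => l; exact: symbol_polyE.
  rewrite propagator_poly; apply: pmf_sum => e _.
  case: ifP => oe; first by rewrite scale0r; exact: pmf0.
  apply: pmf_scale; rewrite -(odd_double_half e) oe add0n.
  exact: (pmf_sigma_odd hp).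
Qed.

Lemma eta_char_bounded (v : heis K) : qbounded (eta_char v) (unorm v).
Proof.
move=> n; rewrite /eta_char qsumE; apply: unorm_sum; first exact: unorm_ge0.
move=> m mv; rewrite qscaleE unormM (le_trans (y := unorm v@_m * 1)) //.
  by rewrite ler_wpM2l ?unorm_ge0 // char_mon_bounded.
rewrite mulr1 -[unorm v]/(heis_norm v) /heis_norm.
elim: (msupp v : seq _) (mv : m \in (msupp v : seq _)) => //= k r IH.
rewrite inE big_cons le_max => /orP[/eqP <-|/IH ->]; rewrite ?orbT //.
by rewrite lexx.
Qed.

Lemma eta_char_pmf (v : heis K) : pmf (eta_char v).
Proof. by apply: pmf_sum => m _; apply: pmf_scale; exact: char_mon_pmf. Qed.

End CorrelatorsPadic.

(** * Extension by continuity *)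

Section Extension.
Variables (K : uNormFieldType) (V : uNormLmodType K) (F : V -> qseries K).
Hypothesis complete : forall x : nat -> K, cauchy_seq x -> exists l, null_seq (fun n => x n - l).
Hypothesis FP : forall a u v, F (a *: u + v) = a *: F u + F v.
Hypothesis Fbound : forall v, qbounded (F v) (unorm v).

Lemma null_seqD (W : uNormZmodType) (x y : nat -> W) :
  null_seq x -> null_seq y -> null_seq (fun n => x n + y n).
Proof.
move=> hx hy e e0; have [N hN] := hx e e0; have [M hM] := hy e e0.
exists (maxn N M) => n; rewrite geq_max => /andP[a b].
by apply: unormD_lt; [exact: hN|exact: hM].
Qed.

Lemma null_seqB (W : uNormZmodType) (x y : nat -> W) :
  null_seq x -> null_seq y -> null_seq (fun n => x n - y n).
Proof.
move=> hx hy e e0; have [N hN] := hx e e0; have [M hM] := hy e e0.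
exists (maxn N M) => n; rewrite geq_max => /andP[a b].
by apply: unormB_lt; [exact: hN|exact: hM].
Qed.

Lemma null_seqZ a (x : nat -> K) : null_seq x -> null_seq (fun n => a * x n).
Proof.
move=> hx e e0; have [->|a0] := eqVneq a 0.
  by exists 0%N => n _; rewrite mul0r unorm0.
have na : 0 < unorm a by rewrite unorm_gt0.
have [N hN] := hx _ (divr_gt0 e0 na); exists N => n nN.
by rewrite unormM mulrC -ltr_pdivlMr // hN.
Qed.

Lemma null_const (W : uNormZmodType) (l : W) : null_seq (fun=> l) -> l = 0.
Proof.
move=> h; apply/eqP; rewrite -unorm_eq0 eq_le unorm_ge0 andbT leNgt.
by apply/negP => /h[N /(_ N (leqnn N))]; rewrite ltxx.
Qed.

Lemma bounded_linB u v : F (u - v) = F u - F v.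
Proof. by rewrite addrC -scaleN1r FP scaleN1r addrC. Qed.

Lemma bounded_lin_cauchy (u : cauchy V) n : cauchy_seq (fun k => F (u k) n).
Proof.
move=> e e0; have [N hN] := cauchyP u e0; exists N => i j hi hj.
rewrite -[X in unorm X]/((F (u i) - F (u j)) n) -bounded_linB.
exact: le_lt_trans (Fbound _ _) (hN _ _ hi hj).
Qed.

Definition cont_ext (x : completion V) : qseries K :=
  fun n => projT1 (cid (complete (bounded_lin_cauchy (crepr x) n))).

Lemma cont_extP (u : cauchy V) n : null_seq (fun k => F (u k) n - cont_ext (cpi u) n).
Proof.
have h : null_seq (fun k => F (crepr (cpi u) k) n - cont_ext (cpi u) n).
  by rewrite /cont_ext; case: cid.
have d : null_seq (fun k => F ((u - crepr (cpi u) : cauchy V) k) n).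
  have : null_seq (u - crepr (cpi u)) by apply/cpi_eq0; rewrite cpiB creprK subrr.
  move=> hd e e0; have [N hN] := hd e e0; exists N => k kN.
  exact: le_lt_trans (Fbound _ _) (hN _ kN).
have := null_seqD d h; congr null_seq; apply/funext => k.
rewrite [F _ n](_ : _ = F (u k) n - F (crepr (cpi u) k) n); last first.
  by rewrite -[RHS]/((F (u k) - F (crepr (cpi u) k)) n) -bounded_linB.
by rewrite addrA subrK.
Qed.

Lemma cont_ext_unique (u : cauchy V) n l :
  null_seq (fun k => F (u k) n - l) -> cont_ext (cpi u) n = l.
Proof.
move=> h; apply/eqP; rewrite -subr_eq0; apply/eqP/null_const.
have := null_seqB h (cont_extP u n); congr null_seq; apply/funext => k.
by rewrite opprB addrC addrA subrK.
Qed.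

Lemma cont_ext_linear : linear cont_ext.
Proof.
move=> a x y; rewrite -(creprK x) -(creprK y).
set u := crepr x; set v := crepr y; rewrite [a *: _]completion_scaleE -cpiD.
apply/funext => n; apply: cont_ext_unique; rewrite qaddE qscaleE.
have := null_seqD (null_seqZ a (cont_extP u n)) (cont_extP v n); congr null_seq.
apply/funext => k.
have -> : F ((cauchy_scale a u + v : cauchy V) k) n = a * F (u k) n + F (v k) n.
  by rewrite -[RHS]/((a *: F (u k) + F (v k)) n) -FP.
ring.
Qed.

Lemma cont_ext_to_completion v : cont_ext (to_completion v) = F v.
Proof.
apply/funext => n; apply: cont_ext_unique => e e0; exists 0%N => k _ /=.
by rewrite subrr unorm0.
Qed.

(** If the value exceeded the norm of x, then F would exceed the norm far
    along a Cauchy sequence for x, because ultrametric norms stabilize. *)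
Lemma cont_ext_bounded x : qbounded (cont_ext x) (unorm x).
Proof.
move=> n; rewrite -(creprK x); set u := crepr x.
rewrite leNgt; apply/negP => lt.
have e0 : 0 < unorm (cont_ext (cpi u) n) - unorm (cpi u) by rewrite subr_gt0.
have c0 : 0 < unorm (cont_ext (cpi u) n) by apply: le_lt_trans lt; exact: unorm_ge0.
have [N hN] := cont_extP u n c0; have [M hM] := completion_normP u e0.
have a := hN _ (leq_maxl N M); have b := hM _ (leq_maxr N M).
rewrite unorm_distC in a.
have eqn := unorm_isosceles a.
have := Fbound (u (maxn N M)) n; rewrite eqn leNgt => /negP; apply.
by move: b => /ltr_distlDr; rewrite [unorm (cpi u) + _]addrC subrK.
Qed.

Lemma cont_extB x y : cont_ext (x - y) = cont_ext x - cont_ext y.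
Proof.
have := cont_ext_linear (-1) y x; rewrite !scaleN1r => e.
by rewrite addrC e addrC.
Qed.

Lemma cont_ext_continuous : sup_continuous cont_ext.
Proof.
move=> x e e0; exists e => // y yx n.
rewrite -[X in unorm X]/((cont_ext y - cont_ext x) n) -cont_extB.
exact: le_trans (cont_ext_bounded _ _) (ltW yx).
Qed.

Lemma cont_ext_pmf : (forall v, padic_modular_forms K (F v)) ->
  forall x, padic_modular_forms K (cont_ext x).
Proof.
move=> h x; apply: pmf_closed => e e0; have [v xv] := to_completion_dense x e0.
exists (F v) => // n; rewrite -cont_ext_to_completion.
rewrite -[X in unorm X]/((cont_ext x - cont_ext (to_completion v)) n) -cont_extB.
exact: le_trans (cont_ext_bounded _ _) (ltW xv).
Qed.

End Extension.

(** * Quasi-modular forms as characters *)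

Section Span.
Variable K : fieldType.

Inductive lspan (G : set (qseries K)) : set (qseries K) :=
| lspan0 : lspan G 0
| lspan_step a g f : G g -> lspan G f -> lspan G (a *: g + f).

Lemma lspan_gen G g : G g -> lspan G g.
Proof.
by move=> hg; rewrite -[g]scale1r -[_ *: _]addr0; apply: lspan_step => //; exact: lspan0.
Qed.

Lemma lspanD G f g : lspan G f -> lspan G g -> lspan G (f + g).
Proof.
by elim=> [|a h {}f hh _ IH] hg; rewrite ?add0r // -addrA; apply: lspan_step => //; exact: IH.
Qed.

Lemma lspanZ G a f : lspan G f -> lspan G (a *: f).
Proof.
elim=> [|b h {}f hh _ IH]; first by rewrite scaler0; exact: lspan0.
by rewrite scalerDr scalerA; apply: lspan_step.
Qed.

Lemma lspan_mull G G' x f :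
  (forall g, G g -> lspan G' (x * g)) -> lspan G f -> lspan G' (x * f).
Proof.
move=> h; elim=> [|a g {}f hg _ IH]; first by rewrite mulr0; exact: lspan0.
by rewrite mulrDr -qscaleAr; apply: lspanD => //; apply: lspanZ; exact: h.
Qed.

Lemma lspan_sub G G' f : (forall g, G g -> lspan G' g) -> lspan G f -> lspan G' f.
Proof. by move=> h hf; rewrite -[f]mul1r; apply: lspan_mull hf => g; rewrite mul1r; exact: h. Qed.

End Span.

Lemma removals_cat (T : Type) (a b : seq T) : removals (a ++ b) =
  [seq (x.1, x.2 ++ b) | x <- removals a] ++ [seq (x.1, a ++ x.2) | x <- removals b].
Proof.
elim: a => [|x a IH] /=; first by rewrite -[LHS]map_id; apply: eq_map => -[].
by rewrite IH map_cat -!map_comp.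
Qed.

Lemma removals_nseq (T : Type) n (x : T) : removals (nseq n x) = nseq n (x, nseq n.-1 x).
Proof.
elim: n => //= n ->; congr (_ :: _); case: n => //= n; congr (_ :: _).
by rewrite map_nseq.
Qed.

Section Surjectivity.
Variable K : fieldType.
Hypothesis char0 : forall n, n.+1%:R != 0 :> K.
Local Notation sigma_series := (@sigma_series K).
Local Notation Im := (range (@eta_char K)).

Lemma Im0 : Im 0.
Proof. by exists 0 => //; rewrite /eta_char msupp0 big_seq_fset0. Qed.

Lemma ImP a f g : Im f -> Im g -> Im (a *: f + g).
Proof. by move=> [u _ <-] [v _ <-]; exists (a *: u + v) => //; rewrite eta_charP. Qed.

Lemma count_factors (m : {cmonom nat}) i : count_mem i (factors m) = m i.
Proof.
rewrite /factors count_flatten -map_comp sumnE big_map /=.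
under eq_bigr do rewrite count_nseq /=.
have [im|] := boolP (i \in finsupp m).
  rewrite (big_rem _ im) /= eqxx mul1n big1_seq ?addn0 // => j /=.
  by rewrite mem_rem_uniq ?fset_uniq // inE => /andP[/negPf -> _].
rewrite -cmE_eq0 => /eqP mi; rewrite mi big1 // => j _.
by case: eqP => [->|//]; rewrite mi muln0.
Qed.

(** The monomial with these factors has the given correlator, since [factors]
    recovers them up to order. *)
Lemma corr_symbol_Im t : Im (corr (map (symbol K) t)).
Proof.
pose M := foldr (fun i m => mulcm m (ucm i)) (onecm nat) t.
exists (mon K M) => //; rewrite eta_char_mon char_monE.
apply: (@corr_perm K _ (symbol K) _ _ [::]).
apply/allP => i _ /=; rewrite count_factors; apply/eqP.
rewrite {}/M; elim: t => [|j t IH] /=; first by rewrite onecmE.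
by rewrite mulcmE IH ucmE addnC.
Qed.

(** The square bracket modes, that is, the modes after the change of
    coordinate z -> exp(z) - 1: their propagators are multiples of a single
    [sigma_series]. *)
Definition powfun (n : nat) : int -> K := fun j => j%:~R ^+ n.

Lemma propagatorP a (f g k : int -> K) :
  propagator (fun j => a * f j + g j) k = a *: propagator f k + propagator g k.
Proof.
rewrite -lambertZ -lambertD; congr lambert; apply/funext => d.
rewrite /propagator_coef; ring.
Qed.

Lemma corr_linear (a : K) (f g : int -> K) s :
  corr ((fun j => a * f j + g j) :: s) = a *: corr (f :: s) + corr (g :: s).
Proof.
rewrite !corr_cons scaler_sumr -big_split; apply: eq_bigr => x _ /=.
by rewrite propagatorP mulrDl scalerAl.
Qed.

Lemma powfun_symbol : (powfun 0 = symbol K 0) *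
  (powfun 1 = (fun j => -1 * symbol K 1 j + (fun j => -2 * symbol K 0 j + symbol K 0 j) j)) *
  (powfun 2 = (fun j => 2 * symbol K 2 j + (fun j => 3 * symbol K 1 j + symbol K 0 j) j)).
Proof.
have s0 j : symbol K 0 j = 1 by rewrite /symbol /binz big_ord0 fact0 divr1 mulr1.
have s1 j : symbol K 1 j = - (j%:~R + 1).
  by rewrite /symbol /binz big_ord1 divr1 subr0 expr1 mulN1r intrD.
have s2 j : symbol K 2 j = (j%:~R + 2) * (j%:~R + 1) / 2.
  rewrite /symbol /binz big_ord_recr big_ord1 /= subr0 sqrrN expr1n mul1r.
  by rewrite rmorphB !rmorphD /=; congr (_ * _ / _); ring.
have h2 : 2 != 0 :> K by exact: (char0 1).
split; first split.
- by apply/funext => j; rewrite /powfun s0.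
- by apply/funext => j; rewrite /powfun s0 s1; ring.
- by apply/funext => j; rewrite /powfun s0 s1 s2; field.
Qed.

(** A correlator is linear in its first field and symmetric. So the powers can
    be expanded into symbols one after the other, each being moved behind the
    powers that are left. *)
Lemma corr_powfun_Im ks t : all (fun k => k < 3)%N ks ->
  Im (corr (map powfun ks ++ map (symbol K) t)).
Proof.
elim: ks t => [|k ks IH] t /=; first by move=> _; exact: corr_symbol_Im.
move=> /andP[k3 hk].
have base i : Im (corr (symbol K i :: map powfun ks ++ map (symbol K) t)).
  by rewrite -corr_front; exact: (IH (i :: t)).
case: k k3 => [|[|[|//]]] _.
- by rewrite powfun_symbol; exact: base.
- rewrite powfun_symbol !corr_linear; apply: ImP; first exact: base.
  by apply: ImP; exact: base.
- rewrite powfun_symbol !corr_linear; apply: ImP; first exact: base.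
  by apply: ImP; exact: base.
Qed.

Lemma propagator_powfun m n :
  propagator (powfun m) (powfun n) = ((-1) ^+ m + (-1) ^+ n) *: sigma_series (m + n).+1.
Proof.
rewrite -lambertZ; congr lambert; apply/funext => d.
rewrite /propagator_coef /powfun !rmorphN /= -pmulrn (exprNn d%:R m) (exprNn d%:R n) exprS exprD.
by move: ((-1) ^+ m) ((-1) ^+ n) (d%:R ^+ m) (d%:R ^+ n) => x y z t; ring.
Qed.

Lemma corr_block (f g1 g2 g3 : int -> K) c a b :
  corr (f :: nseq c g1 ++ nseq a g2 ++ nseq b g3) =
  c%:R *: (propagator f g1 * corr (nseq c.-1 g1 ++ nseq a g2 ++ nseq b g3)) +
  (a%:R *: (propagator f g2 * corr (nseq c g1 ++ nseq a.-1 g2 ++ nseq b g3)) +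
   b%:R *: (propagator f g3 * corr (nseq c g1 ++ nseq a g2 ++ nseq b.-1 g3))).
Proof.
rewrite corr_cons !removals_cat !removals_nseq map_cat -!map_comp !big_cat /=.
rewrite !map_nseq !big_nseq /= !iter_addr !addr0 -!scaler_nat //.
Qed.

(** The propagators of the powers of exponent 0, 1 and 2 with themselves are
    multiples of [sigma_series] 1, 3 and 5. The exponents 0 and 2 have the
    mixed propagator 2 [sigma_series 3], and by parity the exponent 1 has none
    with the other two. *)
Definition corr3 c a b := corr (nseq c (powfun 2) ++ nseq a (powfun 0) ++ nseq b (powfun 1)).

Lemma corr3_Im c a b : Im (corr3 c a b).
Proof.
have := @corr_powfun_Im (nseq c 2 ++ nseq a 0 ++ nseq b 1)%N [::].
rewrite cats0 !map_cat !map_nseq; apply.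
by rewrite !all_cat !all_nseq /= !orbT.
Qed.

Lemma corr3S c a b : corr3 c.+1 a b =
  c%:R *: ((2 *: sigma_series 5) * corr3 c.-1 a b) +
  a%:R *: ((2 *: sigma_series 3) * corr3 c a.-1 b).
Proof.
rewrite /corr3 /= corr_block !propagator_powfun sqrrN expr1n expr0 expr1.
by rewrite subrr scale0r mul0r scaler0 addr0 -[1 + 1]/2.
Qed.

Lemma corr3_0S a b : corr3 0 a.+1 b = a%:R *: ((2 *: sigma_series 1) * corr3 0 a.-1 b).
Proof.
rewrite /corr3 /= (@corr_block _ (powfun 2) _ _ 0) !propagator_powfun expr0 expr1.
by rewrite scale0r add0r subrr scale0r mul0r scaler0 addr0 -[1 + 1]/2.
Qed.

Lemma corr3_00S b : corr3 0 0 b.+1 = b%:R *: ((- 2 *: sigma_series 3) * corr3 0 0 b.-1).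
Proof.
rewrite /corr3 /= (@corr_block _ (powfun 2) (powfun 0) _ 0 0) !propagator_powfun expr1.
by rewrite !scale0r !add0r -opprD.
Qed.

Definition qmon i j k : qseries K :=
  sigma_series 1 ^+ i * sigma_series 3 ^+ j * sigma_series 5 ^+ k.

(** The monomials of lower degree in [sigma_series 5], modulo which
    correlators are computed. *)
Definition qmon_lt k : set (qseries K) :=
  lspan [set g | exists i j k', (k' < k)%N /\ g = qmon i j k'].

Lemma qmon_lt_sub k k' f : (k <= k')%N -> qmon_lt k f -> qmon_lt k' f.
Proof.
move=> kk; apply: lspan_sub => _ [i [j [l [lk ->]]]]; apply: lspan_gen.
by exists i, j, l; rewrite (leq_trans lk).
Qed.

Lemma qmon_lt1 k f : qmon_lt k f -> qmon_lt k (sigma_series 1 * f).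
Proof.
apply: lspan_mull => _ [i [j [l [lk ->]]]]; apply: lspan_gen.
by exists i.+1, j, l; split=> //; rewrite /qmon exprS !mulrA.
Qed.

Lemma qmon_lt3 k f : qmon_lt k f -> qmon_lt k (sigma_series 3 * f).
Proof.
apply: lspan_mull => _ [i [j [l [lk ->]]]]; apply: lspan_gen.
by exists i, j.+1, l; split=> //; rewrite /qmon exprS; ring.
Qed.

Lemma qmon_lt5 k f : qmon_lt k f -> qmon_lt k.+1 (sigma_series 5 * f).
Proof.
apply: lspan_mull => _ [i [j [l [lk ->]]]]; apply: lspan_gen.
by exists i, j, l.+1; split=> //; rewrite /qmon exprS; ring.
Qed.

Lemma qmon_lt_const k : (0 < k)%N -> qmon_lt k 1.
Proof. by move=> k0; apply: lspan_gen; exists 0%N, 0%N, 0%N; rewrite /qmon !mulr1. Qed.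

(** A contraction of two fields of exponent 2 contributes one factor
    [sigma_series 5] and uses up two of the c fields; every other contraction
    contributes none. *)
Lemma corr3_lt c a b : qmon_lt c./2.+1 (corr3 c a b).
Proof.
elim/ltn_ind: c a b => -[_ a|[|c] IH a b].
- elim/ltn_ind: a => -[_ b|[|a] IH b].
  + elim/ltn_ind: b => -[_|[|b] IH].
    * by rewrite /corr3 corr_nil; exact: qmon_lt_const.
    * by rewrite corr3_00S scale0r; exact: lspan0.
    * rewrite corr3_00S -scalerAl; apply/lspanZ/lspanZ/qmon_lt3; exact: IH.
  + by rewrite corr3_0S scale0r; exact: lspan0.
  + rewrite corr3_0S -scalerAl; apply/lspanZ/lspanZ/qmon_lt1; exact: IH.
- rewrite corr3S scale0r add0r -scalerAl; apply/lspanZ/lspanZ/qmon_lt3; exact: (IH 0%N).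
- rewrite corr3S -!scalerAl; apply: lspanD; apply/lspanZ/lspanZ.
    by apply: qmon_lt5; exact: (IH c).
  apply/qmon_lt3/(@qmon_lt_sub c.+1./2.+1); last exact: IH.
  by rewrite ltnS /= uphalf_half; case: odd => //=.
Qed.

(** Contracting the fields of exponent 2 among themselves gives the monomial;
    contracting one of them with a field of exponent 0 leaves an odd number of
    them, which loses a power of [sigma_series 5] by [corr3_lt]. *)
Lemma corr3_lead i j k : exists2 x : K, x != 0 &
  qmon_lt k (corr3 k.*2 i.*2 j.*2 - x *: qmon i j k).
Proof.
have n2 : 2 != 0 :> K by exact: (char0 1).
elim: k => [|k [x x0 hx]].
  suff [x x0 ->] : exists2 x, x != 0 & corr3 0 i.*2 j.*2 = x *: qmon i j 0.
    by exists x; rewrite // subrr; exact: lspan0.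
  elim: i => [|i [x x0 e]].
    elim: j => [|j [x x0 e]].
      by exists 1; rewrite ?oner_eq0 // scale1r /corr3 corr_nil /qmon !mulr1.
    exists (j.*2.+1%:R * (- 2) * x); first by rewrite !mulf_neq0 ?oppr_eq0.
    rewrite doubleS corr3_00S /= e -!scalerAl -!qscaleAr !scalerA /qmon exprS.
    by congr (_ *: _); ring.
  exists (i.*2.+1%:R * 2 * x); first by rewrite !mulf_neq0.
  rewrite doubleS corr3_0S /= e -!scalerAl -!qscaleAr !scalerA /qmon exprS.
  by congr (_ *: _); ring.
exists (k.*2.+1%:R * 2 * x); first by rewrite !mulf_neq0.
rewrite doubleS corr3S /= addrAC; apply: lspanD; last first.
  rewrite -scalerAl; apply/lspanZ/lspanZ/qmon_lt3.
  have := corr3_lt k.*2.+1 i.*2.-1 j.*2.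
  by rewrite /= uphalf_double.
have -> : qmon i j k.+1 = sigma_series 5 * qmon i j k by rewrite /qmon exprS; ring.
rewrite (_ : _ - _ =
    (k.*2.+1%:R * 2) *: (sigma_series 5 * (corr3 k.*2 i.*2 j.*2 - x *: qmon i j k))).
  by apply/lspanZ/qmon_lt5.
by rewrite mulrBr scalerBr -scalerAl scalerA -qscaleAr scalerA.
Qed.

(** The system is triangular in the exponent k. *)
Lemma qmon_Im i j k : Im (qmon i j k).
Proof.
elim/ltn_ind: k i j => k IH i j.
have sub f : qmon_lt k f -> Im f.
  elim=> [|a g {}f [i' [j' [k' [kk ->]]]] _ hf]; first exact: Im0.
  by apply: ImP => //; exact: IH.
have [x x0 /sub h] := corr3_lead i j k.
have -> : qmon i j k = (- x^-1) *: (corr3 k.*2 i.*2 j.*2 - x *: qmon i j k)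
    + (x^-1 *: corr3 k.*2 i.*2 j.*2 + 0).
  rewrite scalerBr !scaleNr scalerA mulVf // scale1r addr0 opprK addrAC addNr add0r //.
by apply: ImP => //; apply: ImP; [exact: corr3_Im|exact: Im0].
Qed.

(** The series E2, E4 and E6 are affine in [sigma_series] 1, 3 and 5, so the
    monomials in the latter span all quasi-modular forms. *)
Theorem quasi_modular_Im : quasi_modular_forms K `<=` Im.
Proof.
pose Q := lspan [set g | exists i j k, g = qmon i j k].
have Qmon i j k : Q (qmon i j k) by apply: lspan_gen; exists i, j, k.
have QM f g : Q f -> Q g -> Q (f * g).
  move=> hf; apply: lspan_mull => _ [i [j [k ->]]]; rewrite mulrC.
  move: hf; apply: lspan_mull => _ [i' [j' [k' ->]]].
  rewrite (_ : _ * _ = qmon (i + i') (j + j') (k + k')); first exact: Qmon.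
  by rewrite /qmon !exprD; ring.
have Q1 : Q 1 by have := Qmon 0%N 0%N 0%N; rewrite /qmon !mulr1.
suff h f : quasi_modular_forms K f -> Q f.
  move=> f /h; elim=> [|a g {}f [i [j [k ->]]] _ hf]; first exact: Im0.
  by apply: ImP => //; exact: qmon_Im.
have unscale (x y : K) (g E : qseries K) : x * y = 1 -> g = x *: (E - 1) -> Q g -> Q E.
  move=> xy e hg; rewrite (_ : E = y *: g + 1); last first.
    by rewrite e scalerA mulrC xy scale1r subrK.
  by apply: lspanD => //; exact: lspanZ.
elim=> [a|g [->|[->|->]]|{}f g _ hf _ hg|{}f g _ hf _ hg].
- exact: lspanZ.
- apply: (unscale _ (- 24%:R) _ _ _ (sigma_series_E2 char0)).
    by rewrite mulrNN mulVf // (char0 23).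
  by have := Qmon 1%N 0%N 0%N; rewrite /qmon !mulr1 expr1.
- apply: (unscale _ 240%:R _ _ _ (sigma_series_E4 char0)).
    by rewrite mulVf // (char0 239).
  by have := Qmon 0%N 1%N 0%N; rewrite /qmon mulr1 mul1r expr1.
- apply: (unscale _ (- 504%:R) _ _ _ (sigma_series_E6 char0)).
    by rewrite mulrNN mulVf // (char0 503).
  by have := Qmon 0%N 0%N 1%N; rewrite /qmon !mul1r expr1.
- exact: lspanD.
- exact: QM.
Qed.

End Surjectivity.

(** * The p-adic numbers *)

Lemma to_completionD (V : uNormZmodType) (x y : V) :
  to_completion (x + y) = to_completion x + to_completion y.
Proof. by rewrite /to_completion -cpiD; congr cpi; exact: val_inj. Qed.
Section QpFacts.
Variables (p : nat) (hp : prime p).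

Lemma Qp_natE n : (n%:R : Qp hp) = to_completion (n%:R : padic_rat hp).
Proof.
elim: n => [|n IH].
  by apply: esym; apply/cpi_eq0 => e e0; exists 0%N => n _; rewrite unorm0.
rewrite -natr1 IH -[in RHS]natr1 to_completionD; congr (_ + _).
by rewrite -cpi1; congr cpi; exact: val_inj.
Qed.

Lemma unorm_Qp_nat n : unorm (n%:R : Qp hp) = padic_norm p n%:R.
Proof. by rewrite Qp_natE unorm_to_completion. Qed.

Lemma Qp_char0 n : n.+1%:R != 0 :> Qp hp.
Proof.
rewrite -unorm_eq0 unorm_Qp_nat -[padic_norm p _]/(unorm (n.+1%:R : padic_rat hp)).
by rewrite unorm_eq0 pnatr_eq0.
Qed.

Lemma unorm_Qp_p : unorm (p%:R : Qp hp) = p%:R^-1.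
Proof.
rewrite unorm_Qp_nat -[p%:R in LHS]divr1 -[1]/(1%:~R) -[p%:R / _]/(p%:~R / 1%:~R).
rewrite padic_norm_frac //; last by rewrite eqz_nat -lt0n prime_gt0.
by rewrite logn1 sub0r logn_prime // eqxx.
Qed.
End QpFacts.

Theorem theorem9p7 (p : nat) (hp : prime p) (hodd : odd p) :
  exists f : {linear S1 hp -> qseries (Qp hp)},
    [/\ sup_continuous f,
        forall x : S1 hp, padic_modular_forms (Qp hp) (f x),
        forall v : heis (Qp hp),
          qshift_mul (dedekind_eta (Qp hp)) (character v) = (0, f (to_completion v)) &
        quasi_modular_forms (Qp hp) `<=` range f].
Proof.
have char0 := Qp_char0 hp; have normp := unorm_Qp_p hp.
have complete := @completion_complete (padic_rat hp).
have linF := @eta_charP (Qp hp).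
have bdF := eta_char_bounded char0.
pose f := cont_ext complete linF bdF.
pose fL := GRing.isLinear.Build (Qp hp) (S1 hp) (qseries (Qp hp)) _ f
  (cont_ext_linear complete linF bdF).
pose g : {linear S1 hp -> qseries (Qp hp)} := HB.pack f fL.
exists g; split.
- exact: cont_ext_continuous.
- by apply: cont_ext_pmf => v; exact: (eta_char_pmf hp char0 normp).
- move=> v; rewrite eta_charE; congr (_, _); apply: esym.
  exact: (cont_ext_to_completion complete linF bdF).
- move=> q /(quasi_modular_Im char0) [v _ <-]; exists (to_completion v) => //.
  exact: (cont_ext_to_completion complete linF bdF).
Qed.
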